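(* For every real $s$ with $-1/4<s<1/4$, the Cauchy problem for the defocusing modified Korteweg-de Vries equation $$u_t+u_{xxx}=6u^2u_x,\qquad u(0,x)=u_0(x),\qquad x\in\mathbb R,$$ with $u$ real-valued, is not locally well-posed in $H^s(\mathbb R)$; more precisely, the solution operator fails to be uniformly continuous with respect to the $H^s$ norm.
   Context: For every real-valued initial datum $u_0$ in the Schwartz class $\mathcal S(\mathbb R)$ there is a unique global smooth solution $u\in C^\infty_t(\mathbb R;\mathcal S(\mathbb R))$; this defines the solution map (solution operator) $S$, $Su_0:=u$, on real-valued Schwartz functions. Definition (local well-posedness). The equation is locally well-posed in $H^s(\mathbb R)$ if for every radius $R>0$ there exists a time $T=T(R)>0$ such that the solution map $S$ (restricted to Schwartz data) can be uniformly continuously and uniquely extended to a map from the ball $\{u_0\in H^s(\mathbb R):\|u_0\|_{H^s}<R\}$ (with the $H^s$ norm, real-valued functions) to the space $C^0_t((-T,T);H^s(\mathbb R))$, the latter endowed with the topology induced by the norm $\sup_{t\in(-T,T)}\|u(t)\|_{H^s}$. Failure of uniform continuity of the solution operator refers to the restriction of $S$ to Schwartz data, in these norms. *)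

(* Defs.v *)
From HB Require Import structures.
From mathcomp Require Import all_boot all_order all_algebra.
From mathcomp Require Import all_classical all_reals all_analysis.
From mathcomp Require Import complex.

Set Implicit Arguments.
Unset Strict Implicit.
Unset Printing Implicit Defensive.

Import Order.TTheory GRing.Theory Num.Theory.
Import numFieldNormedType.Exports.

Local Open Scope classical_set_scope.
Local Open Scope ring_scope.

Section schwartz_class.
Variable R : realType.
Implicit Types (f : R -> R) (u v : R -> R -> R).

Definition schwartz_seminorm (k n : nat) f : \bar R :=
  ereal_sup [set `|x ^+ k * derive1n n f x|%:E | x in [set: R]].

Definition schwartz f : Prop :=
  (forall n x, derivable (derive1n n f) x 1) /\
  (forall k n, (schwartz_seminorm k n f < +oo)%E).

(* [v] is the time derivative of the curve [t |-> u t], the difference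
   quotients converging in the Frechet topology of the Schwartz space. *)
Definition schwartz_time_derivative u v : Prop :=
  forall t k n,
    (fun h => schwartz_seminorm k n
       (fun x => h^-1 * (u (t + h) x - u t x) - v t x)) @ 0^' --> 0%E.

(* u is in C^oo_t(R; S(R)); [U j] is the j-th time derivative. *)
Definition smooth_schwartz_curve u : Prop :=
  exists U : nat -> R -> R -> R,
    [/\ U 0%N = u,
        forall j t, schwartz (U j t) &
        forall j, schwartz_time_derivative (U j) (U j.+1)].

End schwartz_class.

Section mkdv.
Variable R : realType.

(* The first argument of a space-time function is time. *)
Definition mkdv_solution (u0 : R -> R) (u : R -> R -> R) : Prop :=
  [/\ smooth_schwartz_curve u,
      forall t x, derive1 (fun t' => u t' x) t + derive1n 3 (u t) x
                  = 6 * u t x ^+ 2 * derive1 (u t) x &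
      u 0 = u0].

(* S maps each real Schwartz datum to the unique global smooth solution. *)
Definition mkdv_solution_operator (S : (R -> R) -> R -> R -> R) : Prop :=
  forall u0, schwartz u0 ->
    mkdv_solution u0 (S u0) /\ (forall u, mkdv_solution u0 u -> u = S u0).

End mkdv.

Section sobolev.
Variable R : realType.
Local Notation mu := (@lebesgue_measure R).

(* \int e^(- i x xi) f(x) dx for real-valued f *)
Definition fourier (f : R -> R) (xi : R) : R[i] :=
  Complex (\int[mu]_x (f x * cos (x * xi))) (- \int[mu]_x (f x * sin (x * xi))).

(* Real-valued distributions, represented by their action on real-valued test
   functions. Values outside the Schwartz class are irrelevant, hence the
   equality [eq_distr]. *)
Definition distr := (R -> R) -> R.

Definition eq_distr (a b : distr) : Prop :=
  forall phi, schwartz phi -> a phi = b phi.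

Definition distr_of (f : R -> R) : distr :=
  fun phi => \int[mu]_x (f x * phi x).

Definition distr_sub (a b : distr) : distr := fun phi => a phi - b phi.

Definition tempered (a : distr) : Prop :=
  (forall (c : R) phi psi, schwartz phi -> schwartz psi ->
     a (fun x => c * phi x + psi x) = c * a phi + a psi) /\
  (exists (C : R) (N : nat), forall phi, schwartz phi ->
     (`|a phi|%:E <=
        C%:E * \sum_(k < N) \sum_(n < N) schwartz_seminorm k n phi)%E).

(* The distributional Fourier transform of a is the function g: the pairing of
   g with phi equals the pairing of a with the Fourier transform of phi. Since
   a is real-valued, the real and imaginary parts separate when phi is real;
   complex test functions follow by linearity. *)
Definition has_fourier (a : distr) (g : R -> R[i]) : Prop :=
  forall phi, schwartz phi ->
    \int[mu]_xi (complex.Re (g xi) * phi xi)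
      = a (fun x => complex.Re (fourier phi x)) /\
    \int[mu]_xi (complex.Im (g xi) * phi xi)
      = a (fun x => complex.Im (fourier phi x)).

Definition hs_weighted_norm (s : R) (g : R -> R[i]) : \bar R :=
  ('N[mu]_(2%:E)
     [(fun xi : R => ((1 + xi ^+ 2) `^ (s / 2) *
                      ComplexField.Normc.normc (g xi))%R%:E)])%E.

(* The infimum only serves to select the Fourier transform, which is unique
   up to a null set; the norm is +oo when there is none. *)
Definition hs_norm (s : R) (a : distr) : \bar R :=
  ereal_inf [set hs_weighted_norm s g | g in
    [set g : R -> R[i] |
      [/\ measurable_fun setT (fun xi => complex.Re (g xi)),
          measurable_fun setT (fun xi => complex.Im (g xi)) &
          has_fourier a g]]].

Definition Hs (s : R) : set distr :=
  [set a | tempered a /\ (hs_norm s a < +oo)%E].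

Definition Hs_ball (s rho : R) : set distr :=
  [set a | Hs s a /\ (hs_norm s a < rho%:E)%E].

Definition C0_Hs (s T : R) (w : R -> distr) : Prop :=
  (forall t, t \in `]-T, T[ -> Hs s (w t)) /\
  (forall t, t \in `]-T, T[ -> forall eps, 0 < eps ->
     exists2 delta, 0 < delta & forall t', t' \in `]-T, T[ ->
       `|t' - t| < delta ->
       (hs_norm s (distr_sub (w t') (w t)) < eps%:E)%E).

(* the norm of w - w' in C^0_t((-T, T); H^s) *)
Definition C0_Hs_dist (s T : R) (w w' : R -> distr) : \bar R :=
  ereal_sup [set hs_norm s (distr_sub (w t) (w' t)) | t in `]-T, T[%classic].

End sobolev.

Section well_posedness.
Variables (R : realType) (S : (R -> R) -> R -> R -> R) (s : R).

Definition solution_distr (u0 : R -> R) (t : R) : distr R :=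
  distr_of (S u0 t).

Definition unif_continuous_extension (rho T : R)
    (Phi : distr R -> R -> distr R) : Prop :=
  [/\ forall a, Hs_ball s rho a -> C0_Hs s T (Phi a),
      forall eps, 0 < eps -> exists2 delta, 0 < delta &
        forall a b, Hs_ball s rho a -> Hs_ball s rho b ->
          (hs_norm s (distr_sub a b) < delta%:E)%E ->
          (C0_Hs_dist s T (Phi a) (Phi b) <= eps%:E)%E &
      forall u0, schwartz u0 -> Hs_ball s rho (distr_of u0) ->
        forall t, t \in `]-T, T[ ->
          eq_distr (Phi (distr_of u0) t) (solution_distr u0 t)].

Definition locally_well_posed : Prop :=
  forall rho, 0 < rho -> exists2 T, 0 < T &
    exists2 Phi, unif_continuous_extension rho T Phi &
      forall Psi, unif_continuous_extension rho T Psi ->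
        forall a, Hs_ball s rho a -> forall t, t \in `]-T, T[ ->
          eq_distr (Psi a t) (Phi a t).

Definition solution_operator_unif_continuous : Prop :=
  forall rho, 0 < rho -> exists2 T, 0 < T &
    forall eps, 0 < eps -> exists2 delta, 0 < delta &
      forall u0 v0, schwartz u0 -> schwartz v0 ->
        (hs_norm s (distr_of u0) < rho%:E)%E ->
        (hs_norm s (distr_of v0) < rho%:E)%E ->
        (hs_norm s (distr_sub (distr_of u0) (distr_of v0)) < delta%:E)%E ->
        (C0_Hs_dist s T (solution_distr u0) (solution_distr v0)
           <= eps%:E)%E.

End well_posedness.

(* Main.v *)
(** A plateau-shaped wave packet [a G(x/L) cos(N x)] evolves, to leading order,
    by the phase-corrected transport [a G(Y) cos(N x + N^3 t + (3/2) a^2 N t G(Y)^2)],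
    [Y = (x + 3 N^2 t)/L]: the amplitude enters the phase speed.  Hence two packets
    with amplitudes [a] and [(1 + del) a], which are [O(del)]-close in H^s, are out of
    phase by [pi] at a time [t] with [(3/2) a^2 N t (2 del + del^2) = pi].  With
    [a ~ N^-(s + 1/4)] and [L = N^(1/2)] both H^s norms stay of order one while
    [t ~ N^-(1/2 - 2 s)] tends to 0, and the solutions separate by a fixed H^s distance.

    The ansatz is justified after rescaling to [N = 1].  The conserved functional
    [int (u_xx + u - u^3)^2 + 4 u^2 u_x^2 + u^6] is of size [a^4 L] on such packets, so
    [u_xx + u] is small in L^2 for all times: the solution keeps oscillating at
    frequency one, which controls the error [w] in sup norm by its L^2 norm and closes the
    energy estimate for [w] up to times of order [a^-2], with an error which is small
    when [a L] is large.

    The H^s distance is bounded from below by pairing with a Gaussian wave packet,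
    whose Fourier transform is explicit; neither Plancherel's theorem nor Fourier
    inversion is needed. *)
Require Import Defs.
From HB Require Import structures.
From mathcomp Require Import all_boot all_order all_algebra.
From mathcomp Require Import all_classical all_reals all_analysis.
From mathcomp Require Import measurable_realfun gauss_integral complex ring lra.

Set Implicit Arguments.
Unset Strict Implicit.
Unset Printing Implicit Defensive.

Import Order.TTheory GRing.Theory Num.Theory.
Import numFieldNormedType.Exports.

Local Open Scope classical_set_scope.
Local Open Scope ring_scope.

(** * Derivatives *)

(** At the final time the packets carry the phases Phi G^2 and (Phi + pi) G^2, and Phi is of order
    1/del, hence large. They are opposite to each other, and locked to the phase of one fixed test
    packet, only where G is within about 1/Phi of 1. This forces a profile with a flat top whose
    half-width D is chosen after Phi, and a Gaussian test packet narrow enough (D/8 in the same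
    units) to see mainly that top.

    The order of choices is: the distance of the data fixes del, then Phi, then D, then a threshold
    for a L, and only then the frequency tends to infinity. All constants of the stability argument,
    including exp(C Phi), may therefore depend on Phi.

    The obstacle in the energy identity is the term U_x w^3, since the L2 norm of w alone does not
    control its supremum. The conserved functional has the quadratic part int (u_xx + u)^2, which
    degenerates exactly at frequency one; this supplies the missing bound. The normalised squared
    error X then obeys X' <= C a^2 (X + X^2), an inequality that integrates explicitly, so that no
    continuity argument is involved. *)

Section derivatives.
Variable R : realType.
Implicit Types (f g : R -> R) (x a b c : R).

Definition hder f x a := is_derive x (1 : R) f a.

Lemma hder_eq f x a b : hder f x a -> a = b -> hder f x b.
Proof. by move=> h <-. Qed.

Lemma hder_ext f g x a : f =1 g -> hder f x a -> hder g x a.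
Proof. by move=> /funext ->. Qed.

Lemma hder_cst c x : hder (fun=> c) x 0.
Proof. exact: is_derive_cst. Qed.

Lemma hder_id x : hder (fun y => y) x 1.
Proof. exact: is_derive_id. Qed.

Lemma hder_add f g x a b : hder f x a -> hder g x b -> hder (fun y => f y + g y) x (a + b).
Proof. by move=> h1 h2; apply: is_deriveD. Qed.

Lemma hder_opp f x a : hder f x a -> hder (fun y => - f y) x (- a).
Proof. by move=> h1; apply: is_deriveN. Qed.

Lemma hder_sub f g x a b : hder f x a -> hder g x b -> hder (fun y => f y - g y) x (a - b).
Proof. by move=> h1 h2; apply: is_deriveB. Qed.

Lemma hder_mul f g x a b : hder f x a -> hder g x b ->
  hder (fun y => f y * g y) x (a * g x + f x * b).
Proof.
move=> h1 h2; apply: (@hder_eq _ _ (f x *: b + g x *: a)); first exact: is_deriveM.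
by rewrite addrC /GRing.scale /= mulrC.
Qed.

Lemma hder_scale c f x a : hder f x a -> hder (fun y => c * f y) x (c * a).
Proof. by move=> h; apply: hder_eq (hder_mul (hder_cst c x) h) _; rewrite mul0r add0r. Qed.

Lemma hder_exp f x a n : hder f x a -> hder (fun y => f y ^+ n.+1) x (n.+1%:R * f x ^+ n * a).
Proof.
move=> h; elim: n => [|n IH].
  by apply: (hder_ext (f := f)) => [y|]; rewrite ?expr1// expr0 !mul1r.
apply: (hder_ext (f := fun y => f y * f y ^+ n.+1)) => [y|]; first by rewrite -exprS.
apply: hder_eq (hder_mul h IH) _; rewrite -[n.+2]addn1 natrD !exprS; ring.
Qed.

Lemma hder_comp f g x a b : hder g x a -> hder f (g x) b -> hder (fun y => f (g y)) x (b * a).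
Proof. by move=> h1 h2; apply: is_derive1_comp. Qed.

Lemma hder_cos f x a : hder f x a -> hder (fun y => cos (f y)) x (- sin (f x) * a).
Proof. by move=> h; apply: (hder_comp h); exact: is_derive_cos. Qed.

Lemma hder_sin f x a : hder f x a -> hder (fun y => sin (f y)) x (cos (f x) * a).
Proof. by move=> h; apply: (hder_comp h); exact: is_derive_sin. Qed.

Lemma hder_expR f x a : hder f x a -> hder (fun y => expR (f y)) x (expR (f x) * a).
Proof. by move=> h; apply: (hder_comp h); exact: is_derive_expR. Qed.

Lemma hder_inv f x a : f x != 0 -> hder f x a -> hder (fun y => (f y)^-1) x (- a / f x ^+ 2).
Proof.
move=> f0 h; apply: (@hder_eq _ _ (- (f x) ^- 2 *: a)).
  exact: is_deriveV.
by rewrite /GRing.scale /= mulNr mulNr mulrC.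
Qed.

Lemma hder_continuous f f' : (forall x, hder f x (f' x)) -> continuous f.
Proof.
move=> h x; apply: differentiable_continuous; apply/derivable1_diffP.
by have [] := h x.
Qed.

Lemma hder_derive1 f x a : hder f x a -> derive1 f x = a.
Proof. by move=> h; rewrite derive1E; exact: derive_val. Qed.

Lemma hder_derivable f x a : hder f x a -> derivable f x 1.
Proof. by case. Qed.

Lemma derivable_der f x : derivable f x 1 -> hder f x (derive1 f x).
Proof. by move=> h; split=> //; rewrite derive1E. Qed.

Lemma hder_shift f x c a : hder f (x + c) a -> hder (fun y => f (y + c)) x a.
Proof.
move=> h; rewrite -[a]mulr1; apply: (hder_comp (g := fun y => y + c)) => //.
by rewrite -[1]addr0; exact: hder_add (hder_id _) (hder_cst _ _).
Qed.

Lemma hder_ge0_le f f' a b : (forall x, a <= x <= b -> hder f x (f' x)) -> a <= b ->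
  (forall x, a <= x <= b -> 0 <= f' x) -> f a <= f b.
Proof.
move=> h ab h0; rewrite le_eqVlt in ab; case/orP: ab => [/eqP->//|ab].
have hd x : x \in `]a, b[ -> is_derive x 1 f (f' x).
  by rewrite in_itv /= => /andP[? ?]; apply: h; rewrite !ltW.
have [| c] := MVT ab hd.
  apply: derivable_within_continuous => x; rewrite in_itv/= => xab.
  exact: (hder_derivable (h x xab)).
rewrite in_itv /= => /andP[ac cb] e; rewrite -subr_ge0 e mulr_ge0 ?subr_ge0 ?(ltW ab)//.
by rewrite h0 ?ltW.
Qed.

Lemma hder_bound f f' a b C : (forall x, a <= x <= b -> hder f x (f' x)) -> a <= b ->
  (forall x, a <= x <= b -> `|f' x| <= C) -> `|f b - f a| <= C * (b - a).
Proof.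
move=> h ab hC; rewrite ler_norml; apply/andP; split.
  have h1 x : a <= x <= b -> hder (fun y => C * y + f y) x (C + f' x).
    move=> xab; apply: hder_add (h _ xab).
    by apply: hder_eq (hder_scale _ (hder_id _)) _; rewrite mulr1.
  have /= := hder_ge0_le h1 ab.
  have h2 x : a <= x <= b -> 0 <= C + f' x.
    by move=> /hC; rewrite ler_norml => /andP[? ?]; lra.
  by move=> /(_ h2); lra.
have h1 x : a <= x <= b -> hder (fun y => C * y - f y) x (C - f' x).
  move=> xab; apply: hder_sub (h _ xab).
  by apply: hder_eq (hder_scale _ (hder_id _)) _; rewrite mulr1.
have /= := hder_ge0_le h1 ab.
have h2 x : a <= x <= b -> 0 <= C - f' x.
  by move=> /hC; rewrite ler_norml => /andP[? ?]; lra.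
by move=> /(_ h2); lra.
Qed.

End derivatives.

(* Computes a derivative by recursion on the syntax of the function, leaving
   as goals the atoms that are not covered by a hypothesis. *)
Ltac hder_step :=
  lazymatch goal with
  | |- hder (fun y => y) _ _ => exact: hder_id
  | |- hder (fun y => @?f y + @?g y) _ _ =>
      refine (@hder_add _ f g _ _ _ _ _); hder_step
  | |- hder (fun y => - @?f y) _ _ => refine (@hder_opp _ f _ _ _); hder_step
  | |- hder (fun y => @?f y * @?g y) _ _ =>
      refine (@hder_mul _ f g _ _ _ _ _); hder_step
  | |- hder (fun y => @?f y ^+ ?n) _ _ => let m := eval compute in n.-1 in
      refine (@hder_exp _ f _ _ m _); hder_step
  | |- hder (fun y => cos (@?f y)) _ _ => refine (@hder_cos _ f _ _ _); hder_step
  | |- hder (fun y => sin (@?f y)) _ _ => refine (@hder_sin _ f _ _ _); hder_step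
  | |- hder (fun y => expR (@?f y)) _ _ => refine (@hder_expR _ f _ _ _); hder_step
  | _ => first
      [ exact: hder_cst
      | match goal with h : _ |- _ => solve [eapply h] end
      | idtac ]
  end.

Ltac hder_tac := eapply hder_eq; [hder_step | cbv beta].

Ltac ge0_tac := repeat first
  [ assumption | exact: sqr_ge0 | exact: ltW | exact: normr_ge0 | exact: expR_ge0
  | exact: ler0n | exact: ler01 | exact: sqrtr_ge0
  | apply: mulr_ge0 | apply: addr_ge0 | apply: exprn_ge0 | apply: divr_ge0 ].

Lemma hder_unique (R : realType) (f : R -> R) x a b : hder f x a -> hder f x b -> a = b.
Proof. by move=> /hder_derive1 <- /hder_derive1. Qed.

Section trigonometric_bounds.
Variable R : realType.
Implicit Types x y : R.

Lemma norm_cos_le1 x : `|cos x| <= 1.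
Proof. by rewrite ler_norml cos_geN1 cos_le1. Qed.

Lemma norm_sin_le1 x : `|sin x| <= 1.
Proof. by rewrite ler_norml sin_geN1 sin_le1. Qed.

End trigonometric_bounds.

(** * Integrals of functions dominated by 1/(1 + x^2) *)

Section integrals.
Variable R : realType.
Implicit Types (f g : R -> R) (x a b c k : R).
Local Notation mu := (@lebesgue_measure R).

Definition lor (x : R) : R := (1 + x ^+ 2)^-1.

Definition integ f : R := \int[mu]_x f x.

(** One class takes care of integrability throughout: it is an algebra, it is stable under affine
    substitutions and under multiplication by bounded continuous functions, and it contains the
    Schwartz functions. *)
Definition nice f := continuous f /\ exists C, forall x, `|f x| <= C * lor x.

Lemma oneD_gt0 x : 0 < 1 + x ^+ 2.
Proof. by rewrite ltr_pwDl// sqr_ge0. Qed.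

Lemma lor_gt0 x : 0 < lor x.
Proof. by rewrite invr_gt0 oneD_gt0. Qed.

Lemma lor_le1 x : lor x <= 1.
Proof. by rewrite invf_le1 ?oneD_gt0// lerDl sqr_ge0. Qed.

Lemma lor_continuous : continuous lor.
Proof. exact: continuous_oneDsqrV. Qed.

Lemma ge0_nice_const f C : (forall x, `|f x| <= C * lor x) -> 0 <= C.
Proof.
by move=> /(_ 0) h; rewrite -(@pmulr_lge0 _ (lor 0)) ?lor_gt0// (le_trans _ h).
Qed.

Lemma continuous_measurable_funT f : continuous f -> measurable_fun setT f.
Proof. by move=> cf; apply: continuous_measurable_fun. Qed.

Lemma integral_lor : (\int[mu]_x (lor x)%:E = pi%:E)%E.
Proof.
rewrite ge0_symfun_integralT//=.
- rewrite (_ : [set x | _] = `[0, +oo[%classic); last first.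
    by apply/seteqP; split => x/=; rewrite in_itv/= andbT.
  rewrite [X in (2 * X)%E](_ : _ = (pi / 2)%:E); last by rewrite -integral0y_oneDsqr.
  by rewrite -EFinM mulrCA divff// mulr1.
- by move=> x; exact: ltW (lor_gt0 x).
- exact: lor_continuous.
- by move=> x; rewrite /= /lor sqrrN.
Qed.

Lemma integrable_lor : mu.-integrable [set: R] (EFin \o lor).
Proof.
apply/integrableP; split.
  by apply/measurable_EFinP; apply: continuous_measurable_funT; exact: lor_continuous.
under eq_integral => x _ do rewrite /= ger0_norm ?(ltW (lor_gt0 x))//.
by rewrite integral_lor ltry.
Qed.

Lemma integ_lor : integ lor = pi.
Proof. by rewrite /integ /Rintegral integral_lor. Qed.

Lemma lor_integrable f C : measurable_fun setT f -> (forall x, `|f x| <= C * lor x) ->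
  mu.-integrable [set: R] (EFin \o f).
Proof.
move=> mf hC; apply: (@le_integrable _ (measurableTypeR R) R mu setT measurableT _ (EFin \o (fun x => C * lor x))) => //.
- exact/measurable_EFinP.
- move=> x _ /=; rewrite lee_fin (le_trans (hC x))// ler_norm//.
- have := integrableZl (measurableT) C integrable_lor.
  by apply: eq_integrable => // x _ /=; rewrite EFinM.
Qed.

Lemma nice_integrable f : nice f -> mu.-integrable [set: R] (EFin \o f).
Proof. by move=> [/continuous_measurable_funT cf [C hC]]; exact: lor_integrable hC. Qed.

Lemma nice_lor : nice lor.
Proof.
split; first exact: lor_continuous.
by exists 1 => x; rewrite mul1r ger0_norm ?(ltW (lor_gt0 x)).
Qed.

Lemma niceD f g : nice f -> nice g -> nice (fun x => f x + g x).
Proof.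
move=> [cf [C hC]] [cg [C' hC']]; split; first by move=> x; exact: cvgD (cf x) (cg x).
exists (C + C') => x; rewrite mulrDl (le_trans (ler_normD _ _))// lerD//.
Qed.

Lemma niceMb f g C : nice f -> continuous g -> (forall x, `|g x| <= C) ->
  nice (fun x => f x * g x).
Proof.
move=> [cf [C0 hC0]] cg hC; split; first by move=> x; exact: cvgM (cf x) (cg x).
exists (C0 * C) => x; rewrite normrM mulrAC ler_pM//.
Qed.

Lemma nice_bounded f : nice f -> exists C, forall x, `|f x| <= C.
Proof.
move=> [cf [C hC]]; exists C => x; rewrite (le_trans (hC x))// ler_piMr ?lor_le1//.
exact: ge0_nice_const hC.
Qed.

Lemma niceM f g : nice f -> nice g -> nice (fun x => f x * g x).
Proof. by move=> nf ng; have [C] := nice_bounded ng; apply: niceMb => //; case: ng. Qed.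

Lemma niceZ c f : nice f -> nice (fun x => c * f x).
Proof.
move=> nf; rewrite (_ : (fun x => _) = (fun x => f x * cst c x)); last first.
  by apply/funext => x; rewrite mulrC.
by apply: (@niceMb _ _ `|c|) => // x; exact: cvg_cst.
Qed.

Lemma niceN f : nice f -> nice (fun x => - f x).
Proof.
by move=> /(niceZ (-1)); congr nice; apply/funext => x; rewrite mulN1r.
Qed.

Lemma niceB f g : nice f -> nice g -> nice (fun x => f x - g x).
Proof. by move=> nf ng; exact: niceD nf (niceN ng). Qed.

Lemma niceX f n : nice f -> nice (fun x => f x ^+ n.+1).
Proof.
move=> nf; elim: n => [|n IH].
  by congr nice: nf; apply/funext => x; rewrite expr1.
have := niceM nf IH; congr nice; apply/funext => x; by rewrite exprS.
Qed.

Lemma nice_norm f : nice f -> nice (fun x => `|f x|).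
Proof.
move=> [cf [C hC]]; split; first by move=> x; exact: cvg_norm (cf x).
by exists C => x; rewrite normr_id.
Qed.

Lemma integD f g : nice f -> nice g -> integ (fun x => f x + g x) = integ f + integ g.
Proof. by move=> nf ng; rewrite /integ RintegralD//; exact: nice_integrable. Qed.

Lemma integB f g : nice f -> nice g -> integ (fun x => f x - g x) = integ f - integ g.
Proof. by move=> nf ng; rewrite /integ RintegralB//; exact: nice_integrable. Qed.

Lemma integZ c f : nice f -> integ (fun x => c * f x) = c * integ f.
Proof. by move=> nf; rewrite /integ RintegralZl//; exact: nice_integrable. Qed.

Lemma le_integ f g : nice f -> nice g -> (forall x, f x <= g x) -> integ f <= integ g.
Proof.
move=> nf ng fg; apply: le_Rintegral => //; exact: nice_integrable.
Qed.

Lemma integ_ge0 f : (forall x, 0 <= f x) -> 0 <= integ f.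
Proof. by move=> f0; apply: Rintegral_ge0. Qed.

Lemma norm_integ_le f g : nice f -> nice g -> (forall x, `|f x| <= g x) -> `|integ f| <= integ g.
Proof.
move=> nf ng fg; rewrite (le_trans (le_normr_Rintegral measurableT (nice_integrable nf)))//.
by apply: le_integ => //; exact: nice_norm.
Qed.

Lemma eq_integ f g : f =1 g -> integ f = integ g.
Proof. by move=> /funext ->. Qed.

Lemma lor_affine k c : k != 0 -> exists C, forall x, lor (k * x + c) <= C * lor x.
Proof.
(* With z = k x + c, the constant comes from k^2 x^2 = (z - c)^2 <= 2 z^2 + 2 c^2. *)
move=> k0; exists (1 + 2 * (1 + c ^+ 2) / k ^+ 2) => x.
rewrite /lor.
rewrite ler_pdivlMr ?oneD_gt0// mulrC ler_pdivrMr ?oneD_gt0//.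
have k2 : 0 < k ^+ 2 by rewrite exprn_even_gt0.
rewrite -(ler_pM2l k2).
have -> : k ^+ 2 * ((1 + 2 * (1 + c ^+ 2) / k ^+ 2) * (1 + (k * x + c) ^+ 2)) =
  (k ^+ 2 + 2 * (1 + c ^+ 2)) * (1 + (k * x + c) ^+ 2) by field; rewrite k0.
set z := k * x + c.
have -> : k ^+ 2 * (1 + x ^+ 2) = k ^+ 2 + (z - c) ^+ 2 by rewrite /z; ring.
have h1 : 0 <= k ^+ 2 * z ^+ 2 by rewrite mulr_ge0 ?sqr_ge0.
have h2 : 0 <= c ^+ 2 * z ^+ 2 by rewrite mulr_ge0 ?sqr_ge0.
have h3 : 0 <= (z + c) ^+ 2 by exact: sqr_ge0.
nra.
Qed.

Lemma nice_affine f k c : k != 0 -> nice f -> nice (fun x => f (k * x + c)).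
Proof.
move=> k0 [cf [C hC]]; split.
  move=> x; apply: (@continuous_comp _ _ _ (fun x => k * x + c) f); last exact: cf.
  apply: cvgD; last exact: cvg_cst.
  by apply: cvgM; [exact: cvg_cst|exact: cvg_id].
have [C' hC'] := lor_affine c k0.
exists (C * C') => x; rewrite (le_trans (hC _))// -mulrA ler_wpM2l ?(ge0_nice_const hC)//.
Qed.

Lemma ge0_integ_affine f k c : 0 < k -> nice f -> (forall x, 0 <= f x) ->
  integ (fun x => f (k * x + c)) = k^-1 * integ f.
Proof.
move=> k0 nf f0.
have dF x : hder (fun x => k * x + c) x k.
  by hder_tac; ring.
have dE : derive1 (fun x => k * x + c) = cst k by apply/funext => x; exact: hder_derive1.
have h : (\int[mu]_x (f x)%:E = \int[mu]_x ((f (k * x + c) * k)%:E))%E.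
  rewrite (@increasing_ge0_integration_by_substitutionT R (fun x => k * x + c) f) ?dE//.
  - by move=> x y xy; rewrite ltrD2r ltr_pM2l.
  - by move=> x; exact: cvg_cst.
  - exact: is_cvg_cst.
  - exact: is_cvg_cst.
  - apply/cvgrNyPle => A; near=> x.
    rewrite -lerBrDr mulrC -ler_pdivlMr//; near: x; exact: nbhs_ninfty_le.
  - apply/cvgryPge => A; near=> x.
    rewrite -lerBlDr mulrC -ler_pdivrMr//; near: x; exact: nbhs_pinfty_ge.
  - by case: nf.
have h2 : integ f = integ (fun x => k * f (k * x + c)).
  by rewrite /integ /Rintegral h; congr fine; apply: eq_integral => x _; rewrite mulrC.
rewrite h2 integZ ?mulKf ?gt_eqF//.
by apply: nice_affine => //; rewrite gt_eqF.
Unshelve. all: by end_near. Qed.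

(** Reduces to the nonnegative case by writing f as (f + |f|) - |f|. *)
Lemma integ_affine f k c : 0 < k -> nice f ->
  integ (fun x => f (k * x + c)) = k^-1 * integ f.
Proof.
move=> k0 nf; have k0' : k != 0 by rewrite gt_eqF.
have nf' := nice_norm nf.
have -> : integ (fun x => f (k * x + c)) =
  integ (fun x => (f (k * x + c) + `|f (k * x + c)|) - `|f (k * x + c)|).
  by apply: eq_integ => x; rewrite addrK.
have -> : integ f = integ (fun x => (f x + `|f x|) - `|f x|).
  by apply: eq_integ => x; rewrite addrK.
have h1 := niceD nf nf'.
rewrite !integB//; last 2 first.
- exact: (nice_affine c k0' h1).
- exact: (nice_affine c k0' nf').
rewrite (ge0_integ_affine c k0 h1) ?(ge0_integ_affine c k0 nf') ?mulrBr//.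
by move=> x; have := ler_norm (- f x); rewrite normrN; lra.
Qed.

Lemma hder_integ (f f' : R -> R -> R) t0 r C : 0 < r ->
  (forall t, `|t - t0| < r -> nice (f t)) ->
  (forall t x, `|t - t0| < r -> hder (f^~ x) t (f' t x)) ->
  (forall t x, `|t - t0| < r -> `|f' t x| <= C * lor x) ->
  hder (fun t => integ (f t)) t0 (integ (f' t0)).
Proof.
move=> r0 hf hd hC.
have itvP t : `](t0 - r), (t0 + r)[%classic t -> `|t - t0| < r.
  by rewrite /= in_itv/= ltr_distl.
have It0 : `](t0 - r), (t0 + r)[%classic t0.
  by rewrite /= in_itv /= ltrBlDr ltrDl r0.
have e1 t x : `|t - t0| < r -> partial1of2 f t x = f' t x.
  by move=> ht; rewrite /partial1of2; exact: hder_derive1 (hd _ _ ht).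
have C0 : 0 <= C by apply: (@ge0_nice_const (f' t0)) => x; apply: hC; rewrite subrr normr0.
have iC : mu.-integrable [set: R] (EFin \o (fun x => C * lor x)).
  by apply/nice_integrable/niceZ/nice_lor.
have h := @derivable_under_integral R _ _ mu f setT measurableT t0 (t0 - r) (t0 + r) It0
  (fun t ht => nice_integrable (hf _ (itvP _ ht)))
  (fun t x ht _ => hder_derivable (hd _ x (itvP _ ht)))
  (fun x => C * lor x) (fun x => mulr_ge0 C0 (ltW (lor_gt0 x))) iC.
have h' := @differentiation_under_integral R _ _ mu f setT measurableT t0 (t0 - r) (t0 + r) It0
  (fun t ht => nice_integrable (hf _ (itvP _ ht)))
  (fun t x ht _ => hder_derivable (hd _ x (itvP _ ht)))
  (fun x => C * lor x) (fun x => mulr_ge0 C0 (ltW (lor_gt0 x))) iC.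
have hb t x : `](t0 - r), (t0 + r)[%classic t -> [set: R] x -> `|partial1of2 f t x| <= C * lor x.
  by move=> /itvP ht _; rewrite e1// hC.
apply: (hder_eq (derivable_der (h hb))); rewrite (h' hb).
by apply: eq_integ => x; rewrite e1// subrr normr0.
Qed.

(** By translation invariance the integral of f(x + t) is constant in t, while its derivative at t =
    0 is the integral of f'. *)
Lemma integ_der f f' : (forall x, hder f x (f' x)) -> nice f -> nice f' -> integ f' = 0.
Proof.
move=> hd nf nf'.
have e h : integ (fun x => f (x + h)) = integ f.
  transitivity (integ (fun x => f (1 * x + h))); first by apply: eq_integ => x; rewrite mul1r.
  by rewrite integ_affine// invr1 mul1r.
have [C hC] := nf'.2.
have C0 := ge0_nice_const hC.
have h : hder (fun t => integ (fun x => f (x + t))) 0 (integ (fun x => f' (x + 0))).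
  (* The factor 4 pays for the shift: 1 + x^2 <= 4 (1 + (x + t)^2) when |t| <= 1. *)
  apply: (@hder_integ (fun t x => f (x + t)) (fun t x => f' (x + t)) 0 1 (C * 4)) => //.
  - move=> t _; have := nice_affine t (oner_neq0 _) nf; congr nice.
    by apply/funext => x; rewrite mul1r.
  - move=> t x _; apply: (hder_ext (f := fun t => f (t + x))); first by move=> s; rewrite addrC.
    by rewrite addrC; apply: hder_shift; rewrite addrC; exact: hd.
  - move=> t x; rewrite subr0 => /ltW; rewrite ler_norml => /andP[t1 t2].
    rewrite (le_trans (hC _))// -mulrA ler_wpM2l// /lor.
    rewrite ler_pdivlMr ?oneD_gt0// mulrC ler_pdivrMr ?oneD_gt0//.
    have h1 := sqr_ge0 (x + t + t).
    have h2 : t ^+ 2 <= 1 by nra.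
    nra.
have h0 : hder (fun t => integ (fun x => f (x + t))) 0 0.
  by under eq_fun do rewrite e; exact: hder_cst.
have := hder_derive1 h; rewrite (hder_derive1 h0) => ->.
by apply: eq_integ => x; rewrite addr0.
Qed.

(** The fundamental theorem of calculus on [y, x], with y so far to the left that the decay of f
    makes f y negligible. *)
Lemma nice_le_integ_der f f' x : (forall x, hder f x (f' x)) -> nice f -> nice f' ->
  f x <= integ (fun y => `|f' y|).
Proof.
move=> hd nf nf'.
have key y : y < x -> f x - f y <= integ (fun y => `|f' y|).
  move=> yx; have cf' := nf'.1.
  have e := @continuous_FTC2 R f' f y x yx (continuous_subspaceT cf').
  have e' : (\int[mu]_(z in `[y, x]) (f' z)%:E = (f x)%:E - (f y)%:E)%E.
    apply: e; last by move=> z _; exact: hder_derive1.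
    have cf : continuous f := nf.1.
    split; first by move=> z _; case: (hd z).
      exact/cvg_at_right_filter/cf.
    exact/cvg_at_left_filter/cf.
  have -> : f x - f y = \int[mu]_(z in `[y, x]) f' z by rewrite /Rintegral e'.
  have int' := nice_integrable nf'.
  have int'' := nice_integrable (nice_norm nf').
  have intS g : mu.-integrable [set: R] (EFin \o g) -> mu.-integrable `[y, x] (EFin \o g).
    by apply: integrableS.
  rewrite (le_trans (ler_norm _))//.
  rewrite (le_trans (le_normr_Rintegral _ (intS _ int')))//.
  rewrite /integ -lee_fin /Rintegral !fineK ?integrable_fin_num//; last exact: intS.
  by apply: ge0_subset_integral => //; exact: measurable_int int''.
have [C hC] := nf.2.
rewrite leNgt; apply/negP => hlt.
set e := f x - integ (fun y => `|f' y|).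
have e0 : 0 < e by rewrite subr_gt0.
have C0 := ge0_nice_const hC.
(* Here 1 + y^2 exceeds C / e, so |f y| <= C / (1 + y^2) falls below the supposed excess e. *)
pose y := - (C / e + 1 + `|x|).
have yx : y < x.
  rewrite /y ltrNl (le_lt_trans (ler_norm (- x)))// normrN ltrDr.
  by rewrite ltr_wpDl ?divr_ge0// ltW.
have := key _ yx; rewrite lerBlDl -lerBlDr -/e leNgt => /negP; apply.
rewrite (le_lt_trans (ler_norm _))// (le_lt_trans (hC _))//.
rewrite ltr_pdivrMr ?oneD_gt0//.
have h1 : 0 <= C / e by rewrite divr_ge0 // ltW.
have h2 : 1 + C / e <= 1 + y ^+ 2.
  have := normr_ge0 x; rewrite /y; nra.
rewrite (lt_le_trans _ (ler_wpM2l (ltW e0) h2))//.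
by rewrite mulrDr mulr1 mulrC divfK ?gt_eqF// ltrDr.
Qed.

Lemma integ_CS f g : nice f -> nice g ->
  (integ (fun x => f x * g x)) ^+ 2 <= integ (fun x => f x ^+ 2) * integ (fun x => g x ^+ 2).
Proof.
move=> nf ng; set F := integ (fun x => f x ^+ 2).
set G := integ (fun x => g x ^+ 2); set A := integ _.
have nff := niceX 1 nf; have ngg := niceX 1 ng; have nfg := niceM nf ng.
have G0 : 0 <= G by apply: integ_ge0 => x; exact: sqr_ge0.
have h l : 0 <= F - 2 * l * A + l ^+ 2 * G.
  have : 0 <= integ (fun x => (f x - l * g x) ^+ 2) by apply: integ_ge0 => x; exact: sqr_ge0.
  rewrite (@eq_integ _ (fun x => (f x ^+ 2 - 2 * l * (f x * g x)) + l ^+ 2 * g x ^+ 2)).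
    rewrite integD ?integB ?integZ//; try exact: niceZ; apply: niceB => //; exact: niceZ.
  by move=> x; ring.
have [G00|Gn0] := eqVneq G 0.
  (* For G = 0 the quadratic in l is affine; unless A = 0, this l would give it the value -1. *)
  have := h ((F + 1) / (2 * A)); rewrite G00 mulr0 addr0.
  have [->|A0] := eqVneq A 0; first by move=> _; rewrite expr0n /= mulr0.
  have -> : 2 * ((F + 1) / (2 * A)) * A = F + 1 by field.
  by lra.
have Gp : 0 < G by rewrite lt_def Gn0 G0.
have := h (A / G).
have -> : F - 2 * (A / G) * A + (A / G) ^+ 2 * G = (F * G - A ^+ 2) / G by field.
by rewrite pmulr_lge0 ?invr_gt0// subr_ge0.
Qed.

End integrals.

(** * L2 norms, and interpolation around frequency one *)

Section interpolation.
Variable R : realType.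
Implicit Types (f g : R -> R) (x a b c k : R).

Definition L2 f : R := Num.sqrt (integ (fun x => f x ^+ 2)).

Lemma L2_ge0 f : 0 <= L2 f. Proof. exact: sqrtr_ge0. Qed.

Lemma sqr_L2 f : L2 f ^+ 2 = integ (fun x => f x ^+ 2).
Proof. by rewrite sqr_sqrtr// integ_ge0// => x; exact: sqr_ge0. Qed.

Lemma integM_le f g : nice f -> nice g -> `|integ (fun x => f x * g x)| <= L2 f * L2 g.
Proof.
move=> nf ng; rewrite -(@ler_pXn2r _ 2)// ?nnegrE ?mulr_ge0 ?L2_ge0//.
by rewrite exprMn !sqr_L2 -normrX ger0_norm ?sqr_ge0//; exact: integ_CS.
Qed.

Lemma le_L2 f g : nice f -> nice g -> (forall x, `|f x| <= `|g x|) -> L2 f <= L2 g.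
Proof.
move=> nf ng h; rewrite ler_wsqrtr// le_integ//; [exact: (niceX 1)|exact: (niceX 1)|].
by move=> x; rewrite -(ger0_norm (sqr_ge0 (f x))) -(ger0_norm (sqr_ge0 (g x))) !normrX lerXn2r ?nnegrE.
Qed.

Lemma L2_add f g : nice f -> nice g -> L2 (fun x => f x + g x) <= L2 f + L2 g.
Proof.
move=> nf ng; have nff := niceX 1 nf; have ngg := niceX 1 ng; have nfg := niceM nf ng.
rewrite -(@ler_pXn2r _ 2)// ?nnegrE ?addr_ge0 ?L2_ge0//.
rewrite sqrrD !sqr_L2 (@eq_integ _ _ (fun x => (f x ^+ 2 + 2 * (f x * g x)) + g x ^+ 2)); last first.
  by move=> x; ring.
rewrite integD//; last by apply: niceD => //; exact: niceZ.
rewrite integD//; last exact: niceZ.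
rewrite integZ// lerD2r lerD2l -[leRHS]mulr_natl ler_pM2l//.
exact: le_trans (ler_norm _) (integM_le nf ng).
Qed.

Lemma L2_scale c f : nice f -> L2 (fun x => c * f x) = `|c| * L2 f.
Proof.
move=> nf; rewrite /L2 -sqrtr_sqr -sqrtrM ?sqr_ge0// -integZ; last exact: (niceX 1).
by congr Num.sqrt; apply: eq_integ => x; rewrite exprMn.
Qed.

Lemma L2_norm f : L2 (fun x => `|f x|) = L2 f.
Proof. by congr Num.sqrt; apply: eq_integ => x; rewrite real_normK ?num_real. Qed.

Variables (w0 w1 w2 : R -> R).
Hypotheses (n0 : nice w0) (n1 : nice w1) (n2 : nice w2).
Hypothesis d0 : forall x, hder w0 x (w1 x).
Hypothesis d1 : forall x, hder w1 x (w2 x).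
Let z x := w2 x + w0 x.

(** The function (w0 w1)' = w1^2 + w0 z - w0^2 has integral zero. *)
Lemma L2_der_interp : L2 w1 ^+ 2 <= L2 w0 ^+ 2 + L2 w0 * L2 z.
Proof.
have nz : nice z by exact: niceD.
have n00 := niceX 1 n0; have n11 := niceX 1 n1.
have h : integ (fun x => (w1 x ^+ 2 + w0 x * z x) - w0 x ^+ 2) = 0.
  apply: (@integ_der _ (fun x => w0 x * w1 x)); last 2 first.
  - exact: niceM.
  - by apply: niceB => //; apply: niceD => //; exact: niceM.
  - by move=> x; hder_tac; rewrite /z; ring.
rewrite integB// in h; last by apply: niceD => //; exact: niceM.
rewrite integD// in h; last exact: niceM.
rewrite !sqr_L2.
have := integM_le n0 nz; rewrite ler_norml => /andP[h1 h2]; lra.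
Qed.

(* The sum [w0^2 + w1^2] is the energy of a harmonic oscillator, whose
   derivative only sees the defect [z = w2 + w0]. *)
Lemma sup_interp x : w0 x ^+ 2 + w1 x ^+ 2 <= 2 * (L2 w1 * L2 z).
Proof.
have nz : nice z by exact: niceD.
have n00 := niceX 1 n0; have n11 := niceX 1 n1.
have /= := @nice_le_integ_der _ (fun x => w0 x ^+ 2 + w1 x ^+ 2) (fun x => 2 * (w1 x * z x)) x.
have n3 : nice (fun x => 2 * (w1 x * z x)) by apply: niceZ; exact: niceM.
move=> h; apply: le_trans (h _ _ n3) _.
- by move=> y; hder_tac; rewrite /z; ring.
- exact: niceD.
rewrite (@eq_integ _ _ (fun y => 2 * (`|w1 y| * `|z y|))); last first.
  by move=> y; rewrite !normrM ger0_norm.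
rewrite integZ ?ler_pM2l//; last by apply: niceM; exact: nice_norm.
rewrite (le_trans (ler_norm _))// (le_trans (integM_le _ _)) ?L2_norm//; exact: nice_norm.
Qed.

End interpolation.

(** * Domination locally uniform in time *)

Section local_domination.
Variable R : realType.
Implicit Types (f g : R -> R -> R) (c t : R).

(** One constant serves all times near t0; this is what differentiating an integral with respect to
    time requires. *)
Definition lnice t0 f := exists2 r : R, 0 < r & exists C, forall t, `|t - t0| < r ->
  continuous (f t) /\ forall x, `|f t x| <= C * lor x.

Lemma lnice_nice t0 f : lnice t0 f -> nice (f t0).
Proof.
by move=> [r r0 [C h]]; have [|? ?] := h t0; [rewrite subrr normr0|split=> //; exists C].
Qed.

Lemma lniceD t0 f g : lnice t0 f -> lnice t0 g -> lnice t0 (fun t x => f t x + g t x).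
Proof.
move=> [r r0 [C h]] [r' r'0 [C' h']]; exists (Num.min r r'); first by rewrite lt_min r0.
exists (C + C') => t; rewrite lt_min => /andP[/h[c b] /h'[c' b']].
split; first by move=> x; exact: cvgD (c x) (c' x).
by move=> x; rewrite mulrDl (le_trans (ler_normD _ _))// lerD.
Qed.

Lemma lniceM t0 f g : lnice t0 f -> lnice t0 g -> lnice t0 (fun t x => f t x * g t x).
Proof.
move=> [r r0 [C h]] [r' r'0 [C' h']]; exists (Num.min r r'); first by rewrite lt_min r0.
exists (C * C') => t; rewrite lt_min => /andP[/h[c b] /h'[c' b']].
split; first by move=> x; exact: cvgM (c x) (c' x).
move=> x; rewrite normrM mulrAC ler_pM// (le_trans (b' x))// ler_piMr ?lor_le1//.
exact: ge0_nice_const b'.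
Qed.

Lemma lniceZ t0 c f : lnice t0 f -> lnice t0 (fun t x => c * f t x).
Proof.
move=> [r r0 [C h]]; exists r => //; exists (`|c| * C) => t /h[k b].
split; first by move=> x; apply: cvgM (k x); exact: cvg_cst.
by move=> x; rewrite normrM -mulrA ler_wpM2l.
Qed.

Lemma lniceN t0 f : lnice t0 f -> lnice t0 (fun t x => - f t x).
Proof.
move=> [r r0 [C h]]; exists r => //; exists C => t /h[k b].
split; first by move=> x; exact: cvgN (k x).
by move=> x; rewrite normrN.
Qed.

Lemma lniceX t0 f n : lnice t0 f -> lnice t0 (fun t x => f t x ^+ n.+1).
Proof.
move=> nf; elim: n => [|n IH]; first exact: nf.
by have := lniceM nf IH; congr lnice.
Qed.

Lemma lnice_der_integ (f f' : R -> R -> R) t0 : lnice t0 f -> lnice t0 f' ->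
  (forall t x, hder (f^~ x) t (f' t x)) ->
  hder (fun t => integ (f t)) t0 (integ (f' t0)).
Proof.
move=> [r r0 [C h]] [r' r'0 [C' h']] hd.
apply: (@hder_integ _ f f' t0 (Num.min r r') C').
- by rewrite lt_min r0.
- by move=> t; rewrite lt_min => /andP[/h[? ?] _]; split=> //; exists C.
- by move=> t x _; exact: hd.
- by move=> t x; rewrite lt_min => /andP[_ /h'[]].
Qed.

End local_domination.

Ltac lnice_step :=
  lazymatch goal with
  | |- lnice _ (fun t x => @?f t x + @?g t x) => refine (@lniceD _ _ f g _ _); lnice_step
  | |- lnice _ (fun t x => - @?f t x) => refine (@lniceN _ _ f _); lnice_step
  | |- lnice _ (fun t x => @?f t x * @?g t x) =>
     first [ refine (@lniceZ _ _ _ g _) | refine (@lniceM _ _ f g _ _) ]; lnice_step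
  | |- lnice _ (fun t x => @?f t x ^+ ?n) =>
      let m := eval compute in n.-1 in
      refine (@lniceX _ _ f m _); lnice_step
  | _ => match goal with
    | h : forall s, lnice s _ |- _ => refine (h _)
    | h : forall n s, lnice s _ |- _ => refine (h _ _)
    end
  end.
Ltac lnice_tac := lnice_step.

(** * Conservation law and energy identity *)

Section mkdv_family.
Variable R : realType.

(* [v n] is the n-th space derivative of a solution. *)
Record mkdv_family (v : nat -> R -> R -> R) : Prop := MkdvFamily {
  fam_x : forall n t x, hder (v n t) x (v n.+1 t x);
  fam_nice : forall n t, lnice t (v n);
  fam_t0 : forall t x, hder ((v 0%N)^~ x) t (6 * v 0%N t x ^+ 2 * v 1%N t x - v 3%N t x);
  fam_t1 : forall t x, hder ((v 1%N)^~ x) t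
    (12 * v 0%N t x * v 1%N t x ^+ 2 + 6 * v 0%N t x ^+ 2 * v 2%N t x - v 4%N t x);
  fam_t2 : forall t x, hder ((v 2%N)^~ x) t
    (12 * v 1%N t x ^+ 3 + 36 * v 0%N t x * v 1%N t x * v 2%N t x
     + 6 * v 0%N t x ^+ 2 * v 3%N t x - v 5%N t x) }.

Variable v : nat -> R -> R -> R.
Hypothesis hv : mkdv_family v.

(** Up to total derivatives this is the density of E2 - 2 E + M, where M = int u^2, E = int u_x^2 +
    u^4 and E2 = int u_xx^2 + 10 u^2 u_x^2 + 2 u^6 are the first conserved quantities of the
    equation. The quadratic part has the symbol (xi^2 - 1)^2, and the defocusing sign lets the
    remainder be arranged into nonnegative terms. *)
Definition kdens t x := (v 2%N t x + v 0%N t x - v 0%N t x ^+ 3) ^+ 2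
  + 4 * (v 0%N t x ^+ 2 * v 1%N t x ^+ 2) + v 0%N t x ^+ 6.

Lemma kdens_conserved t : integ (kdens t) = integ (kdens 0).
Proof.
have hx := fam_x hv; have hn := fam_nice hv.
have h0 := fam_t0 hv; have h1 := fam_t1 hv; have h2 := fam_t2 hv.
pose T0 t x := 6 * v 0%N t x ^+ 2 * v 1%N t x - v 3%N t x.
pose T1 t x := 12 * v 0%N t x * v 1%N t x ^+ 2 + 6 * v 0%N t x ^+ 2 * v 2%N t x - v 4%N t x.
pose T2 t x := 12 * v 1%N t x ^+ 3 + 36 * v 0%N t x * v 1%N t x * v 2%N t x
     + 6 * v 0%N t x ^+ 2 * v 3%N t x - v 5%N t x.
have n0 s : lnice s T0 by rewrite /T0; lnice_tac.
have n1 s : lnice s T1 by rewrite /T1; lnice_tac.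
have n2 s : lnice s T2 by rewrite /T2; lnice_tac.
pose kt t x := 2 * (v 2%N t x + v 0%N t x - v 0%N t x ^+ 3) *
    (T2 t x + T0 t x - 3 * v 0%N t x ^+ 2 * T0 t x)
  + 4 * (2 * v 0%N t x * T0 t x * v 1%N t x ^+ 2 + v 0%N t x ^+ 2 * (2 * v 1%N t x * T1 t x))
  + 6 * v 0%N t x ^+ 5 * T0 t x.
have hk s x : hder (kdens^~ x) s (kt s x).
  rewrite /kdens; eapply hder_eq.
    hder_step.
  rewrite /kt /T0 /T1 /T2; cbv beta; ring.
have nk s : lnice s kdens by rewrite /kdens; lnice_tac.
have nkt s : lnice s kt by rewrite /kt; lnice_tac.
have hK s : hder (fun t => integ (kdens t)) s 0.
  have -> : 0 = integ (kt s); last exact: lnice_der_integ.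
  (* An explicit flux: the time derivative [kt] of the density equals the x-derivative of q, a
     polynomial identity in the space derivatives of v. *)
  pose q t x := v 1%N t x ^+ 2 - 2 * (v 0%N t x * v 2%N t x) + 3 * v 0%N t x ^+ 4
    - 2 * v 2%N t x ^+ 2 + 2 * (v 1%N t x * v 3%N t x) - 2 * (v 0%N t x * v 4%N t x)
    + 12 * (v 0%N t x ^+ 2 * v 1%N t x ^+ 2) + 20 * (v 0%N t x ^+ 3 * v 2%N t x)
    - 8 * v 0%N t x ^+ 6 + v 3%N t x ^+ 2 - 2 * (v 2%N t x * v 4%N t x) + v 1%N t x ^+ 4
    + 20 * (v 0%N t x * v 1%N t x ^+ 2 * v 2%N t x) + 16 * (v 0%N t x ^+ 2 * v 2%N t x ^+ 2)
    - 14 * (v 0%N t x ^+ 2 * v 1%N t x * v 3%N t x) + 2 * (v 0%N t x ^+ 3 * v 4%N t x)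
    + 30 * (v 0%N t x ^+ 4 * v 1%N t x ^+ 2) - 24 * (v 0%N t x ^+ 5 * v 2%N t x)
    + 9 * v 0%N t x ^+ 8.
  symmetry; apply: (@integ_der _ (q s)).
  - move=> x; rewrite /q; eapply hder_eq.
      hder_step.
    rewrite /kt /T0 /T1 /T2; cbv beta; ring.
  - by apply: (@lnice_nice _ s q); rewrite /q; lnice_tac.
  - exact: lnice_nice (nkt s).
have [t0|t0] := leP 0 t.
  have := @hder_bound _ (fun t => integ (kdens t)) (fun=> 0) 0 t 0 (fun s _ => hK s) t0.
  have hz (x : R) : 0 <= x <= t -> `|0 : R| <= 0 by rewrite normr0.
  by move=> /(_ hz); rewrite mul0r normr_le0 subr_eq0 => /eqP.
have := @hder_bound _ (fun t => integ (kdens t)) (fun=> 0) t 0 0 (fun s _ => hK s) (ltW t0).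
have hz (x : R) : t <= x <= 0 -> `|0 : R| <= 0 by rewrite normr0.
by move=> /(_ hz); rewrite mul0r normr_le0 subr_eq0 => /eqP.
Qed.

Lemma kdens_ge t x : (v 2%N t x + v 0%N t x - v 0%N t x ^+ 3) ^+ 2 <= kdens t x /\
  (v 0%N t x ^+ 3) ^+ 2 <= kdens t x.
Proof.
have h1 : 0 <= v 0%N t x ^+ 2 * v 1%N t x ^+ 2 by rewrite mulr_ge0 ?sqr_ge0.
have h2 : 0 <= (v 0%N t x ^+ 3) ^+ 2 by exact: sqr_ge0.
have h3 := sqr_ge0 (v 2%N t x + v 0%N t x - v 0%N t x ^+ 3).
rewrite /kdens (exprM _ 3 2); move: h1 h2 h3; set a := _ ^+ 2; set b := (_ ^+ 3) ^+ 2; set d := _ * _.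
by split; lra.
Qed.

(** The defect is the sum of v_xx + v - v^3 and v^3, whose squares are both dominated by the
    conserved density; hence the factor 2. *)
Lemma L2_defect t : L2 (fun x => v 2%N t x + v 0%N t x) <= 2 * Num.sqrt (integ (kdens 0)).
Proof.
have hn := fam_nice hv.
have n0 : nice (v 0%N t) := lnice_nice (hn _ _).
have n2 : nice (v 2%N t) := lnice_nice (hn _ _).
have n3 : nice (fun x => v 0%N t x ^+ 3) := niceX 2 n0.
have na : nice (fun x => v 2%N t x + v 0%N t x - v 0%N t x ^+ 3).
  by apply: niceB => //; exact: niceD.
have nk : nice (kdens t) by apply: lnice_nice; rewrite /kdens; lnice_tac.
have -> : L2 (fun x => v 2%N t x + v 0%N t x) =
   L2 (fun x => (v 2%N t x + v 0%N t x - v 0%N t x ^+ 3) + v 0%N t x ^+ 3).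
  by congr L2; apply/funext => x; rewrite subrK.
apply: le_trans (L2_add na n3) _.
rewrite -(kdens_conserved t) (mulr_natl _ 2) mulr2n; apply: lerD.
  rewrite ler_wsqrtr// le_integ//; first exact: (niceX 1).
  by move=> x; have [] := kdens_ge t x.
rewrite ler_wsqrtr// le_integ//; first exact: (niceX 1).
by move=> x; have [] := kdens_ge t x.
Qed.

(* An approximate solution U with residual [Ut + U3 - 6 U0^2 U1]. *)
Variables (U : nat -> R -> R -> R) (Ut : R -> R -> R).
Hypothesis Ux : forall n t x, (n < 3)%N -> hder (U n t) x (U n.+1 t x).
Hypothesis Un : forall n t, (n < 4)%N -> lnice t (U n).
Hypothesis Utn : forall t, lnice t Ut.
Hypothesis Utd : forall t x, hder ((U 0%N)^~ x) t (Ut t x).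

Let w n t x := v n t x - U n t x.
Let F t x := Ut t x + U 3%N t x - 6 * U 0%N t x ^+ 2 * U 1%N t x.

(** The dispersive term and all terms with a derivative of w combine into the x-derivative of the
    polynomial q below. What remains contains derivatives of U only, so no derivative of the error
    is lost. *)
Lemma energy_der t : hder (fun t => integ (fun x => w 0%N t x ^+ 2)) t
  (integ (fun x => 12 * (U 0%N t x * U 1%N t x * w 0%N t x ^+ 2)
    + 4 * (U 1%N t x * w 0%N t x ^+ 3) - 2 * (w 0%N t x * F t x))).
Proof.
have hx := fam_x hv; have hn := fam_nice hv; have h0 := fam_t0 hv.
have u0 s := Un s (isT : (0 < 4)%N); have u1 s := Un s (isT : (1 < 4)%N).
have u2 s := Un s (isT : (2 < 4)%N); have u3 s := Un s (isT : (3 < 4)%N).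
have ux0 s x := Ux s x (isT : (0 < 3)%N); have ux1 s x := Ux s x (isT : (1 < 3)%N).
have ux2 s x := Ux s x (isT : (2 < 3)%N).
have nF s : lnice s F by rewrite /F; lnice_tac.
have nw n s : (n < 4)%N -> lnice s (w n) by move=> n4; have un r := @Un n r n4; rewrite /w; lnice_tac.
have w0 s := nw _ s (isT : (0 < 4)%N); have w1 s := nw _ s (isT : (1 < 4)%N).
have w2 s := nw _ s (isT : (2 < 4)%N); have w3 s := nw _ s (isT : (3 < 4)%N).
have wx n s x : (n < 3)%N -> hder (w n s) x (w n.+1 s x).
  by move=> n3; have un := Ux s x n3; rewrite /w; hder_tac.
have wx0 s x := wx _ s x (isT : (0 < 3)%N); have wx1 s x := wx _ s x (isT : (1 < 3)%N).
(* Apart from the dispersive part, q comes from 2 w times the nonlinearity, that is 4 w (3 U^2 w + 3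
   U w^2 + w^3)_x, after moving the derivative off w. *)
pose q t x := w 1%N t x ^+ 2 - 2 * (w 0%N t x * w 2%N t x) + 6 * (U 0%N t x ^+ 2 * w 0%N t x ^+ 2)
  + 8 * (U 0%N t x * w 0%N t x ^+ 3) + 3 * w 0%N t x ^+ 4.
pose q' t x := - 2 * (w 0%N t x * w 3%N t x)
  + 6 * (2 * U 0%N t x * U 1%N t x * w 0%N t x ^+ 2 + U 0%N t x ^+ 2 * (2 * w 0%N t x * w 1%N t x))
  + 8 * (U 1%N t x * w 0%N t x ^+ 3 + U 0%N t x * (3 * w 0%N t x ^+ 2 * w 1%N t x))
  + 3 * (4 * w 0%N t x ^+ 3 * w 1%N t x).
pose e t x := 12 * (U 0%N t x * U 1%N t x * w 0%N t x ^+ 2)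
    + 4 * (U 1%N t x * w 0%N t x ^+ 3) - 2 * (w 0%N t x * F t x).
have ne s : lnice s e by rewrite /e; lnice_tac.
have nq s : lnice s q by rewrite /q; lnice_tac.
have nq' s : lnice s q' by rewrite /q'; lnice_tac.
have hq s x : hder (q s) x (q' s x).
  have wx2 := wx 2%N s x isT.
  rewrite /q; eapply hder_eq; first by hder_step.
  rewrite /q'; cbv beta; ring.
have hI : integ (q' t) = 0.
  by apply: (@integ_der _ (q t)) => //; exact: lnice_nice.
have -> : integ (fun x => e t x) = integ (fun x => e t x + q' t x).
  by have := integD (lnice_nice (ne t)) (lnice_nice (nq' t)); rewrite hI addr0 => ->.
apply: (@lnice_der_integ _ (fun s x => w 0%N s x ^+ 2) (fun s x => e s x + q' s x)).
- by lnice_tac.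
- by lnice_tac.
- move=> s x; have wt : hder ((w 0%N)^~ x) s (6 * v 0%N s x ^+ 2 * v 1%N s x - v 3%N s x - Ut s x).
    by rewrite /w; hder_tac.
  eapply hder_eq; first by hder_step.
  rewrite /e /q' /F /w; cbv beta; ring.
Qed.

End mkdv_family.

(** * Stability of approximate solutions *)

Section stability.
Variable R : realType.
Variables (a L B T : R) (v : nat -> R -> R -> R).
Variables (U : nat -> R -> R -> R) (Ut : R -> R -> R).
Hypothesis hv : mkdv_family v.
Hypothesis Ux : forall n t x, (n < 3)%N -> hder (U n t) x (U n.+1 t x).
Hypothesis Un : forall n t, (n < 4)%N -> lnice t (U n).
Hypothesis Utn : forall t, lnice t Ut.
Hypothesis Utd : forall t x, hder ((U 0%N)^~ x) t (Ut t x).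

Let w n t x := v n t x - U n t x.
Let F t x := Ut t x + U 3%N t x - 6 * U 0%N t x ^+ 2 * U 1%N t x.

(** Sizes for a packet of frequency one, amplitude a and length L: its envelope has L2 norm of order
    a sqrt L, the defect U_xx + U is of pointwise size a^2, the residual a/L^2, and the initial
    error a^3. *)
Hypotheses (a0 : 0 < a) (L0 : 0 < L) (B1 : 1 <= B) (aL1 : a ^+ 2 * L <= 1).
Hypothesis U0b : forall t x : R, 0 <= t <= T -> `|U 0%N t x| <= B * a.
Hypothesis U1b : forall t x : R, 0 <= t <= T -> `|U 1%N t x| <= B * a.
Hypothesis Uzb : forall t : R, 0 <= t <= T ->
  L2 (fun x => U 2%N t x + U 0%N t x) <= B * a ^+ 2 * Num.sqrt L.
Hypothesis Fb : forall t : R, 0 <= t <= T -> L2 (F t) <= B * (a / L ^+ 2) * Num.sqrt L.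
Hypothesis kb : integ (kdens v 0) <= (B * a ^+ 2 * Num.sqrt L) ^+ 2.
Hypothesis w0b : L2 (w 0%N 0) <= B * a ^+ 3 * Num.sqrt L.

Let Q := Num.sqrt L.
Let Q0 : 0 < Q. Proof. by rewrite sqrtr_gt0. Qed.
Let QL : Q ^+ 2 = L. Proof. by rewrite sqr_sqrtr// ltW. Qed.
Let B0 : 0 < B. Proof. exact: lt_le_trans B1. Qed.

Let wn n t : (n < 4)%N -> lnice t (w n).
Proof.
move=> n4; have hn := fam_nice hv; have un r := @Un n r n4.
by rewrite /w; lnice_tac.
Qed.

Let wx n t x : (n < 3)%N -> hder (w n t) x (w n.+1 t x).
Proof.
by move=> n3; have hx := fam_x hv; have un := Ux t x n3; rewrite /w; hder_tac.
Qed.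

(** Both v and U have a defect of order a^2 sqrt L in L2, the former by conservation, hence so has
    w. Interpolation then bounds the supremum of w by its L2 norm; a^2 L <= 1 puts the bound in this
    form. *)
Lemma stability_sup (t x : R) : 0 <= t <= T ->
  `|w 0%N t x| <= 5 * B * a * (1 + Q * L2 (w 0%N t)).
Proof.
move=> tT.
have n0 := lnice_nice (wn t (isT : (0 < 4)%N)).
have n1 := lnice_nice (wn t (isT : (1 < 4)%N)).
have n2 := lnice_nice (wn t (isT : (2 < 4)%N)).
have d0 y := wx t y (isT : (0 < 3)%N).
have d1 y := wx t y (isT : (1 < 3)%N).
have := sup_interp n0 n1 n2 d0 d1 x; have := L2_der_interp n0 n1 n2 d0 d1.
set Z := L2 (fun x => _ + _); set r := L2 (w 0%N t); set p := L2 (w 1%N t).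
have Zb : Z <= 3 * B * a ^+ 2 * Q.
  have nu0 := lnice_nice (@Un 0%N t isT); have nu2 := lnice_nice (@Un 2%N t isT).
  have nv0 := lnice_nice (fam_nice hv 0%N t); have nv2 := lnice_nice (fam_nice hv 2%N t).
  have -> : Z = L2 (fun x => (v 2%N t x + v 0%N t x) + -1 * (U 2%N t x + U 0%N t x)).
    by congr L2; apply/funext => y; rewrite /w; ring.
  apply: le_trans (L2_add _ _) _.
  - exact: niceD.
  - by apply: niceZ; exact: niceD.
  rewrite L2_scale; last exact: niceD.
  rewrite normrN normr1 mul1r; have := Uzb tT.
  have h1 := L2_defect hv t.
  have h2 : Num.sqrt (integ (kdens v 0)) <= B * a ^+ 2 * Q.
    rewrite -[leRHS]ger0_norm; last by ge0_tac.
    by rewrite -sqrtr_sqr ler_wsqrtr.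
  rewrite -/Q; lra.
have Zge : 0 <= Z := L2_ge0 _.
have r0 : 0 <= r := L2_ge0 _.
have p0 : 0 <= p := L2_ge0 _.
move=> hp hs.
have hp' : p <= r + 3 * B * a ^+ 2 * Q.
  rewrite -(@ler_pXn2r _ 2)// ?nnegrE; last by rewrite (le_trans p0)// (le_trans _ (lerD (lexx _) Zb))// -(@ler_pXn2r _ 2)// ?nnegrE ?addr_ge0//; nra.
  apply: le_trans hp _.
  have : r * Z <= r * (3 * B * a ^+ 2 * Q) by rewrite ler_wpM2l.
  have : 0 <= r * (3 * B * a ^+ 2 * Q) by ge0_tac.
  have : 0 <= (3 * B * a ^+ 2 * Q) ^+ 2 by exact: sqr_ge0.
  by rewrite sqrrD; lra.
have hs' : w 0%N t x ^+ 2 <= 2 * ((r + 3 * B * a ^+ 2 * Q) * (3 * B * a ^+ 2 * Q)).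
  have := sqr_ge0 (w 1%N t x); have : p * Z <= (r + 3 * B * a ^+ 2 * Q) * (3 * B * a ^+ 2 * Q).
    by rewrite ler_pM.
  lra.
rewrite -(@ler_pXn2r _ 2)// ?nnegrE; last first.
  by rewrite !mulr_ge0 ?addr_ge0 ?mulr_ge0 ?(ltW B0) ?(ltW a0) ?(ltW Q0).
rewrite -normrX ger0_norm ?sqr_ge0//; apply: le_trans hs' _.
have -> : 2 * ((r + 3 * B * a ^+ 2 * Q) * (3 * B * a ^+ 2 * Q)) =
  a ^+ 2 * (B * 6 * (Q * r) + 18 * B ^+ 2 * (a ^+ 2 * L)) by rewrite -QL; ring.
rewrite [leRHS](_ : _ = a ^+ 2 * (25 * (B ^+ 2 * (1 + Q * r) ^+ 2))); last by ring.
rewrite ler_wpM2l ?sqr_ge0//.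
set rho := Q * r.
have rho0 : 0 <= rho by rewrite mulr_ge0// ltW.
have h1 : B * rho <= B ^+ 2 * rho by rewrite expr2 -mulrA ler_peMl// mulr_ge0// ltW.
have h2 : B ^+ 2 * (a ^+ 2 * L) <= B ^+ 2 by rewrite ler_piMr ?sqr_ge0.
have h3 : 0 <= B ^+ 2 * rho ^+ 2 by rewrite mulr_ge0 ?sqr_ge0.
have h4 : 0 <= B ^+ 2 := sqr_ge0 _.
have h5 : 0 <= B ^+ 2 * rho by rewrite mulr_ge0.
nra.
Qed.

Let y t := integ (fun x => w 0%N t x ^+ 2).
(** The offset (a L)^-2 has the size of the forcing by the residual. It absorbs the term linear in
    the error norm, and it keeps X positive so that 1/X can be differentiated. *)
Let X t := L * y t + (a * L) ^- 2.

Let y0 t : 0 <= y t. Proof. by apply: integ_ge0 => x; exact: sqr_ge0. Qed.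
Let eta0 : 0 < (a * L) ^- 2. Proof. by rewrite invr_gt0 exprn_gt0// mulr_gt0. Qed.
Let X0 t : 0 < X t.
Proof. by rewrite /X ltr_wpDl// mulr_ge0 ?(ltW L0). Qed.

(** With rho^2 = L y, the energy identity and the bound on the supremum give X' <= 34 B^2 a^2 (1 +
    rho) X, and 1 + rho <= 2 (1 + X). Division by X^2 makes the resulting Bernoulli inequality
    linear in 1/X. *)
Lemma stability_ode (t X' : R) : 0 <= t <= T -> hder X t X' ->
  X' / X t ^+ 2 <= 68 * B ^+ 2 * a ^+ 2 * ((X t)^-1 + 1).
Proof.
move=> tT hX.
have nw : lnice t (w 0%N) by exact: wn.
have nF : lnice t F.
  have u0 s := @Un 0%N s isT; have u1 s := @Un 1%N s isT; have u3 s := @Un 3%N s isT.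
  by rewrite /F; lnice_tac.
have nu0 : lnice t (U 0%N) by exact: Un.
have nu1 : lnice t (U 1%N) by exact: Un.
have hX' : X' = L * integ (fun x => 12 * (U 0%N t x * U 1%N t x * w 0%N t x ^+ 2)
    + 4 * (U 1%N t x * w 0%N t x ^+ 3) - 2 * (w 0%N t x * F t x)).
  rewrite -(hder_derive1 hX); apply: hder_derive1.
  have hy := energy_der hv Ux Un Utn Utd t.
  rewrite /X /y; eapply hder_eq; first by hder_step.
  by cbv beta; ring.
set r := L2 (w 0%N t); set rho := Q * r.
have r0 : 0 <= r := L2_ge0 _.
have rho0 : 0 <= rho by rewrite mulr_ge0// ltW.
have yr : y t = r ^+ 2 by rewrite sqr_L2.
have ryL : L * y t = rho ^+ 2 by rewrite yr exprMn QL.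
have h : X' <= a ^+ 2 * (12 * B ^+ 2 * rho ^+ 2 + 20 * B ^+ 2 * (1 + rho) * rho ^+ 2
   + 2 * B * rho * (a * L)^-1).
  have h1 : integ (fun x => 12 * (U 0%N t x * U 1%N t x * w 0%N t x ^+ 2)
    + 4 * (U 1%N t x * w 0%N t x ^+ 3) - 2 * (w 0%N t x * F t x)) <=
    (12 * B ^+ 2 * a ^+ 2 + 20 * B ^+ 2 * a ^+ 2 * (1 + rho)) * y t
    + 2 * (r * (B * (a / L ^+ 2) * Q)).
    have nA : nice (fun x => 12 * (U 0%N t x * U 1%N t x * w 0%N t x ^+ 2)
       + 4 * (U 1%N t x * w 0%N t x ^+ 3)).
      apply: (@lnice_nice _ t (fun t x => 12 * (U 0%N t x * U 1%N t x * w 0%N t x ^+ 2)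
       + 4 * (U 1%N t x * w 0%N t x ^+ 3))).
      have u0 s := @Un 0%N s isT; have u1 s := @Un 1%N s isT.
      have w0 s := @wn 0%N s isT.
      by lnice_tac.
    have nwF : nice (fun x => w 0%N t x * F t x) by apply: niceM; exact: lnice_nice.
    have nw2 : nice (fun x => w 0%N t x ^+ 2) := niceX 1 (lnice_nice nw).
    rewrite integB//; last exact: niceZ.
    apply: lerD.
      rewrite /y -integZ//; apply: le_integ => //; first exact: niceZ.
      move=> x; have u0 := U0b x tT; have u1 := U1b x tT; have ws := stability_sup x tT.
      have w2 : 0 <= w 0%N t x ^+ 2 := sqr_ge0 _.
      rewrite [leRHS]mulrDl; apply: lerD.
        rewrite -[leRHS]mulrA -[leRHS]mulrA ler_pM2l//.
        rewrite (_ : B ^+ 2 * _ = (B * a) * (B * a) * w 0%N t x ^+ 2); last by ring.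
        by rewrite ler_wpM2r// (le_trans (ler_norm _))// normrM ler_pM.
      rewrite (_ : 4 * _ = (4 * U 1%N t x * w 0%N t x) * w 0%N t x ^+ 2); last by ring.
      rewrite ler_wpM2r// (le_trans (ler_norm _))// !normrM ger0_norm//.
      rewrite (_ : 20 * _ * _ * _ = 4 * (B * a) * (5 * B * a * (1 + rho))); last by ring.
      rewrite ler_pM ?mulr_ge0// ler_wpM2l//.
    rewrite integZ// lerNl -mulrN ler_pM2l// lerNl.
    have := integM_le (lnice_nice nw) (lnice_nice nF); rewrite ler_norml => /andP[+ _].
    rewrite -/r; have : r * L2 (F t) <= r * (B * (a / L ^+ 2) * Q) by rewrite ler_wpM2l ?Fb.
    lra.
  rewrite hX'; apply: le_trans (ler_wpM2l (ltW L0) h1) _.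
  rewrite mulrDr [L * (_ * y t)]mulrCA ryL.
  rewrite (_ : L * (2 * _) = 2 * B * rho * (a / L)); last first.
    by rewrite /rho; field; rewrite gt_eqF.
  rewrite le_eqVlt; apply/orP; left; apply/eqP.
  by field; rewrite !gt_eqF.
have XE : X t = rho ^+ 2 + (a * L)^-1 ^+ 2 by rewrite /X ryL exprVn.
set e := (a * L)^-1 in h XE.
have e0 : 0 < e by rewrite invr_gt0 mulr_gt0.
have Xp := X0 t.
have h2 : X' <= 34 * B ^+ 2 * a ^+ 2 * (1 + rho) * X t.
  apply: le_trans h _.
  have BB : B <= B ^+ 2 by rewrite expr2 ler_peMl// ltW.
  have k1 : rho ^+ 2 <= X t by rewrite XE lerDl sqr_ge0.
  have k2 : 2 * (rho * e) <= X t by rewrite XE; have := sqr_ge0 (rho - e); nra.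
  have k3 : rho ^+ 2 * (1 + rho) <= X t * (1 + rho) by rewrite ler_wpM2r// addr_ge0.
  have k4 : X t <= X t * (1 + rho) by rewrite ler_peMr ?(ltW Xp)// lerDl.
  have k5 : rho ^+ 2 <= rho ^+ 2 * (1 + rho) by rewrite ler_peMr ?sqr_ge0// lerDl.
  have B2 : 0 <= B ^+ 2 := sqr_ge0 _.
  rewrite (_ : 34 * _ * _ * _ * _ = a ^+ 2 * (34 * (B ^+ 2 * (X t * (1 + rho))))); last by ring.
  rewrite ler_wpM2l ?sqr_ge0//.
  have m1 : B ^+ 2 * (rho ^+ 2 * (1 + rho)) <= B ^+ 2 * (X t * (1 + rho)) by rewrite ler_wpM2l.
  have m2 : B ^+ 2 * rho ^+ 2 <= B ^+ 2 * (X t * (1 + rho)) by rewrite ler_wpM2l// (le_trans k5).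
  have m3 : B * (2 * (rho * e)) <= B ^+ 2 * (X t * (1 + rho)).
    by apply: ler_pM; [ge0_tac|ge0_tac|exact: BB|exact: le_trans k2 k4].
  have m4 : 0 <= B ^+ 2 * (X t * (1 + rho)) by rewrite mulr_ge0// mulr_ge0 ?(ltW Xp)// addr_ge0.
  lra.
have h3 : (1 + rho) / X t <= 2 * ((X t)^-1 + 1).
  have : 1 + rho <= 2 * (1 + X t).
    have := sqr_ge0 (rho - 1); have := sqr_ge0 e; rewrite XE; nra.
  rewrite ler_pdivrMr// (_ : _ * X t = 2 * (1 + X t))//; by field; rewrite gt_eqF.
rewrite ler_pdivrMr ?exprn_gt0//; apply: le_trans h2 _.
rewrite (_ : 68 * _ * _ * _ * _ =
   34 * B ^+ 2 * a ^+ 2 * (2 * ((X t)^-1 + 1) * X t * X t)); last by ring.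
rewrite -[leLHS]mulrA ler_wpM2l//; first by ge0_tac.
rewrite ler_wpM2r ?(ltW Xp)//.
by rewrite -ler_pdivrMr.
Qed.

(** Amounts to (a^2 L)^4 <= 1, because L (a^3 sqrt L)^2 (a L)^2 = (a^2 L)^4. *)
Lemma stability_y0 : X 0 <= (B ^+ 2 + 1) * (a * L) ^- 2.
Proof.
rewrite /X mulrDl mul1r lerD2r ler_pdivlMr ?exprn_gt0 ?mulr_gt0//.
have : y 0 <= (B * a ^+ 3 * Q) ^+ 2.
  rewrite /y -sqr_L2 lerXn2r ?nnegrE ?L2_ge0//.
  by ge0_tac.
move=> /(ler_wpM2l (ltW L0)) h.
apply: le_trans (ler_wpM2r (sqr_ge0 _) h) _.
rewrite (_ : L * _ * _ = B ^+ 2 * (a ^+ 2 * L) ^+ 4); last by rewrite exprMn QL; ring.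
by rewrite ler_piMr ?sqr_ge0// exprn_ile1// mulr_ge0 ?sqr_ge0// ltW.
Qed.

(** Integrates X' <= K a^2 (X + X^2) up to times of order a^-2. The largeness of a L makes X 0 so
    small that the quadratic term cannot cause blow-up before T. *)
Lemma stability_bound (Phi t : R) : 0 <= t <= T -> a ^+ 2 * T <= Phi ->
  2 * (B ^+ 2 + 1) * expR (68 * B ^+ 2 * Phi) <= (a * L) ^+ 2 ->
  L * y t <= 2 * (B ^+ 2 + 1) * expR (68 * B ^+ 2 * Phi) / (a * L) ^+ 2.
Proof.
move=> tT aT hbig; set K := 68 * B ^+ 2; set m := (a * L) ^+ 2.
have m0 : 0 < m by rewrite exprn_gt0// mulr_gt0.
have [t0 tT'] := andP tT.
have hX (s : R) : hder X s (L * integ (fun x => 12 * (U 0%N s x * U 1%N s x * w 0%N s x ^+ 2)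
    + 4 * (U 1%N s x * w 0%N s x ^+ 3) - 2 * (w 0%N s x * F s x))).
  have hy := energy_der hv Ux Un Utn Utd s.
  rewrite /X /y; eapply hder_eq; first by hder_step.
  by cbv beta; ring.
set X' := fun s => L * integ (fun x => 12 * (U 0%N s x * U 1%N s x * w 0%N s x ^+ 2)
    + 4 * (U 1%N s x * w 0%N s x ^+ 3) - 2 * (w 0%N s x * F s x)).
(* By [stability_ode], 1/X + 1 decreases at most at the relative rate K a^2, so g is nondecreasing
   on [0, t]. *)
pose g s := ((X s)^-1 + 1) * expR (K * a ^+ 2 * s).
have hg s : hder g s ((- X' s / X s ^+ 2 + K * a ^+ 2 * ((X s)^-1 + 1)) * expR (K * a ^+ 2 * s)).
  have hi := hder_inv (lt0r_neq0 (X0 s)) (hX s).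
  rewrite /g; eapply hder_eq; first by hder_step.
  by cbv beta; rewrite /X'; ring.
have hmono : g 0 <= g t.
  apply: (hder_ge0_le (fun s _ => hg s) t0) => s /andP[s0 st].
  rewrite mulr_ge0 ?expR_ge0// mulNr addrC subr_ge0.
  by apply: stability_ode => //; rewrite s0 (le_trans st).
have h0 : m / (B ^+ 2 + 1) <= g 0.
  rewrite /g mulr0 expR0 mulr1 ler_wpDr//.
  have B2 : 0 < B ^+ 2 + 1 by rewrite ltr_wpDl// sqr_ge0.
  rewrite -[leLHS]invrK lef_pV2 ?posrE ?X0//; last by rewrite invr_gt0 divr_gt0.
  by apply: le_trans stability_y0 _; rewrite invf_div.
set E := expR (K * Phi).
have E0 : 0 < E := expR_gt0 _.
have B2 : 0 < B ^+ 2 + 1 by rewrite ltr_wpDl// sqr_ge0.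
have h1 : m / (B ^+ 2 + 1) <= ((X t)^-1 + 1) * E.
  apply: le_trans h0 (le_trans hmono _); rewrite /g ler_wpM2l ?addr_ge0 ?invr_ge0 ?(ltW (X0 t))//.
  rewrite ler_expR -mulrA ler_wpM2l ?mulr_ge0 ?sqr_ge0 ?(ltW B0)//.
  by rewrite (le_trans _ aT)// ler_wpM2l ?sqr_ge0.
(* With r the left-hand side, [h1] reads 2 r <= 1/X + 1, and r >= 1 by the largeness hypothesis; so
   the summand 1 costs only a factor 2. *)
have h2 : m / (2 * (B ^+ 2 + 1) * E) <= (X t)^-1.
  have : 1 <= m / (2 * (B ^+ 2 + 1) * E).
    by rewrite ler_pdivlMr ?mul1r// !mulr_gt0.
  move: h1; rewrite -ler_pdivrMr//.
  rewrite (_ : m / (B ^+ 2 + 1) / E = 2 * (m / (2 * (B ^+ 2 + 1) * E))); last first.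
    by field; rewrite !gt_eqF.
  lra.
have h3 : X t <= 2 * (B ^+ 2 + 1) * E / m.
  rewrite -[leLHS]invrK -[leRHS]invf_div lef_pV2 ?posrE ?invr_gt0 ?X0//.
  by rewrite divr_gt0// !mulr_gt0.
by apply: le_trans h3; rewrite /X lerDl ltW.
Qed.

End stability.

(** * Boundedness locally uniform in time *)

Section local_boundedness.
Variable R : realType.
Implicit Types (f g : R -> R -> R) (c t : R).

(** Phase derivatives, powers of t and trigonometric factors do not decay in x; with this bound they
    may multiply an [lnice] amplitude. *)
Definition lbd t0 f := exists2 r : R, 0 < r & exists C, forall t, `|t - t0| < r ->
  continuous (f t) /\ forall x, `|f t x| <= C.

Lemma lbd_cst t0 c : lbd t0 (fun _ _ => c).
Proof. by exists 1 => //; exists `|c| => t _; split=> // x; exact: cvg_cst. Qed.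

Lemma lnice_lbd t0 f : lnice t0 f -> lbd t0 f.
Proof.
move=> [r r0 [C h]]; exists r => //; exists C => t /h[k b]; split=> // x.
by rewrite (le_trans (b x))// ler_piMr ?lor_le1//; exact: ge0_nice_const b.
Qed.

Lemma lbdD t0 f g : lbd t0 f -> lbd t0 g -> lbd t0 (fun t x => f t x + g t x).
Proof.
move=> [r r0 [C h]] [r' r'0 [C' h']]; exists (Num.min r r'); first by rewrite lt_min r0.
exists (C + C') => t; rewrite lt_min => /andP[/h[c b] /h'[c' b']].
split; first by move=> x; exact: cvgD (c x) (c' x).
by move=> x; rewrite (le_trans (ler_normD _ _))// lerD.
Qed.

Lemma lbdM t0 f g : lbd t0 f -> lbd t0 g -> lbd t0 (fun t x => f t x * g t x).
Proof.
move=> [r r0 [C h]] [r' r'0 [C' h']]; exists (Num.min r r'); first by rewrite lt_min r0.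
exists (C * C') => t; rewrite lt_min => /andP[/h[c b] /h'[c' b']].
split; first by move=> x; exact: cvgM (c x) (c' x).
by move=> x; rewrite normrM ler_pM.
Qed.

Lemma lbdN t0 f : lbd t0 f -> lbd t0 (fun t x => - f t x).
Proof.
move=> [r r0 [C h]]; exists r => //; exists C => t /h[k b].
split; first by move=> x; exact: cvgN (k x).
by move=> x; rewrite normrN.
Qed.

Lemma lbdX t0 f n : lbd t0 f -> lbd t0 (fun t x => f t x ^+ n.+1).
Proof.
move=> nf; elim: n => [|n IH]; first exact: nf.
by have := lbdM nf IH; congr lbd.
Qed.

Lemma lniceMl t0 f g : lnice t0 f -> lbd t0 g -> lnice t0 (fun t x => f t x * g t x).
Proof.
move=> [r r0 [C h]] [r' r'0 [C' h']]; exists (Num.min r r'); first by rewrite lt_min r0.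
exists (C * C') => t; rewrite lt_min => /andP[/h[c b] /h'[c' b']].
split; first by move=> x; exact: cvgM (c x) (c' x).
by move=> x; rewrite normrM mulrAC ler_pM.
Qed.

Lemma lniceMr t0 f g : lbd t0 f -> lnice t0 g -> lnice t0 (fun t x => f t x * g t x).
Proof.
move=> bf ng; have := lniceMl ng bf; congr lnice.
by apply/funext => t; apply/funext => x; rewrite mulrC.
Qed.

End local_boundedness.

Ltac lbd_step :=
  lazymatch goal with
  | |- lbd _ (fun t x => @?f t x + @?g t x) => refine (@lbdD _ _ f g _ _); lbd_step
  | |- lbd _ (fun t x => - @?f t x) => refine (@lbdN _ _ f _); lbd_step
  | |- lbd _ (fun t x => @?f t x * @?g t x) => refine (@lbdM _ _ f g _ _); lbd_step
  | |- lbd _ (fun t x => @?f t x ^+ ?n) =>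
      let m := eval compute in n.-1 in
      refine (@lbdX _ _ f m _); lbd_step
  | _ => first [ refine (@lbd_cst _ _ _)
    | match goal with
      | h : forall s, lbd s _ |- _ => refine (h _)
      | h : forall s, lnice s _ |- _ => refine (lnice_lbd (h _))
      end ]
  end.

Ltac lnice_osc :=
  lazymatch goal with
  | |- lnice _ (fun t x => @?f t x + @?g t x) => refine (@lniceD _ _ f g _ _); lnice_osc
  | |- lnice _ (fun t x => - @?f t x) => refine (@lniceN _ _ f _); lnice_osc
  | |- lnice _ (fun t x => @?f t x * @?g t x) =>
     first [ solve [refine (@lniceMl _ _ f g _ _); [lnice_osc | lbd_step]]
           | solve [refine (@lniceMr _ _ f g _ _); [lbd_step | lnice_osc]] ]
  | |- lnice _ (fun t x => @?f t x ^+ ?n) =>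
      let m := eval compute in n.-1 in
      refine (@lniceX _ _ f m _); lnice_osc
  | _ => match goal with
    | h : forall s, lnice s _ |- _ => refine (h _)
    end
  end.

(** * The oscillating ansatz *)

Section oscillation.
Variable R : realType.
Variables (A0 A1 A2 A3 At th h1 h2 h3 ht : R -> R -> R).

Definition osc0 t x := A0 t x * cos (th t x).
Definition osc1 t x := A1 t x * cos (th t x) - A0 t x * h1 t x * sin (th t x).
Definition osc2 t x := (A2 t x - A0 t x * h1 t x ^+ 2) * cos (th t x)
  - (2 * (A1 t x * h1 t x) + A0 t x * h2 t x) * sin (th t x).
Definition osc3 t x :=
  (A3 t x - 3 * (A1 t x * h1 t x ^+ 2) - 3 * (A0 t x * h1 t x * h2 t x)) * cos (th t x)
  - (3 * (A2 t x * h1 t x) + 3 * (A1 t x * h2 t x) + A0 t x * h3 t x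
     - A0 t x * h1 t x ^+ 3) * sin (th t x).
Definition osct t x := At t x * cos (th t x) - A0 t x * ht t x * sin (th t x).

Hypothesis A0x : forall t x, hder (A0 t) x (A1 t x).
Hypothesis A1x : forall t x, hder (A1 t) x (A2 t x).
Hypothesis A2x : forall t x, hder (A2 t) x (A3 t x).
Hypothesis thx : forall t x, hder (th t) x (h1 t x).
Hypothesis h1x : forall t x, hder (h1 t) x (h2 t x).
Hypothesis h2x : forall t x, hder (h2 t) x (h3 t x).
Hypothesis A0t : forall t x, hder (A0^~ x) t (At t x).
Hypothesis tht : forall t x, hder (th^~ x) t (ht t x).

Lemma osc0_der t x : hder (osc0 t) x (osc1 t x).
Proof. by rewrite /osc0 /osc1; eapply hder_eq; [hder_step | cbv beta; ring]. Qed.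

Lemma osc1_der t x : hder (osc1 t) x (osc2 t x).
Proof. by rewrite /osc1 /osc2; eapply hder_eq; [hder_step | cbv beta; ring]. Qed.

Lemma osc2_der t x : hder (osc2 t) x (osc3 t x).
Proof. by rewrite /osc2 /osc3; eapply hder_eq; [hder_step | cbv beta; ring]. Qed.

Lemma osc0_dert t x : hder (osc0^~ x) t (osct t x).
Proof. by rewrite /osc0 /osct; eapply hder_eq; [hder_step | cbv beta; ring]. Qed.

Hypotheses (nA0 : forall t, lnice t A0) (nA1 : forall t, lnice t A1)
  (nA2 : forall t, lnice t A2) (nA3 : forall t, lnice t A3) (nAt : forall t, lnice t At).
Hypotheses (bh1 : forall t, lbd t h1) (bh2 : forall t, lbd t h2) (bh3 : forall t, lbd t h3)
  (bht : forall t, lbd t ht).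

Let bc t0 : lbd t0 (fun t x => cos (th t x)).
Proof.
exists 1 => //; exists 1 => t _; split; last by move=> x; exact: norm_cos_le1.
by apply: (@hder_continuous _ _ (fun x => - sin (th t x) * h1 t x)) => x; exact: hder_cos.
Qed.

Let bs t0 : lbd t0 (fun t x => sin (th t x)).
Proof.
exists 1 => //; exists 1 => t _; split; last by move=> x; exact: norm_sin_le1.
by apply: (@hder_continuous _ _ (fun x => cos (th t x) * h1 t x)) => x; exact: hder_sin.
Qed.

Lemma osc0_nice t : lnice t osc0. Proof. by rewrite /osc0; lnice_osc. Qed.
Lemma osc1_nice t : lnice t osc1. Proof. by rewrite /osc1; lnice_osc. Qed.
Lemma osc2_nice t : lnice t osc2. Proof. by rewrite /osc2; lnice_osc. Qed.
Lemma osc3_nice t : lnice t osc3. Proof. by rewrite /osc3; lnice_osc. Qed.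
Lemma osct_nice t : lnice t osct. Proof. by rewrite /osct; lnice_osc. Qed.

End oscillation.

Section norm_bounds.
Variable R : realType.
Implicit Types x y b c : R.

Lemma bnd_add x y b c : `|x| <= b -> `|y| <= c -> `|x + y| <= b + c.
Proof. by move=> h h'; rewrite (le_trans (ler_normD _ _))// lerD. Qed.

Lemma bnd_opp x b : `|x| <= b -> `|- x| <= b.
Proof. by rewrite normrN. Qed.

Lemma bnd_mul x y b c : `|x| <= b -> `|y| <= c -> `|x * y| <= b * c.
Proof. by move=> h h'; rewrite normrM ler_pM. Qed.

Lemma bnd_exp x b n : `|x| <= b -> `|x ^+ n| <= b ^+ n.
Proof. by move=> h; rewrite normrX lerXn2r// nnegrE (le_trans _ h). Qed.

End norm_bounds.

(** The right-hand side may be an existential variable: it is built along the syntax of the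
    expression from the bounds in the context. The constants of the estimates below arise in this
    way and are never written down. *)
Ltac bnd_tac :=
  first [ eassumption | lazymatch goal with
  | |- is_true (`|_ + _| <= _) => refine (bnd_add _ _); bnd_tac
  | |- is_true (`|- _| <= _) => refine (bnd_opp _); bnd_tac
  | |- is_true (`|_ * _| <= _) => refine (bnd_mul _ _); bnd_tac
  | |- is_true (`|_ ^+ _| <= _) => refine (bnd_exp _ _); bnd_tac
  | _ => exact: lexx
  end ].

(** * The corrected wave packet as an approximate solution *)

Section wkb.
Variable R : realType.
(** The profile is given through its logarithmic derivative d, so that all its derivatives are G
    times bounded functions. Pointwise errors thus keep a factor G, which gives them the L2 norm of
    a packet. *)
Variables (G d e1 e2 : R -> R).
Hypothesis Gx : forall y, hder G y (G y * d y).
Hypothesis dx : forall y, hder d y (e1 y).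
Hypothesis e1x : forall y, hder e1 y (e2 y).
Hypothesis G0 : forall y, 0 <= G y.
Hypothesis G1 : forall y, G y <= 1.
Hypothesis d1 : forall y, `|d y| <= 1.
Hypothesis e11 : forall y, `|e1 y| <= 1.
Hypothesis e21 : forall y, `|e2 y| <= 2.
Hypothesis nG : nice G.
Hypothesis ce2 : continuous e2.

Section ansatz.
Variables (a L : R).
Hypotheses (a0 : 0 < a) (L0 : 0 < L).
Local Notation e := (L^-1).

Definition wkb_y (t x : R) := e * (x + 3 * t).
Local Notation Y := wkb_y.
(** L^-1 q0 is the x-derivative of the phase correction (3/2) a^2 t G^2, and q1, q2 continue it with
    the powers of L^-1 taken out. All three are bounded in terms of a^2 t alone. *)
Definition wkb_q0 t x := 3 * (a ^+ 2 * t) * (G (Y t x) ^+ 2 * d (Y t x)).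
Definition wkb_q1 t x := 3 * (a ^+ 2 * t) * (G (Y t x) ^+ 2 * (2 * d (Y t x) ^+ 2 + e1 (Y t x))).
Definition wkb_q2 t x := 3 * (a ^+ 2 * t) *
  (G (Y t x) ^+ 2 * (4 * d (Y t x) ^+ 3 + 6 * (d (Y t x) * e1 (Y t x)) + e2 (Y t x))).
Definition wkb_d2 t x := d (Y t x) ^+ 2 + e1 (Y t x).
Definition wkb_d3 t x := d (Y t x) ^+ 3 + 3 * (d (Y t x) * e1 (Y t x)) + e2 (Y t x).

Definition wkb_P0 t x := a * G (Y t x).
Definition wkb_P1 t x := a * e * (G (Y t x) * d (Y t x)).
Definition wkb_P2 t x := a * e ^+ 2 * (G (Y t x) * wkb_d2 t x).
Definition wkb_P3 t x := a * e ^+ 3 * (G (Y t x) * wkb_d3 t x).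
Definition wkb_Pt t x := 3 * wkb_P1 t x.

(** For the linear equation x + t is the phase at frequency one and -3 the group velocity. The part
    of 6 u^2 u_x resonant with u = A cos th is -(3/2) A^3 sin th to leading order, which gives the
    frequency shift (3/2) A^2. *)
Definition wkb_th t x := x + t + 3 / 2 * (a ^+ 2 * t) * G (Y t x) ^+ 2.
Definition wkb_h1 t x := 1 + e * wkb_q0 t x.
Definition wkb_h2 t x := e ^+ 2 * wkb_q1 t x.
Definition wkb_h3 t x := e ^+ 3 * wkb_q2 t x.
Definition wkb_ht t x := 1 + 3 / 2 * wkb_P0 t x ^+ 2 + 3 * (e * wkb_q0 t x).

(** Amplitude of the third harmonic, used below with the factor -1/16: the nonlinearity leaves (3/2)
    A^3 sin 3th in the residual, and the linear operator maps cos 3th to (27 - 3) sin 3th to leading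
    order. *)
Definition wkb_S0 t x := wkb_P0 t x ^+ 3.
Definition wkb_S1 t x := 3 * (wkb_P0 t x ^+ 2 * wkb_P1 t x).
Definition wkb_S2 t x := 6 * (wkb_P0 t x * wkb_P1 t x ^+ 2) + 3 * (wkb_P0 t x ^+ 2 * wkb_P2 t x).
Definition wkb_S3 t x := 6 * wkb_P1 t x ^+ 3 + 18 * (wkb_P0 t x * wkb_P1 t x * wkb_P2 t x)
  + 3 * (wkb_P0 t x ^+ 2 * wkb_P3 t x).
Definition wkb_St t x := 9 * (wkb_P0 t x ^+ 2 * wkb_P1 t x).

Definition wkb_3th t x := 3 * wkb_th t x.
Definition wkb_3h1 t x := 3 * wkb_h1 t x.
Definition wkb_3h2 t x := 3 * wkb_h2 t x.
Definition wkb_3h3 t x := 3 * wkb_h3 t x.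
Definition wkb_3ht t x := 3 * wkb_ht t x.

(* The third harmonic cancels the non-resonant part of the cubic nonlinearity. *)
Definition wkbU n t x := match n with
  | 0%N => osc0 wkb_P0 wkb_th t x - 16^-1 * osc0 wkb_S0 wkb_3th t x
  | 1%N => osc1 wkb_P0 wkb_P1 wkb_th wkb_h1 t x
           - 16^-1 * osc1 wkb_S0 wkb_S1 wkb_3th wkb_3h1 t x
  | 2%N => osc2 wkb_P0 wkb_P1 wkb_P2 wkb_th wkb_h1 wkb_h2 t x
           - 16^-1 * osc2 wkb_S0 wkb_S1 wkb_S2 wkb_3th wkb_3h1 wkb_3h2 t x
  | _ => osc3 wkb_P0 wkb_P1 wkb_P2 wkb_P3 wkb_th wkb_h1 wkb_h2 wkb_h3 t x
         - 16^-1 * osc3 wkb_S0 wkb_S1 wkb_S2 wkb_S3 wkb_3th wkb_3h1 wkb_3h2 wkb_3h3 t x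
  end.

Definition wkbUt t x := osct wkb_P0 wkb_Pt wkb_th wkb_ht t x
  - 16^-1 * osct wkb_S0 wkb_St wkb_3th wkb_3ht t x.

Let Yx t x : hder (Y t) x e.
Proof. by rewrite /wkb_y; hder_tac; ring. Qed.
Let Yt t x : hder (Y^~ x) t (3 * e).
Proof. by rewrite /wkb_y; hder_tac; ring. Qed.
Let gx t x : hder (fun x => G (Y t x)) x (e * (G (Y t x) * d (Y t x))).
Proof. by rewrite mulrC; exact: hder_comp (Yx t x) (Gx _). Qed.
Let gt t x : hder (fun t => G (Y t x)) t (3 * e * (G (Y t x) * d (Y t x))).
Proof. by rewrite mulrC; exact: hder_comp (Yt t x) (Gx _). Qed.
Let ddx t x : hder (fun x => d (Y t x)) x (e * e1 (Y t x)).
Proof. by rewrite mulrC; exact: hder_comp (Yx t x) (dx _). Qed.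
Let eex t x : hder (fun x => e1 (Y t x)) x (e * e2 (Y t x)).
Proof. by rewrite mulrC; exact: hder_comp (Yx t x) (e1x _). Qed.

Ltac dd := eapply hder_eq; [hder_step | cbv beta].

Let P0x t x : hder (wkb_P0 t) x (wkb_P1 t x).
Proof. by rewrite /wkb_P0 /wkb_P1; dd; ring. Qed.
Let P1x t x : hder (wkb_P1 t) x (wkb_P2 t x).
Proof. by rewrite /wkb_P2 /wkb_P1 /wkb_d2; dd; ring. Qed.
Let P2x t x : hder (wkb_P2 t) x (wkb_P3 t x).
Proof. by rewrite /wkb_P2 /wkb_P3 /wkb_d2 /wkb_d3; dd; ring. Qed.
Let P0t t x : hder (wkb_P0^~ x) t (wkb_Pt t x).
Proof. by rewrite /wkb_P0 /wkb_Pt /wkb_P1; dd; ring. Qed.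
Let thx t x : hder (wkb_th t) x (wkb_h1 t x).
Proof. by rewrite /wkb_th /wkb_h1 /wkb_q0; dd; field; rewrite gt_eqF. Qed.
Let h1x t x : hder (wkb_h1 t) x (wkb_h2 t x).
Proof. by rewrite /wkb_h1 /wkb_h2 /wkb_q0 /wkb_q1; dd; ring. Qed.
Let h2x t x : hder (wkb_h2 t) x (wkb_h3 t x).
Proof. by rewrite /wkb_h3 /wkb_h2 /wkb_q2 /wkb_q1; dd; ring. Qed.
Let tht t x : hder (wkb_th^~ x) t (wkb_ht t x).
Proof. by rewrite /wkb_th /wkb_ht /wkb_P0 /wkb_q0; dd; field; rewrite gt_eqF. Qed.
Let S0x t x : hder (wkb_S0 t) x (wkb_S1 t x).
Proof. by rewrite /wkb_S0 /wkb_S1; dd; ring. Qed.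
Let S1x t x : hder (wkb_S1 t) x (wkb_S2 t x).
Proof. by rewrite /wkb_S2 /wkb_S1; dd; ring. Qed.
Let S2x t x : hder (wkb_S2 t) x (wkb_S3 t x).
Proof. by rewrite /wkb_S2 /wkb_S3; dd; ring. Qed.
Let S0t t x : hder (wkb_S0^~ x) t (wkb_St t x).
Proof. by rewrite /wkb_S0 /wkb_St; eapply hder_eq; [hder_step | cbv beta; rewrite /wkb_Pt; ring]. Qed.
Let th3x t x : hder (wkb_3th t) x (wkb_3h1 t x).
Proof. by apply: hder_scale; exact: thx. Qed.
Let h31x t x : hder (wkb_3h1 t) x (wkb_3h2 t x).
Proof. by apply: hder_scale; exact: h1x. Qed.
Let h32x t x : hder (wkb_3h2 t) x (wkb_3h3 t x).
Proof. by apply: hder_scale; exact: h2x. Qed.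
Let th3t t x : hder (wkb_3th^~ x) t (wkb_3ht t x).
Proof. by apply: hder_scale; exact: tht. Qed.

Lemma wkbU_x n t x : (n < 3)%N -> hder (wkbU n t) x (wkbU n.+1 t x).
Proof.
case: n => [|[|[|//]]] _; apply: hder_sub; try apply: hder_scale.
- exact: (osc0_der P0x thx).
- exact: (osc0_der S0x th3x).
- exact: (osc1_der P0x P1x thx h1x).
- exact: (osc1_der S0x S1x th3x h31x).
- exact: (osc2_der P0x P1x P2x thx h1x h2x).
- exact: (osc2_der S0x S1x S2x th3x h31x h32x).
Qed.

Lemma wkbU_t t x : hder ((wkbU 0)^~ x) t (wkbUt t x).
Proof. by apply: hder_sub; try apply: hder_scale; [exact: (osc0_dert P0t tht)|exact: (osc0_dert S0t th3t)]. Qed.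

Let bcomp (f : R -> R) C : continuous f -> (forall y, `|f y| <= C) ->
  forall t0, lbd t0 (fun t x => f (Y t x)).
Proof.
move=> cf hC t0; exists 1 => //; exists C => t _; split=> // x.
apply: (@continuous_comp _ _ _ (Y t) f); last exact: cf.
by apply: (@hder_continuous _ (Y t) (fun=> e)) => z; exact: Yx.
Qed.

Let nGY t0 : lnice t0 (fun t x => G (Y t x)).
Proof.
have [cG [C hC]] := nG; have C0 := ge0_nice_const hC.
exists 1 => //; exists (C * (1 + 2 * (1 + 9 * (`|t0| + 1) ^+ 2) * (1 + L ^+ 2))) => t ht.
have [ct _] : continuous (fun x => G (Y t x)) /\ True.
  split=> // x; apply: (@continuous_comp _ _ _ (Y t) G); last exact: cG.
  by apply: (@hder_continuous _ (Y t) (fun=> e)) => z; exact: Yx.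
split=> // x; apply: le_trans (hC _) _; rewrite -mulrA ler_wpM2l//.
have tb : t ^+ 2 <= (`|t0| + 1) ^+ 2.
  have ht' : `|t| <= `|t0| + 1.
    by rewrite -(subrK t0 t) (le_trans (ler_normD _ _))// addrC lerD2l ltW.
  by rewrite -[t ^+ 2]ger0_norm ?sqr_ge0// normrX lerXn2r ?nnegrE.
move: tb; set m := (_ + 1) ^+ 2 => tb.
rewrite /lor ler_pdivlMr ?oneD_gt0// mulrC ler_pdivrMr ?oneD_gt0//.
set y := Y t x; have -> : x = L * y - 3 * t by rewrite /y /wkb_y; field; rewrite gt_eqF.
have m0 : 0 <= m := sqr_ge0 _.
have k1 : (L * y - 3 * t) ^+ 2 <= 2 * (L ^+ 2 * y ^+ 2) + 18 * m.
  have := sqr_ge0 (L * y + 3 * t); nra.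
have k2 : 0 <= m * L ^+ 2 by rewrite mulr_ge0 ?sqr_ge0.
have k3 : 0 <= m * y ^+ 2 by rewrite mulr_ge0 ?sqr_ge0.
have k4 : 0 <= m * (L ^+ 2 * y ^+ 2) by ge0_tac.
have k5 := sqr_ge0 y; have k6 := sqr_ge0 L.
have k7 : 0 <= L ^+ 2 * y ^+ 2 by ge0_tac.
nra.
Qed.

Let bd1 := bcomp (hder_continuous dx) d1.
Let be1 := bcomp (hder_continuous e1x) e11.
Let be2 := bcomp ce2 e21.
Let bt t0 : lbd t0 (fun t x : R => t).
Proof.
exists 1 => //; exists (`|t0| + 1) => t ht; split=> [x|_]; first exact: cvg_cst.
by rewrite -(subrK t0 t) (le_trans (ler_normD _ _))// addrC lerD2l ltW.
Qed.

Let nP0 t : lnice t wkb_P0. Proof. by rewrite /wkb_P0; lnice_osc. Qed.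
Let nP1 t : lnice t wkb_P1. Proof. by rewrite /wkb_P1; lnice_osc. Qed.
Let nP2 t : lnice t wkb_P2. Proof. by rewrite /wkb_P2 /wkb_d2; lnice_osc. Qed.
Let nP3 t : lnice t wkb_P3. Proof. by rewrite /wkb_P3 /wkb_d3; lnice_osc. Qed.
Let nPt t : lnice t wkb_Pt. Proof. by rewrite /wkb_Pt; lnice_osc. Qed.
Let bq0 t : lbd t wkb_q0. Proof. by rewrite /wkb_q0; lbd_step. Qed.
Let bq1 t : lbd t wkb_q1. Proof. by rewrite /wkb_q1; lbd_step. Qed.
Let bq2 t : lbd t wkb_q2. Proof. by rewrite /wkb_q2; lbd_step. Qed.
Let bh1 t : lbd t wkb_h1. Proof. by rewrite /wkb_h1; lbd_step. Qed.
Let bh2 t : lbd t wkb_h2. Proof. by rewrite /wkb_h2; lbd_step. Qed.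
Let bh3 t : lbd t wkb_h3. Proof. by rewrite /wkb_h3; lbd_step. Qed.
Let bht t : lbd t wkb_ht. Proof. by rewrite /wkb_ht; lbd_step. Qed.
Let b3h1 t : lbd t wkb_3h1. Proof. by rewrite /wkb_3h1; lbd_step. Qed.
Let b3h2 t : lbd t wkb_3h2. Proof. by rewrite /wkb_3h2; lbd_step. Qed.
Let b3h3 t : lbd t wkb_3h3. Proof. by rewrite /wkb_3h3; lbd_step. Qed.
Let b3ht t : lbd t wkb_3ht. Proof. by rewrite /wkb_3ht; lbd_step. Qed.
Let nS0 t : lnice t wkb_S0. Proof. by rewrite /wkb_S0; lnice_osc. Qed.
Let nS1 t : lnice t wkb_S1. Proof. by rewrite /wkb_S1; lnice_osc. Qed.
Let nS2 t : lnice t wkb_S2. Proof. by rewrite /wkb_S2; lnice_osc. Qed.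
Let nS3 t : lnice t wkb_S3. Proof. by rewrite /wkb_S3; lnice_osc. Qed.
Let nSt t : lnice t wkb_St. Proof. by rewrite /wkb_St; lnice_osc. Qed.

Lemma wkbU_nice n t : (n < 4)%N -> lnice t (wkbU n).
Proof.
have n00 := osc0_nice thx nP0; have n01 := osc0_nice th3x nS0.
have n10 := osc1_nice thx nP0 nP1 bh1; have n11 := osc1_nice th3x nS0 nS1 b3h1.
have n20 := osc2_nice thx nP0 nP1 nP2 bh1 bh2; have n21 := osc2_nice th3x nS0 nS1 nS2 b3h1 b3h2.
have n30 := osc3_nice thx nP0 nP1 nP2 nP3 bh1 bh2 bh3.
have n31 := osc3_nice th3x nS0 nS1 nS2 nS3 b3h1 b3h2 b3h3.
case: n => [|[|[|[|//]]]] _; rewrite /wkbU; lnice_osc.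
Qed.

Lemma wkbUt_nice t : lnice t wkbUt.
Proof.
have n0 := osct_nice thx nP0 nPt bht; have n1 := osct_nice th3x nS0 nSt b3ht.
by rewrite /wkbUt; lnice_osc.
Qed.

End ansatz.

Section estimates.
Variable Phi : R.
Hypothesis Phi0 : 0 <= Phi.

(** Implies a^2 <= 1/L <= a, so powers of the amplitude and of the inverse length can be compared,
    while a^2 t <= Phi keeps the phase correction and its scaled derivatives bounded. *)
Definition wkb_regime (a L t : R) := [/\ 0 < a, a <= 1, 1 <= L, a ^+ 2 * L <= 1 &
  1 <= a * L /\ 0 <= a ^+ 2 * t <= Phi].

Lemma sin_triple (x : R) : sin (3 * x) = 3 * sin x - 4 * sin x ^+ 3.
Proof.
have -> : 3 * x = x + x + x by ring.
rewrite !sinD cosD; have h := cos2Dsin2 x.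
have -> : cos x * cos x = 1 - sin x ^+ 2 by rewrite -h; ring.
rewrite (_ : _ * cos x + (1 - _ - _) * _ = 2 * sin x * cos x ^+ 2 + (1 - 2 * sin x ^+ 2) * sin x); last by ring.
have -> : cos x ^+ 2 = 1 - sin x ^+ 2 by rewrite -h; ring.
by ring.
Qed.

Let Gn y : `|G y| <= 1. Proof. by rewrite ger0_norm. Qed.

Lemma regime_facts a L t : wkb_regime a L t ->
  [/\ `|a| <= 1, `|L^-1| <= 1, `|a ^+ 2 * t| <= Phi, a ^+ 2 <= L^-1 & L^-1 <= a].
Proof.
move=> [a0 a1 L1 aL [aL1 /andP[t0 t1]]].
have L0 : 0 < L := lt_le_trans ltr01 L1.
split.
- by rewrite gtr0_norm.
- by rewrite gtr0_norm ?invr_gt0// invf_le1.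
- by rewrite ger0_norm.
- by rewrite -[leRHS]mul1r ler_pdivlMr.
- by rewrite -[leLHS]mul1r ler_pdivrMr.
Qed.

Lemma regime_invL_gt0 a L t : wkb_regime a L t -> 0 < L^-1.
Proof. by case=> _ _ L1 _ _; rewrite invr_gt0 (lt_le_trans ltr01 L1). Qed.

Let q_bounds a L t x : wkb_regime a L t ->
  [/\ `|wkb_q0 a L t x| <= 3 * Phi, `|wkb_q1 a L t x| <= 9 * Phi &
      `|wkb_q2 a L t x| <= 36 * Phi].
Proof.
move=> /regime_facts[_ _ hPhi _ _].
have hG := Gn (wkb_y L t x); have hd := d1 (wkb_y L t x).
have h1 := e11 (wkb_y L t x); have h2 := e21 (wkb_y L t x).
split; rewrite /wkb_q0 /wkb_q1 /wkb_q2.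
- eapply le_trans; first by bnd_tac.
  by rewrite ger0_norm// expr1n; lra.
- eapply le_trans; first by bnd_tac.
  by rewrite !ger0_norm// !expr1n; lra.
- eapply le_trans; first by bnd_tac.
  by rewrite !ger0_norm// !expr1n; lra.
Qed.

(** Turns the values of the profile, of the phase derivatives and of the trigonometric functions
    into variables with known bounds; the estimates become polynomial. *)
Ltac wkb_atoms a L t x reg :=
  have [] := regime_facts reg;
  have := regime_invL_gt0 reg;
  have [] := q_bounds x reg;
  have := Gn (wkb_y L t x); have := d1 (wkb_y L t x);
  have := e11 (wkb_y L t x); have := e21 (wkb_y L t x);
  have := G0 (wkb_y L t x);
  rewrite ?/wkbUt ?/wkbU ?/osct ?/osc3 ?/osc2 ?/osc1 ?/osc0 ?/wkb_3ht ?/wkb_3h1 ?/wkb_3h2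
    ?/wkb_3h3 ?/wkb_ht ?/wkb_h1 ?/wkb_h2 ?/wkb_h3 ?/wkb_S3 ?/wkb_S2 ?/wkb_S1 ?/wkb_S0
    ?/wkb_St ?/wkb_Pt ?/wkb_P3 ?/wkb_P2 ?/wkb_P1 ?/wkb_P0 ?/wkb_d3 ?/wkb_d2;
  have : `|cos (wkb_th a L t x)| <= 1 by [exact: norm_cos_le1];
  have : `|sin (wkb_th a L t x)| <= 1 by [exact: norm_sin_le1];
  have : `|cos (wkb_3th a L t x)| <= 1 by [exact: norm_cos_le1];
  have : `|sin (wkb_3th a L t x)| <= 1 by [exact: norm_sin_le1];
  move: (sin (wkb_3th a L t x)) (cos (wkb_3th a L t x)) (sin (wkb_th a L t x))
     (cos (wkb_th a L t x));
  move: (wkb_q0 a L t x) (wkb_q1 a L t x) (wkb_q2 a L t x);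
  move: (G (wkb_y L t x)) (d (wkb_y L t x)) (e1 (wkb_y L t x)) (e2 (wkb_y L t x));
  move: (L^-1).

(** The terms of size a, a/L and a^3 cancel by the dispersion relation, by transport at the group
    velocity, and by the phase correction together with the third harmonic. The rest has size a/L^2,
    a^3/L or a^5, and a^2 <= 1/L reduces all three to a/L^2. *)
Lemma wkb_residual : exists C, forall a L t x, wkb_regime a L t ->
  `|wkbUt a L t x + wkbU a L 3 t x
     - 6 * wkbU a L 0 t x ^+ 2 * wkbU a L 1 t x|
  <= C * (a / L ^+ 2) * G (wkb_y L t x).
Proof.
eexists => a L t x reg.
have [a0 _ _ _ _] := reg; rewrite -exprVn.
have := cos2Dsin2 (wkb_th a L t x); have := sin_triple (wkb_th a L t x).
rewrite -[3 * wkb_th a L t x]/(wkb_3th a L t x).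
wkb_atoms a L t x reg => e g D E1 E2 q0 q1 q2 sg k s c.
move=> hsg hk hs hc g0 h2 h1 hd hG hq0 hq1 hq2 e0 ha he hPhi a2e ea sgE cs.
pose D2 := D ^+ 2 + E1; pose D3 := D ^+ 3 + 3 * (D * E1) + E2.
pose T2 := 6 * D ^+ 2 + 3 * D2; pose T3 := 6 * D ^+ 3 + 18 * (D * D2) + 3 * D3.
pose A := c * (e * D3 - 3 * (D * (2 * q0 + e * q0 ^+ 2)) - 3 * ((1 + e * q0) * q1))
  + s * ((3 + e * q0) * q0 ^+ 2 - 3 * (D2 * (1 + e * q0)) - 3 * (e * (D * q1)) - e * q2).
pose B := - (16^-1 * (g ^+ 2 *
    (k * (e ^+ 2 * T3 - 81 * (D * (1 + e * q0) ^+ 2) - 27 * ((1 + e * q0) * (e * q1)) + 9 * D)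
   + sg * (27 * (3 * q0 + 3 * (e * q0 ^+ 2) + e ^+ 2 * q0 ^+ 3) - 9 * q0
       - 9 * (e * (T2 * (1 + e * q0))) - 27 * (e ^+ 2 * (D * q1)) - 3 * (e ^+ 2 * q2)))))
  - 6 * (g ^+ 2 * (D * c ^+ 3 - q0 * (c ^+ 2 * s))).
pose V1 := e * (D * c) - (1 + e * q0) * s.
pose W1 := 3 * (e * (D * k)) - 3 * ((1 + e * q0) * sg).
pose E := 9 / 32 * (g ^+ 4 * sg)
  + g ^+ 4 * (- (6 * ((a ^+ 2 * (g ^+ 2 * k ^+ 2) / 256 - 2 * (c * k) / 16) * V1))
     + 6 / 16 * ((c - a ^+ 2 * (g ^+ 2 * k) / 16) ^+ 2 * W1)).
(* A, B and E are the coefficients of the three surviving orders. The last summand vanishes because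
   c^2 + s^2 = 1 and is kept only to make this an identity of polynomials. *)
rewrite [X in `|X|](_ : _ = (a * e ^+ 2 * A + a ^+ 3 * e * B + a ^+ 5 * E) * g
    + 6 * (a * g) ^+ 3 * (s * (c ^+ 2 + s ^+ 2 - 1))); last first.
  by rewrite /A /B /E /V1 /W1 /T2 /T3 /D2 /D3 sgE; field.
rewrite cs subrr !mulr0 addr0.
rewrite normrM (ger0_norm g0) ler_wpM2r//.
have ae : a ^+ 3 * e <= a * e ^+ 2.
  rewrite (_ : a ^+ 3 * e = a * (a ^+ 2 * e)); last by ring.
  by rewrite ler_pM2l// [leRHS]expr2 ler_wpM2r// ltW.
have ae5 : a ^+ 5 <= a * e ^+ 2.
  by rewrite exprS ler_pM2l// (exprM _ 2 2) lerXn2r// nnegrE ltW// exprn_gt0.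
have nA : `|a * e ^+ 2 * A| <= a * e ^+ 2 * `|A|.
  by rewrite normrM ger0_norm//; ge0_tac.
have nB : `|a ^+ 3 * e * B| <= a * e ^+ 2 * `|B|.
  by rewrite normrM ler_wpM2r// ger0_norm//; ge0_tac.
have nE : `|a ^+ 5 * E| <= a * e ^+ 2 * `|E|.
  by rewrite normrM ler_wpM2r// ger0_norm//; ge0_tac.
apply: le_trans (bnd_add (bnd_add nA nB) nE) _.
rewrite -!mulrDr mulrC ler_wpM2r; [|by ge0_tac|].
  by [].
apply: lerD; [apply: lerD|].
- by rewrite /A /D3 /D2; bnd_tac.
- by rewrite /B /T3 /T2 /D3 /D2; bnd_tac.
- by rewrite /E /V1 /W1; bnd_tac.
Qed.

Lemma wkb_U0_bound : exists C, forall a L t x, wkb_regime a L t ->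
  `|wkbU a L 0 t x| <= C * a.
Proof.
eexists => a L t x reg; have a0 : 0 < a by case: reg.
wkb_atoms a L t x reg => e g D E1 E2 q0 q1 q2 sg k s c.
move=> hsg hk hs hc g0 h2 h1 hd hG hq0 hq1 hq2 e0 ha he hPhi a2e ea.
rewrite [X in `|X|](_ : _ = (g * c - 16^-1 * (a ^+ 2 * g ^+ 3 * k)) * a); last by ring.
rewrite normrM (gtr0_norm a0) ler_pM2r//; bnd_tac.
Qed.

Lemma wkb_U1_bound : exists C, forall a L t x, wkb_regime a L t ->
  `|wkbU a L 1 t x| <= C * a.
Proof.
eexists => a L t x reg; have a0 : 0 < a by case: reg.
wkb_atoms a L t x reg => e g D E1 E2 q0 q1 q2 sg k s c.
move=> hsg hk hs hc g0 h2 h1 hd hG hq0 hq1 hq2 e0 ha he hPhi a2e ea.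
rewrite [X in `|X|](_ : _ = (e * (g * D) * c - g * (1 + e * q0) * s
   - 16^-1 * (3 * (a ^+ 2 * (g ^+ 2 * (e * (g * D)))) * k
   - a ^+ 2 * g ^+ 3 * (3 * (1 + e * q0)) * sg)) * a); last by ring.
rewrite normrM (gtr0_norm a0) ler_pM2r//; bnd_tac.
Qed.

(** The leading term a G cos th drops out of U_xx + U; what is left is of size a/L or a^3, both at
    most a^2. *)
Lemma wkb_defect_bound : exists C, forall a L t x, wkb_regime a L t ->
  `|wkbU a L 2 t x + wkbU a L 0 t x| <= C * a ^+ 2 * G (wkb_y L t x).
Proof.
eexists => a L t x reg; have a0 : 0 < a by case: reg.
wkb_atoms a L t x reg => e g D E1 E2 q0 q1 q2 sg k s c.
move=> hsg hk hs hc g0 h2 h1 hd hG hq0 hq1 hq2 e0 ha he hPhi a2e ea.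
pose D2 := D ^+ 2 + E1.
pose A := (e * D2 - 2 * q0 - e * q0 ^+ 2) * c - (2 * (D * (1 + e * q0)) + e * q1) * s.
pose B := - 16^-1 * (g ^+ 2 * ((e ^+ 2 * (6 * D ^+ 2 + 3 * D2) - 9 * (1 + e * q0) ^+ 2 + 1) * k
  - (18 * (e * D * (1 + e * q0)) + 3 * (e ^+ 2 * q1)) * sg)).
rewrite [X in `|X|](_ : _ = (a * e * A + a ^+ 3 * B) * g); last first.
  by rewrite /A /B /D2; ring.
rewrite normrM (ger0_norm g0) ler_wpM2r//.
have nA : `|a * e * A| <= a ^+ 2 * `|A|.
  rewrite normrM ler_wpM2r// ger0_norm; last by ge0_tac.
  by rewrite expr2 ler_pM2l.
have nB : `|a ^+ 3 * B| <= a ^+ 2 * `|B|.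
  by rewrite normrM ler_wpM2r// ger0_norm ?exprn_ge0 ?(ltW a0)// exprS ler_piMl ?sqr_ge0//; case/ler_normlP: ha.
apply: le_trans (bnd_add nA nB) _.
rewrite -mulrDr mulrC ler_wpM2r ?sqr_ge0//.
apply: lerD.
- by rewrite /A /D2; bnd_tac.
- by rewrite /B /D2; bnd_tac.
Qed.

(** At time 0 the phase correction is absent, and the ansatz differs from the data only by its third
    harmonic. *)
Lemma wkb_initial_bound : exists C, forall a L x, wkb_regime a L 0 ->
  `|a * G (x / L) * cos x - wkbU a L 0 0 x| <= C * a ^+ 3 * G (wkb_y L 0 x).
Proof.
eexists => a L x reg.
have -> : x / L = wkb_y L 0 x by rewrite /wkb_y mulr0 addr0 mulrC.
have -> : cos x = cos (wkb_th a L 0 x) by rewrite /wkb_th !mulr0 mul0r !addr0.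
have a0 : 0 < a by case: reg.
wkb_atoms a L (0 : R) x reg => e g D E1 E2 q0 q1 q2 sg k s c.
move=> hsg hk hs hc g0 h2 h1 hd hG hq0 hq1 hq2 e0 ha he hPhi a2e ea.
rewrite [X in `|X|](_ : _ = 16^-1 * (g ^+ 2 * k) * a ^+ 3 * g); last by ring.
rewrite normrM (ger0_norm g0) ler_wpM2r// normrM (ger0_norm (exprn_ge0 _ (ltW a0))).
by rewrite ler_wpM2r ?exprn_ge0 ?(ltW a0)//; bnd_tac.
Qed.

(** Pointwise size of the conserved density at time 0. The factor G^2 turns it into a^4 L after
    integration, which is the initial bound that the stability argument propagates. *)
Lemma initial_defect_bound : exists C, forall a L x, wkb_regime a L 0 -> forall v0 v1 v2,
  v0 = a * G (wkb_y L 0 x) * cos x ->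
  v1 = a * (L^-1 * (G (wkb_y L 0 x) * d (wkb_y L 0 x)) * cos x - G (wkb_y L 0 x) * sin x) ->
  v2 = a * ((L^-1 ^+ 2 * (G (wkb_y L 0 x) * (d (wkb_y L 0 x) ^+ 2 + e1 (wkb_y L 0 x)))
         - G (wkb_y L 0 x)) * cos x
       - 2 * (L^-1 * (G (wkb_y L 0 x) * d (wkb_y L 0 x))) * sin x) ->
  (v2 + v0 - v0 ^+ 3) ^+ 2 + 4 * (v0 ^+ 2 * v1 ^+ 2) + v0 ^+ 6 <=
    C * a ^+ 4 * G (wkb_y L 0 x) ^+ 2.
Proof.
eexists => a L x reg v0 v1 v2.
have : `|cos x| <= 1 by exact: norm_cos_le1.
have : `|sin x| <= 1 by exact: norm_sin_le1.
move: (cos x) (sin x) => C S hS hC.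
have [a0 a1 _ _ _] := reg.
wkb_atoms a L (0 : R) x reg => e g D E1 E2 q0 q1 q2 sg k s c.
move=> hsg hk hs hc g0 h2 h1 hd hG hq0 hq1 hq2 e0 ha he hPhi a2e ea v0E v1E v2E.
have p4 : 0 < a ^+ 4 by rewrite exprn_gt0.
pose A := e * (D ^+ 2 + E1) * C - 2 * D * S.
have hA : `|v2 + v0 - v0 ^+ 3| <= a ^+ 2 * g * (`|A| + `|g ^+ 2 * C ^+ 3|).
  rewrite [X in `|X|](_ : _ = a * e * g * A - a ^+ 3 * g * (g ^+ 2 * C ^+ 3)); last first.
    by rewrite /A v2E v0E; ring.
  have nA : `|a * e * g * A| <= a ^+ 2 * g * `|A|.
    rewrite normrM ler_wpM2r// ger0_norm; last by ge0_tac.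
    by rewrite ler_wpM2r// expr2 ler_pM2l.
  have nB : `|a ^+ 3 * g * (g ^+ 2 * C ^+ 3)| <= a ^+ 2 * g * `|g ^+ 2 * C ^+ 3|.
    rewrite normrM ler_wpM2r// ger0_norm; last by ge0_tac.
    by rewrite ler_wpM2r// exprS ler_piMl ?sqr_ge0//; case/ler_normlP: ha.
  by rewrite [leRHS]mulrDr; exact: bnd_add nA (bnd_opp nB).
have hA2 : (v2 + v0 - v0 ^+ 3) ^+ 2 <= (`|A| + `|g ^+ 2 * C ^+ 3|) ^+ 2 * (a ^+ 4 * g ^+ 2).
  rewrite -[leLHS]ger0_norm ?sqr_ge0// normrX.
  rewrite [leRHS](_ : _ = (a ^+ 2 * g * (`|A| + `|g ^+ 2 * C ^+ 3|)) ^+ 2); last by ring.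
  by rewrite lerXn2r// nnegrE; ge0_tac.
have hB : 4 * (v0 ^+ 2 * v1 ^+ 2) <= `|4 * (C ^+ 2 * g ^+ 2 * (e * D * C - S) ^+ 2)| * (a ^+ 4 * g ^+ 2).
  rewrite [leLHS](_ : _ = 4 * (C ^+ 2 * g ^+ 2 * (e * D * C - S) ^+ 2) * (a ^+ 4 * g ^+ 2)).
    by rewrite ler_wpM2r ?ler_norm//; ge0_tac.
  by rewrite v0E v1E; ring.
have hE : v0 ^+ 6 <= `|a ^+ 2 * (g ^+ 4 * C ^+ 6)| * (a ^+ 4 * g ^+ 2).
  rewrite [leLHS](_ : _ = a ^+ 2 * (g ^+ 4 * C ^+ 6) * (a ^+ 4 * g ^+ 2)).
    by rewrite ler_wpM2r ?ler_norm//; ge0_tac.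
  by rewrite v0E; ring.
apply: le_trans (lerD (lerD hA2 hB) hE) _.
rewrite -!mulrDl -[leRHS]mulrA ler_wpM2r; [|by ge0_tac|].
  by [].
apply: lerD; [apply: lerD|].
- rewrite -[X in X ^+ 2]ger0_norm; last by ge0_tac.
  rewrite -normrX; apply: bnd_exp; apply: bnd_add; rewrite normr_id /A; bnd_tac.
- bnd_tac.
- bnd_tac.
Qed.

End estimates.

Let wkb_yE (L t x : R) : wkb_y L t x = L^-1 * x + L^-1 * (3 * t).
Proof. by rewrite /wkb_y; ring. Qed.

Let nGY (L t : R) : 0 < L -> nice (fun x => G (wkb_y L t x)).
Proof.
move=> L0; under eq_fun do rewrite wkb_yE.
by apply: nice_affine => //; rewrite invr_neq0// gt_eqF.
Qed.

Lemma L2_profile (L t : R) : 0 < L -> L2 (fun x => G (wkb_y L t x)) = Num.sqrt L * L2 G.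
Proof.
move=> L0; rewrite /L2 -sqrtrM ?(ltW L0)//; congr Num.sqrt.
under eq_integ do rewrite wkb_yE.
by rewrite (@integ_affine _ (fun y => G y ^+ 2)) ?invr_gt0 ?invrK//; exact: (niceX 1).
Qed.

Let L2_le_profile (f : R -> R) (L t K : R) : 0 < L -> 0 <= K -> nice f ->
  (forall x, `|f x| <= K * G (wkb_y L t x)) -> L2 f <= K * (Num.sqrt L * L2 G).
Proof.
move=> L0 K0 nf h; rewrite -(L2_profile t L0) -[X in X * _]ger0_norm// -L2_scale; last exact: nGY.
apply: le_L2 => //; first exact/niceZ/nGY.
by move=> x; rewrite [leRHS]ger0_norm// mulr_ge0.
Qed.

(** An instance of [stability_bound]: the pointwise estimates, each with a factor G, become L2
    estimates through the norm sqrt L times that of G. *)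
Theorem wkb_approximation (Phi : R) : 0 <= Phi -> exists2 C : R, 0 < C & forall (a L T : R),
  0 < a -> a <= 1 -> 1 <= L -> a ^+ 2 * L <= 1 -> 0 <= T -> a ^+ 2 * T <= Phi -> C <= (a * L) ^+ 2 ->
  forall v, mkdv_family v -> (forall x, v 0%N 0 x = a * G (x / L) * cos x) ->
  forall t : R, 0 <= t <= T ->
  L * integ (fun x => (v 0%N t x - wkbU a L 0 t x) ^+ 2) <= C / (a * L) ^+ 2.
Proof.
move=> Phi0.
have [C0 hC0] := wkb_U0_bound Phi.
have [C1 hC1] := wkb_U1_bound Phi.
have [Cz hCz] := wkb_defect_bound Phi.
have [Cf hCf] := wkb_residual Phi.
have [Ci hCi] := wkb_initial_bound Phi.
have [Ck hCk] := initial_defect_bound Phi.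
pose k := L2 G; have k0 : 0 <= k := L2_ge0 G.
(* One constant dominating all six estimates, so that C depends on Phi and on the profile only. *)
pose B := 1 + `|C0| + `|C1| + `|Cz| * k + `|Cf| * k + `|Ci| * k + `|Ck| * k ^+ 2.
have p0 := normr_ge0 C0; have p1 := normr_ge0 C1.
have pz : 0 <= `|Cz| * k by rewrite mulr_ge0.
have pf : 0 <= `|Cf| * k by rewrite mulr_ge0.
have pI : 0 <= `|Ci| * k by rewrite mulr_ge0.
have pk : 0 <= `|Ck| * k ^+ 2 by rewrite mulr_ge0 ?sqr_ge0.
have B1 : 1 <= B by rewrite /B; lra.
have B0 : 0 < B := lt_le_trans ltr01 B1.
have BB : B <= B ^+ 2 by rewrite expr2 ler_peMl// ltW.
exists (2 * (B ^+ 2 + 1) * expR (68 * B ^+ 2 * Phi)).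
  by rewrite !mulr_gt0 ?expR_gt0// ltr_wpDl// sqr_ge0.
move=> a L T a0 a1 L1 aL T0 aT hbig v hv v0E t tT.
have L0 : 0 < L := lt_le_trans ltr01 L1.
set Q := Num.sqrt L; have Q0 : 0 < Q by rewrite sqrtr_gt0.
(* The threshold required of (a L)^2 is itself at least 1. *)
have aL1 : 1 <= a * L.
  rewrite -(@ler_pXn2r _ 2) ?nnegrE ?mulr_ge0 ?(ltW a0) ?(ltW L0)// expr1n.
  apply: le_trans hbig; have : 1 <= expR (68 * B ^+ 2 * Phi).
    by rewrite -expR0 ler_expR !mulr_ge0 ?sqr_ge0// ltW.
  move=> hE; rewrite -[leLHS]mulr1 ler_pM//.
  by have := sqr_ge0 B; lra.
have reg s : 0 <= s <= T -> wkb_regime Phi a L s.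
  move=> /andP[s0 sT]; split=> //; split=> //; rewrite mulr_ge0 ?sqr_ge0//=.
  by rewrite (le_trans _ aT)// ler_wpM2l ?sqr_ge0.
have reg0 : wkb_regime Phi a L 0 by apply: reg; rewrite lexx.
have Unice n s : (n < 4)%N -> lnice s (wkbU a L n) by exact: wkbU_nice.
have Utnice s : lnice s (wkbUt a L) by exact: wkbUt_nice.
have Ux n s x : (n < 3)%N -> hder (wkbU a L n s) x (wkbU a L n.+1 s x).
  by move=> n3; exact: wkbU_x.
have Utd s x : hder ((wkbU a L 0)^~ x) s (wkbUt a L s x) by exact: wkbU_t.
apply: (stability_bound (B := B) (T := T) hv Ux Unice Utnice Utd a0 L0 B1 aL) => //.
- move=> s x sT; apply: le_trans (hC0 _ _ _ x (reg _ sT)) _; rewrite ler_pM2r//.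
  by apply: le_trans (ler_norm _) _; rewrite /B; lra.
- move=> s x sT; apply: le_trans (hC1 _ _ _ x (reg _ sT)) _; rewrite ler_pM2r//.
  by apply: le_trans (ler_norm _) _; rewrite /B; lra.
- move=> s sT; apply: le_trans (@L2_le_profile _ L s (`|Cz| * a ^+ 2) L0 _ _ _) _.
  + by ge0_tac.
  + by apply: niceD; [exact: lnice_nice (Unice 2%N s isT)|exact: lnice_nice (Unice 0%N s isT)].
  + move=> x; apply: le_trans (hCz _ _ _ x (reg _ sT)) _.
    by rewrite ler_wpM2r// ler_wpM2r ?sqr_ge0// ler_norm.
  rewrite [leLHS](_ : _ = `|Cz| * k * (a ^+ 2 * Q)); last by rewrite /k /Q; ring.
  rewrite -[leRHS]mulrA ler_wpM2r//; first by ge0_tac.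
  by rewrite /B; lra.
- move=> s sT; apply: le_trans (@L2_le_profile _ L s (`|Cf| * (a / L ^+ 2)) L0 _ _ _) _.
  + by rewrite mulr_ge0// divr_ge0 ?sqr_ge0// ltW.
  + have u0 r := Unice 0%N r isT; have u1 r := Unice 1%N r isT; have u3 r := Unice 3%N r isT.
    apply: (@lnice_nice _ s (fun t x => wkbUt a L t x + wkbU a L 3 t x
       - 6 * wkbU a L 0 t x ^+ 2 * wkbU a L 1 t x)).
    by lnice_tac.
  + move=> x; apply: le_trans (hCf _ _ _ x (reg _ sT)) _.
    by rewrite ler_wpM2r// ler_wpM2r ?ler_norm// divr_ge0 ?sqr_ge0// ltW.
  rewrite [leLHS](_ : _ = `|Cf| * k * ((a / L ^+ 2) * Q)); last by rewrite /k /Q; ring.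
  rewrite -[leRHS]mulrA ler_wpM2r//.
    by rewrite mulr_ge0 ?(ltW Q0)// divr_ge0 ?sqr_ge0// ltW.
  by rewrite /B; lra.
- have yx x : hder (wkb_y L 0) x L^-1 by rewrite /wkb_y; hder_tac; ring.
  have gx x : hder (fun x => G (wkb_y L 0 x)) x (L^-1 * (G (wkb_y L 0 x) * d (wkb_y L 0 x))).
    by rewrite mulrC; exact: hder_comp (yx x) (Gx _).
  have ddx x : hder (fun x => d (wkb_y L 0 x)) x (L^-1 * e1 (wkb_y L 0 x)).
    by rewrite mulrC; exact: hder_comp (yx x) (dx _).
  have v0' x : v 0%N 0 x = a * G (wkb_y L 0 x) * cos x.
    by rewrite v0E /wkb_y mulr0 addr0 mulrC [_ / L]mulrC; ring.
  have v1' x : v 1%N 0 x = a * (L^-1 * (G (wkb_y L 0 x) * d (wkb_y L 0 x)) * cos x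
       - G (wkb_y L 0 x) * sin x).
    apply: (hder_unique (fam_x hv 0%N 0 x)).
    apply: (hder_ext (f := fun x => a * G (wkb_y L 0 x) * cos x)); first by move=> y; rewrite v0'.
    by eapply hder_eq; [hder_step | cbv beta; ring].
  have v2' x : v 2%N 0 x = a * ((L^-1 ^+ 2 * (G (wkb_y L 0 x) * (d (wkb_y L 0 x) ^+ 2 + e1 (wkb_y L 0 x)))
         - G (wkb_y L 0 x)) * cos x
       - 2 * (L^-1 * (G (wkb_y L 0 x) * d (wkb_y L 0 x))) * sin x).
    apply: (hder_unique (fam_x hv 1%N 0 x)).
    apply: (hder_ext (f := fun x => a * (L^-1 * (G (wkb_y L 0 x) * d (wkb_y L 0 x)) * cos x
       - G (wkb_y L 0 x) * sin x))); first by move=> y; rewrite v1'.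
    by eapply hder_eq; [hder_step | cbv beta; ring].
  have nG2 : nice (fun x => G (wkb_y L 0 x) ^+ 2) by exact: (niceX 1 (nGY 0 L0)).
  apply: (@le_trans _ _ (integ (fun x => `|Ck| * a ^+ 4 * G (wkb_y L 0 x) ^+ 2))).
    apply: le_integ.
    + have vn := fam_nice hv; apply: lnice_nice; rewrite /kdens; lnice_tac.
    + exact: niceZ.
    + move=> x; apply: le_trans (hCk _ _ x reg0 _ _ _ (v0' x) (v1' x) (v2' x)) _.
      by rewrite ler_wpM2r ?sqr_ge0// ler_wpM2r ?ler_norm// exprn_ge0// ltW.
  rewrite integZ// -sqr_L2 (L2_profile 0 L0) -/Q -/k.
  rewrite [leLHS](_ : _ = `|Ck| * k ^+ 2 * (a ^+ 2 * Q) ^+ 2); last by ring.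
  rewrite [leRHS](_ : _ = B ^+ 2 * (a ^+ 2 * Q) ^+ 2); last by ring.
  by rewrite ler_wpM2r ?sqr_ge0// (le_trans _ BB)// /B; lra.
- apply: le_trans (@L2_le_profile _ L 0 (`|Ci| * a ^+ 3) L0 _ _ _) _.
  + by ge0_tac.
  + by apply: niceB; [exact: lnice_nice (fam_nice hv 0%N 0)|exact: lnice_nice (Unice 0%N 0 isT)].
  + move=> x; rewrite v0E; apply: le_trans (hCi _ _ x reg0) _.
    by rewrite ler_wpM2r// ler_wpM2r ?exprn_ge0 ?ler_norm// ltW.
  rewrite [leLHS](_ : _ = `|Ci| * k * (a ^+ 3 * Q)); last by rewrite /k /Q; ring.
  rewrite -[leRHS]mulrA ler_wpM2r//; first by ge0_tac.
  by rewrite /B; lra.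
Qed.

End wkb.

(** * Schwartz functions *)

Section schwartz_calculus.
Variable R : realType.
Implicit Types (f g h : R -> R) (x y a b c k : R).

Definition rapid f := forall k : nat, exists C, forall x, `|x ^+ k * f x| <= C.

Lemma seminorm_lty (k n : nat) f C : (forall x, `|x ^+ k * derive1n n f x| <= C) ->
  (schwartz_seminorm k n f < +oo)%E.
Proof.
move=> h; apply: (@le_lt_trans _ _ C%:E); last exact: ltry.
by apply: ge_ereal_sup => _ [x _ <-]; rewrite lee_fin.
Qed.

Lemma seminorm_ub (k n : nat) f x :
  (`|x ^+ k * derive1n n f x|%:E <= schwartz_seminorm k n f)%E.
Proof. by apply: ereal_sup_ubound; exists x. Qed.

Lemma schwartz_rapid f n : schwartz f -> rapid (derive1n n f).
Proof.
move=> [_ h] k; have hk := h k n; have ub := @seminorm_ub k n f.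
have : (0 <= schwartz_seminorm k n f)%E.
  by apply: le_trans (ub 0); rewrite lee_fin.
move: hk ub; case: (schwartz_seminorm k n f) => [r| |] // _ ub _.
by exists r => x; rewrite -lee_fin.
Qed.

(** Closure under a single derivative replaces formulas for all higher ones: to show that a function
    is Schwartz it suffices to exhibit a stable class of rapidly decreasing functions that contains
    it. *)
Lemma schwartz_of_closed (P : (R -> R) -> Prop) :
  (forall h, P h -> exists2 h', P h' & forall x, hder h x (h' x)) ->
  (forall h, P h -> rapid h) -> forall f, P f -> schwartz f.
Proof.
move=> hd hr f Pf.
have Pn n : P (derive1n n f).
  elim: n => [//|n IH]; have [h' Ph' dh'] := hd _ IH.
  by rewrite derive1nS; congr P: Ph'; apply/funext => x; rewrite (hder_derive1 (dh' x)).
split; first by move=> n x; have [h' _ dh'] := hd _ (Pn n); exact: hder_derivable (dh' x).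
by move=> k n; have [C hC] := hr _ (Pn n) k; exact: seminorm_lty hC.
Qed.

Lemma schwartz_hder f n x : schwartz f -> hder (derive1n n f) x (derive1n n.+1 f x).
Proof. by move=> [h _]; rewrite derive1nS; exact: derivable_der. Qed.

Lemma schwartz_hder0 f x : schwartz f -> hder f x (derive1 f x).
Proof. exact: (@schwartz_hder f 0 x). Qed.

Lemma schwartz_derive1 f : schwartz f -> schwartz (derive1 f).
Proof.
move=> sf; split; first by move=> n x; rewrite -derive1Sn; case: sf.
by move=> k n; have := sf.2 k n.+1; rewrite /schwartz_seminorm derive1Sn.
Qed.

Lemma rapidD f g a b : rapid f -> rapid g -> rapid (fun x => a * f x + b * g x).
Proof.
move=> hf hg k; have [C hC] := hf k; have [C' hC'] := hg k.
exists (`|a| * C + `|b| * C') => x.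
rewrite mulrDr (le_trans (ler_normD _ _))// lerD// mulrCA normrM ler_wpM2l//.
Qed.

Lemma rapidMb f g C : rapid f -> (forall x, `|g x| <= C) -> rapid (fun x => f x * g x).
Proof.
move=> hf hg k; have [C' hC'] := hf k; exists (C' * C) => x.
by rewrite mulrA normrM ler_pM.
Qed.

Lemma schwartz_lin f g a b : schwartz f -> schwartz g -> schwartz (fun x => a * f x + b * g x).
Proof.
move=> sf sg; apply: (@schwartz_of_closed
  (fun h => exists f g, [/\ schwartz f, schwartz g & h = fun x => a * f x + b * g x])).
- move=> _ [f1 [g1 [sf1 sg1 ->]]]; exists (fun x => a * derive1 f1 x + b * derive1 g1 x).
    by exists (derive1 f1), (derive1 g1); split=> //; exact: schwartz_derive1.
  move=> x; have h1 := schwartz_hder0 x sf1; have h2 := schwartz_hder0 x sg1.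
  by apply: hder_add; exact: hder_scale.
- by move=> _ [f1 [g1 [sf1 sg1 ->]]]; apply: rapidD; exact: (schwartz_rapid 0).
- by exists f, g.
Qed.

Lemma schwartzZ f a : schwartz f -> schwartz (fun x => a * f x).
Proof.
move=> sf; have := schwartz_lin a 0 sf sf; congr schwartz; apply/funext => x.
by rewrite mul0r addr0.
Qed.

(** Cosine and sine are treated together because differentiation mixes them; the pair of amplitudes
    is the stable class. *)
Lemma schwartz_osc f g b c : schwartz f -> schwartz g ->
  schwartz (fun x => f x * cos (b * x + c) + g x * sin (b * x + c)).
Proof.
move=> sf sg; apply: (@schwartz_of_closed (fun h => exists f g, [/\ schwartz f, schwartz g &
  h = fun x => f x * cos (b * x + c) + g x * sin (b * x + c)])).
- move=> _ [f1 [g1 [sf1 sg1 ->]]].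
  exists (fun x => (1 * derive1 f1 x + b * g1 x) * cos (b * x + c)
     + (1 * derive1 g1 x + (- b) * f1 x) * sin (b * x + c)).
    exists (fun x => 1 * derive1 f1 x + b * g1 x), (fun x => 1 * derive1 g1 x + (- b) * f1 x).
    by split=> //; apply: schwartz_lin => //; exact: schwartz_derive1.
  move=> x; have h1 := schwartz_hder0 x sf1; have h2 := schwartz_hder0 x sg1.
  by eapply hder_eq; [hder_step | cbv beta; ring].
- move=> _ [f1 [g1 [sf1 sg1 ->]]].
  have h1 : rapid (fun x => f1 x * cos (b * x + c)).
    apply: (rapidMb (C := 1)); first exact: (schwartz_rapid 0).
    by move=> x; exact: norm_cos_le1.
  have h2 : rapid (fun x => g1 x * sin (b * x + c)).
    apply: (rapidMb (C := 1)); first exact: (schwartz_rapid 0).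
    by move=> x; exact: norm_sin_le1.
  have := rapidD 1 1 h1 h2; congr rapid; apply/funext => x; by rewrite !mul1r.
- by exists f, g.
Qed.

Lemma schwartz0 : schwartz (fun=> 0 : R).
Proof.
apply: (@schwartz_of_closed (fun h => h = fun=> 0)) => // [h ->|h -> k].
  by exists (fun=> 0) => // x; exact: hder_cst.
by exists 0 => x; rewrite mulr0 normr0.
Qed.

Lemma schwartz_cos f b c : schwartz f -> schwartz (fun x => f x * cos (b * x + c)).
Proof.
move=> sf; have := schwartz_osc b c sf schwartz0; congr schwartz; apply/funext => x.
by rewrite mul0r addr0.
Qed.

Lemma schwartz_sin f b c : schwartz f -> schwartz (fun x => f x * sin (b * x + c)).
Proof.
move=> sf; have := schwartz_osc b c schwartz0 sf; congr schwartz; apply/funext => x.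
by rewrite mul0r add0r.
Qed.

Lemma exp_abs_le (u : R) (k : nat) : 0 <= u -> (1 + u) ^+ k <= 2 ^+ k * (1 + u ^+ k).
Proof.
move=> u0; have [u1|u1] := leP u 1.
  apply: (@le_trans _ _ (2 ^+ k)); first by apply: lerXn2r; rewrite ?nnegrE; lra.
  by rewrite ler_peMr ?exprn_ge0// lerDl exprn_ge0.
apply: (@le_trans _ _ ((2 * u) ^+ k)); first by apply: lerXn2r; rewrite ?nnegrE; lra.
by rewrite exprMn ler_wpM2l ?exprn_ge0// lerDr.
Qed.

Lemma rapid_affine f k c : k != 0 -> rapid f -> rapid (fun x => f (k * x + c)).
Proof.
move=> k0 hf j; have [C0 hC0] := hf 0%N; have [Cj hCj] := hf j.
exists (((1 + `|c|) / `|k|) ^+ j * (2 ^+ j * (C0 + Cj))) => x.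
set z := k * x + c; have -> : x = (z - c) / k by rewrite /z; field.
rewrite normrM normrX.
have h1 : `|(z - c) / k| ^+ j <= ((1 + `|c|) / `|k|) ^+ j * (2 ^+ j * (1 + `|z| ^+ j)).
  apply: le_trans (ler_wpM2l _ (exp_abs_le j (normr_ge0 z))); last by rewrite exprn_ge0// divr_ge0// addr_ge0.
  rewrite -exprMn lerXn2r ?nnegrE ?mulr_ge0 ?addr_ge0 ?invr_ge0//.
  rewrite normrM normfV mulrAC ler_wpM2r ?invr_ge0//.
  rewrite (le_trans (ler_normB _ _))//.
  have := normr_ge0 c; have := normr_ge0 z; nra.
apply: le_trans (ler_wpM2r (normr_ge0 _) h1) _.
have K0 : 0 <= ((1 + `|c|) / `|k|) ^+ j by rewrite exprn_ge0// divr_ge0// addr_ge0.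
rewrite -[leLHS]mulrA; apply: ler_wpM2l => //.
rewrite -[leLHS]mulrA ler_wpM2l ?exprn_ge0// mulrDl mul1r lerD//.
  by have := hC0 z; rewrite expr0 mul1r.
by have := hCj z; rewrite normrM normrX.
Qed.

Lemma schwartz_affine f k c : k != 0 -> schwartz f -> schwartz (fun x => f (k * x + c)).
Proof.
move=> k0 sf; apply: (@schwartz_of_closed (fun h => exists f, schwartz f /\
  h = fun x => f (k * x + c))).
- move=> _ [f1 [sf1 ->]]; exists (fun x => k * derive1 f1 (k * x + c)).
    by exists (fun x => k * derive1 f1 x); split=> //; exact/schwartzZ/schwartz_derive1.
  move=> x; have h1 := schwartz_hder0 (k * x + c) sf1.
  have h2 : hder (fun x => k * x + c) x k by hder_tac; ring.
  by rewrite mulrC; exact: hder_comp h2 h1.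
- by move=> _ [f1 [sf1 ->]]; apply: rapid_affine => //; exact: (schwartz_rapid 0).
- by exists f.
Qed.

Lemma schwartz_nice f : schwartz f -> nice f.
Proof.
move=> sf; split; first by apply: (@hder_continuous _ _ (derive1 f)) => x; exact: schwartz_hder0.
have [C0 hC0] := schwartz_rapid 0 sf 0; have [C2 hC2] := schwartz_rapid 0 sf 2.
exists (C0 + C2) => x; rewrite ler_pdivlMr ?oneD_gt0// mulrDr mulr1 lerD//.
  by have := hC0 x; rewrite expr0 mul1r.
by have := hC2 x; rewrite normrM normrX real_normK ?num_real// mulrC.
Qed.

Lemma pow_le_expR (k : nat) (u : R) : 0 <= u -> u ^+ k <= k`!%:R * expR u.
Proof.
move=> u0; case: k => [|k].
  by rewrite expr0 fact0 mul1r -expR0 ler_expR.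
have := expR_ge1Dxn k u0; have f0 : 0 < (k.+1)`!%:R :> R by rewrite ltr0n fact_gt0.
by move=> h; rewrite mulrC -ler_pdivrMr//; lra.
Qed.

Lemma rapid_expR f C : (forall x, `|f x| <= C * expR (- `|x|)) -> rapid f.
Proof.
move=> h k; exists (k`!%:R * C) => x; rewrite normrM normrX.
have C0 : 0 <= C by have := h 0; rewrite normr0 oppr0 expR0 mulr1; exact: le_trans.
apply: le_trans (ler_pM (exprn_ge0 _ (normr_ge0 _)) (normr_ge0 _)
   (pow_le_expR k (normr_ge0 x)) (h x)) _.
by rewrite mulrACA -expRD subrr expR0 mulr1.
Qed.

Definition gauss x : R := expR (- (x ^+ 2 / 2)).

Lemma gauss_gt0 x : 0 < gauss x. Proof. exact: expR_gt0. Qed.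

Lemma hder_gauss x : hder gauss x (- x * gauss x).
Proof. by rewrite /gauss; eapply hder_eq; [hder_step | cbv beta; field]. Qed.

Lemma schwartz_gauss : schwartz gauss.
Proof.
apply: (@schwartz_of_closed (fun h => exists p : {poly R}, h = fun x => p.[x] * gauss x)).
- move=> _ [p ->]; exists (fun x => (p^`() - 'X * p).[x] * gauss x).
    by exists (p^`() - 'X * p).
  move=> x; have hp : hder (fun x => p.[x]) x (p^`().[x]) by exact: is_derive_poly.
  have hg := hder_gauss x.
  eapply hder_eq; first by apply: (hder_mul hp hg).
  by cbv beta; rewrite hornerD hornerN hornerM hornerX; ring.
- move=> _ [p ->]; elim/poly_ind: p => [|p c IH] k.
    by exists 0 => x; rewrite horner0 mul0r mulr0 normr0.
  have [C hC] := IH k.+1.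
  have hg : rapid gauss.
    (* The constant comes from |x| - x^2/2 <= 1/2. *)
    apply: (@rapid_expR _ (expR (1 / 2))) => x; rewrite ger0_norm ?(ltW (gauss_gt0 x))//.
    rewrite /gauss -expRD ler_expR.
    by have := sqr_ge0 (`|x| - 1); rewrite sqrrB1 real_normK ?num_real// -mulr_natr; lra.
  have [C' hC'] := hg k.
  exists (C + `|c| * C') => x; rewrite hornerMXaddC.
  rewrite [X in `|X|](_ : _ = x ^+ k.+1 * (p.[x] * gauss x) + c * (x ^+ k * gauss x)); last by rewrite exprS; ring.
  by rewrite (le_trans (ler_normD _ _))// lerD// normrM ler_wpM2l.
- by exists 1; apply/funext => x; rewrite hornerE mul1r.
Qed.

End schwartz_calculus.

(** * The plateau profile *)

Section plateau.
Variable R : realType.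
Variable D : R.
Implicit Types (f g h : R -> R) (x y a b c k : R).

(** The logistic function satisfies l' = l (1 - l). A product of two of them is flat on most of
    [-D, D], decays exponentially outside, and has the bounded logarithmic derivative [plat_d]; for
    a compactly supported bump that quotient would be unbounded. *)
Definition logis y : R := (1 + expR (- y))^-1.

Let den_gt0 y : 0 < 1 + expR (- y). Proof. by rewrite addr_gt0// expR_gt0. Qed.

Lemma logis_gt0 y : 0 < logis y.
Proof. by rewrite invr_gt0. Qed.

Lemma logis_lt1 y : logis y < 1.
Proof. by rewrite invf_lt1// ltrDl expR_gt0. Qed.

Lemma hder_logis y : hder logis y (logis y * (1 - logis y)).
Proof.
have h : hder (fun y => 1 + expR (- y)) y (- expR (- y)).
  by eapply hder_eq; [hder_step | cbv beta; ring].
have := @hder_inv _ (fun y => 1 + expR (- y)) y _ (lt0r_neq0 (den_gt0 y)) h; rewrite -/(logis y) => h'.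
apply: hder_eq h' _; rewrite /logis; field; exact: lt0r_neq0.
Qed.

Lemma logis_le_expR y : logis y <= expR y.
Proof.
rewrite -[leRHS]invrK -expRN lef_pV2 ?posrE ?expR_gt0//.
by rewrite lerDr.
Qed.

Lemma logis_ge y : 1 - expR (- y) <= logis y.
Proof.
rewrite /logis -[leRHS]mul1r ler_pdivlMr//; have := sqr_ge0 (expR (- y)); lra.
Qed.

Definition plat_p y := logis (D + y).
Definition plat_q y := logis (D - y).
Definition plat y := plat_p y * plat_q y.
Definition plat_d y := plat_q y - plat_p y.
Definition plat_e1 y := - plat_q y * (1 - plat_q y) - plat_p y * (1 - plat_p y).
Definition plat_e2 y := (2 * plat_q y - 1) * (- plat_q y * (1 - plat_q y))
  + (2 * plat_p y - 1) * (plat_p y * (1 - plat_p y)).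

Lemma hder_plat_p y : hder plat_p y (plat_p y * (1 - plat_p y)).
Proof.
have h : hder (fun y => D + y) y 1 by hder_tac; ring.
by have := hder_comp h (hder_logis (D + y)); rewrite mulr1.
Qed.

Lemma hder_plat_q y : hder plat_q y (- plat_q y * (1 - plat_q y)).
Proof.
have h : hder (fun y => D - y) y (- 1) by hder_tac; ring.
by have := hder_comp h (hder_logis (D - y)); rewrite mulrN1 mulNr.
Qed.

Let p0 y : 0 < plat_p y. Proof. exact: logis_gt0. Qed.
Let p1 y : plat_p y < 1. Proof. exact: logis_lt1. Qed.
Let q0 y : 0 < plat_q y. Proof. exact: logis_gt0. Qed.
Let q1 y : plat_q y < 1. Proof. exact: logis_lt1. Qed.

Lemma hder_plat y : hder plat y (plat y * plat_d y).
Proof.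
have hp := hder_plat_p y; have hq := hder_plat_q y.
by rewrite /plat /plat_d; eapply hder_eq; [hder_step | cbv beta; ring].
Qed.

Lemma hder_plat_d y : hder plat_d y (plat_e1 y).
Proof.
have hp := hder_plat_p y; have hq := hder_plat_q y.
by rewrite /plat_d /plat_e1; eapply hder_eq; [hder_step | cbv beta; ring].
Qed.

Lemma hder_plat_e1 y : hder plat_e1 y (plat_e2 y).
Proof.
have hp := hder_plat_p y; have hq := hder_plat_q y.
by rewrite /plat_e1 /plat_e2; eapply hder_eq; [hder_step | cbv beta; ring].
Qed.

Lemma continuous_plat_e2 : continuous plat_e2.
Proof.
apply: (@hder_continuous _ _ (fun y =>
  (- 2 * plat_q y * (1 - plat_q y)) * (- plat_q y * (1 - plat_q y))
  + (2 * plat_q y - 1) * (1 - 2 * plat_q y) * (plat_q y * (1 - plat_q y))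
  + (2 * plat_p y * (1 - plat_p y)) * (plat_p y * (1 - plat_p y))
  + (2 * plat_p y - 1) * (1 - 2 * plat_p y) * (plat_p y * (1 - plat_p y)))) => y.
have hp := hder_plat_p y; have hq := hder_plat_q y.
by rewrite /plat_e2; eapply hder_eq; [hder_step | cbv beta; ring].
Qed.

Lemma plat_gt0 y : 0 < plat y. Proof. by rewrite mulr_gt0. Qed.

Lemma plat_le1 y : plat y <= 1.
Proof. by rewrite mulr_ile1// ltW. Qed.

Lemma plat_d_le1 y : `|plat_d y| <= 1.
Proof.
have := p0 y; have := p1 y; have := q0 y; have := q1 y.
by rewrite /plat_d ler_norml; lra.
Qed.

Lemma plat_e1_le y : `|plat_e1 y| <= 1.
Proof.
have := p0 y; have := p1 y; have := q0 y; have := q1 y; rewrite /plat_e1 ler_norml.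
move: (plat_p y) (plat_q y) => p q *; apply/andP; split.
  by have := sqr_ge0 (p - 1 / 2); have := sqr_ge0 (q - 1 / 2); nra.
have h1 : 0 <= p * (1 - p) by rewrite mulr_ge0; lra.
have h2 : 0 <= q * (1 - q) by rewrite mulr_ge0; lra.
lra.
Qed.

Lemma plat_e2_le y : `|plat_e2 y| <= 2.
Proof.
have hb (p : R) : 0 < p -> p < 1 -> `|2 * p - 1| <= 1 /\ `|p * (1 - p)| <= 1.
  move=> *; split; first by rewrite ler_norml; lra.
  rewrite ger0_norm; last by rewrite mulr_ge0; lra.
  by rewrite mulr_ile1; lra.
have [h1 h2] := hb _ (p0 y) (p1 y); have [h3 h4] := hb _ (q0 y) (q1 y).
rewrite /plat_e2 mulNr; eapply le_trans; first by bnd_tac.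
lra.
Qed.

Lemma plat_expR y : plat y <= expR (D - `|y|).
Proof.
have [y0|y0] := leP 0 y.
  apply: (@le_trans _ _ (plat_q y)); last by rewrite /plat_q ger0_norm//; exact: logis_le_expR.
  by rewrite ler_piMl ?ltW.
apply: (@le_trans _ _ (plat_p y)); last by rewrite /plat_p ltr0_norm// opprK; exact: logis_le_expR.
by rewrite ler_piMr ?ltW.
Qed.

Lemma plat_ge y : 1 - plat y <= 2 * expR (`|y| - D).
Proof.
have h1 : 1 - plat_p y <= expR (`|y| - D).
  have := logis_ge (D + y); rewrite -/(plat_p y).
  have : expR (- (D + y)) <= expR (`|y| - D).
    by rewrite ler_expR; have := ler_norm (- y); rewrite normrN; lra.
  lra.
have h2 : 1 - plat_q y <= expR (`|y| - D).
  have := logis_ge (D - y); rewrite -/(plat_q y).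
  have : expR (- (D - y)) <= expR (`|y| - D).
    by rewrite ler_expR; have := ler_norm y; lra.
  lra.
have := p0 y; have := p1 y; have := q0 y; have := q1 y; rewrite /plat.
move: (plat_p y) (plat_q y) h1 h2 => p q; nra.
Qed.

(** The polynomials in the two logistic factors: bounded and stable under differentiation. Their
    products with the plateau form the class needed by [schwartz_of_closed]. *)
Inductive plat_alg : (R -> R) -> Prop :=
| plat_alg_cst c : plat_alg (fun=> c)
| plat_alg_p : plat_alg plat_p
| plat_alg_q : plat_alg plat_q
| plat_alg_add f g : plat_alg f -> plat_alg g -> plat_alg (fun y => f y + g y)
| plat_alg_mul f g : plat_alg f -> plat_alg g -> plat_alg (fun y => f y * g y).

Lemma plat_alg_der f : plat_alg f -> exists2 f', plat_alg f' & forall y, hder f y (f' y).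
Proof.
have h1 f1 : plat_alg f1 -> plat_alg (fun y => f1 y * (1 + -1 * f1 y)).
  move=> pf; apply: plat_alg_mul => //; apply: plat_alg_add; first exact: plat_alg_cst.
  by apply: plat_alg_mul => //; exact: plat_alg_cst.
elim=> {f} [c|||f g pf [f' pf' hf] pg [g' pg' hg]|f g pf [f' pf' hf] pg [g' pg' hg]].
- by exists (fun=> 0); [exact: plat_alg_cst|move=> y; exact: hder_cst].
- exists (fun y => plat_p y * (1 + -1 * plat_p y)); first exact/h1/plat_alg_p.
  by move=> y; rewrite mulN1r; exact: hder_plat_p.
- exists (fun y => -1 * (plat_q y * (1 + -1 * plat_q y))).
    by apply: plat_alg_mul; [exact: plat_alg_cst|exact/h1/plat_alg_q].
  by move=> y; rewrite !mulN1r -mulNr; exact: hder_plat_q.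
- exists (fun y => f' y + g' y); first exact: plat_alg_add.
  by move=> y; exact: hder_add.
- exists (fun y => f' y * g y + f y * g' y); last by move=> y; exact: hder_mul.
  by apply: plat_alg_add; exact: plat_alg_mul.
Qed.

Lemma plat_alg_bounded f : plat_alg f -> exists C, forall y, `|f y| <= C.
Proof.
elim=> {f} [c|||f g _ [C hC] _ [C' hC']|f g _ [C hC] _ [C' hC']].
- by exists `|c|.
- by exists 1 => y; rewrite gtr0_norm// ltW.
- by exists 1 => y; rewrite gtr0_norm// ltW.
- by exists (C + C') => y; exact: bnd_add.
- by exists (C * C') => y; exact: bnd_mul.
Qed.

Lemma schwartz_plat : schwartz plat.
Proof.
apply: (@schwartz_of_closed _ (fun h => exists2 f, plat_alg f & h = fun y => plat y * f y)).
- move=> _ [f pf ->]; have [f' pf' hf] := plat_alg_der pf.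
  exists (fun y => plat y * ((plat_q y + -1 * plat_p y) * f y + f' y)).
    exists (fun y => (plat_q y + -1 * plat_p y) * f y + f' y) => //.
    apply: plat_alg_add => //; apply: plat_alg_mul => //; apply: plat_alg_add.
      exact: plat_alg_q.
    by apply: plat_alg_mul; [exact: plat_alg_cst|exact: plat_alg_p].
  move=> y; apply: hder_eq (hder_mul (hder_plat y) (hf y)) _.
  by rewrite /plat_d; ring.
- move=> _ [f /plat_alg_bounded [C hC] ->]; apply: (rapidMb _ hC).
  apply: (@rapid_expR _ _ (expR D)) => y.
  by rewrite gtr0_norm ?plat_gt0// -expRD plat_expR.
- by exists (fun=> 1); [exact: plat_alg_cst|apply/funext => y; rewrite mulr1].
Qed.

End plateau.

(** * Solutions as smooth curves *)

Section schwartz_curves.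
Variable R : realType.
Implicit Types (f g : R -> R) (u v : R -> R -> R) (x h eps c : R).

Lemma hder_of_quotient f t l :
  (forall eps, 0 < eps -> exists2 r, 0 < r & forall h, h != 0 -> `|h| < r ->
     `|h^-1 * (f (t + h) - f t) - l| <= eps) -> hder f t l.
Proof.
move=> hq.
have hc : (fun h => h^-1 *: ((f \o shift t) (h *: (1 : R)) - f t)) @ (0 : R)^' --> l.
  apply/cvgrPdist_le => eps eps0; have [r r0 hr] := hq _ eps0.
  suff : nbhs (0 : R) (fun h => h != 0 -> `|l - h^-1 *: ((f \o shift t) (h *: (1 : R)) - f t)| <= eps) by [].
  apply/nbhs_ballP; exists r => //= h.
  rewrite /ball /= sub0r normrN => hr' h0.
  rewrite distrC /shift /= /GRing.scale /= mulr1 [h + t]addrC; exact: hr.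
by split; [apply/cvg_ex; exists l|exact: cvg_lim hc].
Qed.

Lemma derive1n_quotient f g w n h : schwartz f -> schwartz g -> schwartz w ->
  derive1n n (fun x => h^-1 * (f x - g x) - w x) =
  fun x => h^-1 * (derive1n n f x - derive1n n g x) - derive1n n w x.
Proof.
move=> sf sg sw; elim: n => [//|n IH]; rewrite [LHS]derive1nS IH.
apply/funext => x; apply: hder_derive1.
have h1 := schwartz_hder n x sf; have h2 := schwartz_hder n x sg; have h3 := schwartz_hder n x sw.
by eapply hder_eq; [hder_step | cbv beta; ring].
Qed.

Lemma curve_near u v t (k n : nat) eps : (forall t, schwartz (u t)) -> (forall t, schwartz (v t)) ->
  schwartz_time_derivative u v -> 0 < eps ->
  exists2 r : R, 0 < r & forall h, h != 0 -> `|h| < r -> forall x,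
    `|x ^+ k * (h^-1 * (derive1n n (u (t + h)) x - derive1n n (u t) x) - derive1n n (v t) x)| <= eps.
Proof.
move=> su sv hd eps0; have := hd t k n.
have e0 : (0 < eps%:E)%E by rewrite lte_fin.
move=> /(_ _ (open_ereal_lt' e0)) hn.
have /nbhs_ballP[r r0 hr] : nbhs (0 : R) (fun h => h != 0 -> (schwartz_seminorm k n
    (fun x => h^-1 * (u (t + h)%R x - u t x) - v t x)%R < eps%:E)%E) by exact: hn.
exists r => // h h0 hr' x; rewrite -lee_fin; apply: ltW; apply: le_lt_trans (hr h _ h0); last first.
  by rewrite /ball /= sub0r normrN.
have := @seminorm_ub R k n (fun x => h^-1 * (u (t + h) x - u t x) - v t x) x.
by rewrite (derive1n_quotient n h (su (t + h)) (su t) (sv t)).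
Qed.

Lemma curve_hder u v n t x : (forall t, schwartz (u t)) -> (forall t, schwartz (v t)) ->
  schwartz_time_derivative u v ->
  hder (fun t => derive1n n (u t) x) t (derive1n n (v t) x).
Proof.
move=> su sv hd; apply: hder_of_quotient => eps eps0.
have [r r0 hr] := curve_near t 0 n su sv hd eps0.
by exists r => // h h0 hr'; have := hr h h0 hr' x; rewrite expr0 mul1r.
Qed.

(** Convergence of the difference quotients in the seminorms with weights 1 and x^2 bounds (1 + x^2)
    times the n-th derivative uniformly for t near t0. *)
Lemma curve_lnice u v n t0 : (forall t, schwartz (u t)) -> (forall t, schwartz (v t)) ->
  schwartz_time_derivative u v -> lnice t0 (fun t => derive1n n (u t)).
Proof.
move=> su sv hd.
have [r r0 hr] := curve_near t0 0 n su sv hd ltr01.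
have [r' r'0 hr'] := curve_near t0 2 n su sv hd ltr01.
have bd f k : schwartz f -> exists2 C, 0 <= C & forall x, `|x ^+ k * derive1n n f x| <= C.
  by move=> sf; have [C hC] := schwartz_rapid n sf k; exists C => //; apply: le_trans (hC 0).
have [A0 A00 hA0] := bd _ 0%N (su t0); have [A2 A20 hA2] := bd _ 2%N (su t0).
have [B0 B00 hB0] := bd _ 0%N (sv t0); have [B2 B20 hB2] := bd _ 2%N (sv t0).
exists (Num.min (Num.min r r') 1); first by rewrite !lt_min r0 r'0 ltr01.
exists ((A0 + (B0 + 1)) + (A2 + (B2 + 1))) => t; rewrite !lt_min => /andP[/andP[tr tr'] t1].
split; first by apply: (@hder_continuous _ _ (derive1n n.+1 (u t))) => x; exact: schwartz_hder.
have key k A B : 0 <= B -> (forall x, `|x ^+ k * derive1n n (u t0) x| <= A) ->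
   (forall x, `|x ^+ k * derive1n n (v t0) x| <= B) ->
   (forall h, h != 0 -> `|h| < (if k is 0%N then r else r') -> forall x,
    `|x ^+ k * (h^-1 * (derive1n n (u (t0 + h)) x - derive1n n (u t0) x) - derive1n n (v t0) x)| <= 1) ->
   `|t - t0| < (if k is 0%N then r else r') ->
   forall x, `|x ^+ k * derive1n n (u t) x| <= A + (B + 1).
  move=> B'0 hA hB hk tk x; have [->|tt0] := eqVneq t t0.
    by rewrite (le_trans (hA x))// lerDl addr_ge0.
  set h := t - t0; have h0 : h != 0 by rewrite subr_eq0.
  have e : x ^+ k * derive1n n (u t) x = x ^+ k * derive1n n (u t0) x
     + h * (x ^+ k * derive1n n (v t0) x + x ^+ k * (h^-1 * (derive1n n (u (t0 + h)) x
          - derive1n n (u t0) x) - derive1n n (v t0) x)).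
    by rewrite (_ : t0 + h = t) ?[t0 + _]addrC ?subrK//; field.
  rewrite e; apply: bnd_add => //; rewrite -[B + 1]mul1r; apply: bnd_mul; first exact: ltW.
  by apply: bnd_add => //; exact: hk.
move=> x; rewrite ler_pdivlMr ?oneD_gt0// mulrDr mulr1; apply: lerD.
  by have := key 0%N A0 B0 B00 hA0 hB0 hr tr x; rewrite expr0 mul1r.
have := key 2%N A2 B2 B20 hA2 hB2 hr' tr' x.
by rewrite normrM normrX real_normK ?num_real// mulrC.
Qed.

(** The equation identifies the time derivative of the curve with 6 u^2 u_x - u_xxx; differentiating
    this in x gives the evolution of u_x and u_xx. *)
Lemma mkdv_solution_family (u0 : R -> R) u : mkdv_solution u0 u ->
  mkdv_family (fun n t x => derive1n n (u t) x).
Proof.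
move=> [[U [U0 sU dU]] pde _].
have su t : schwartz (u t) by rewrite -U0.
have sv t : schwartz (U 1%N t) by [].
have hd : schwartz_time_derivative u (U 1%N) by rewrite -U0; exact: dU.
have hx n t x := schwartz_hder n x (su t).
have vE t x : U 1%N t x = 6 * u t x ^+ 2 * derive1n 1 (u t) x - derive1n 3 (u t) x.
  have := pde t x; rewrite (hder_derive1 (curve_hder 0 t x su sv hd)) /= => <-.
  by rewrite addrK.
have v1E t x : derive1n 1 (U 1%N t) x = 12 * derive1n 0 (u t) x * derive1n 1 (u t) x ^+ 2
   + 6 * derive1n 0 (u t) x ^+ 2 * derive1n 2 (u t) x - derive1n 4 (u t) x.
  apply: (hder_unique (schwartz_hder 0 x (sv t))).
  apply: (hder_ext (f := fun x => 6 * derive1n 0 (u t) x ^+ 2 * derive1n 1 (u t) x - derive1n 3 (u t) x)).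
    by move=> y; rewrite /= vE.
  move: (hx 0%N t) (hx 1%N t) (hx 3%N t).
  move: (derive1n 0 (u t)) (derive1n 1 (u t)) (derive1n 2 (u t)) (derive1n 3 (u t))
    (derive1n 4 (u t)) => f0 f1 f2 f3 f4 h0 h1 h3 {hx vE hd}.
  by eapply hder_eq; [hder_step | cbv beta; ring].
have v2E t x : derive1n 2 (U 1%N t) x = 12 * derive1n 1 (u t) x ^+ 3
   + 36 * derive1n 0 (u t) x * derive1n 1 (u t) x * derive1n 2 (u t) x
   + 6 * derive1n 0 (u t) x ^+ 2 * derive1n 3 (u t) x - derive1n 5 (u t) x.
  apply: (hder_unique (schwartz_hder 1 x (sv t))).
  apply: (hder_ext (f := fun x => 12 * derive1n 0 (u t) x * derive1n 1 (u t) x ^+ 2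
   + 6 * derive1n 0 (u t) x ^+ 2 * derive1n 2 (u t) x - derive1n 4 (u t) x)).
    by move=> y; rewrite v1E.
  move: (hx 0%N t) (hx 1%N t) (hx 2%N t) (hx 4%N t).
  move: (derive1n 0 (u t)) (derive1n 1 (u t)) (derive1n 2 (u t)) (derive1n 3 (u t))
    (derive1n 4 (u t)) (derive1n 5 (u t)) => f0 f1 f2 f3 f4 f5 h0 h1 h2 h4 {hx vE v1E hd}.
  by eapply hder_eq; [hder_step | cbv beta; ring].
split.
- by move=> n t x; exact: hx.
- by move=> n t; exact: curve_lnice hd.
- by move=> t x; have := curve_hder 0 t x su sv hd; rewrite /= vE.
- by move=> t x; have := curve_hder 1 t x su sv hd; rewrite v1E.
- by move=> t x; have := curve_hder 2 t x su sv hd; rewrite v2E.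
Qed.

Lemma lnice_rescale (f' : R -> R -> R) (k l : R) t0 : 0 < l -> lnice (k * t0) f' ->
  lnice t0 (fun t x => f' (k * t) (l * x) : R).
Proof.
move=> l0 [r r0 [C h]].
have l0' : l != 0 by rewrite gt_eqF.
have [C' hC'] := lor_affine 0 l0'.
exists (r / (`|k| + 1)); first by rewrite divr_gt0// ltr_wpDl.
exists (C * C') => t ht.
have [|c b] := h (k * t).
  rewrite -mulrBr normrM; have k1 : 0 < `|k| + 1 by rewrite ltr_wpDl.
  rewrite ltr_pdivlMr// in ht.
  by apply: le_lt_trans ht; rewrite mulrC ler_wpM2l// lerDl.
split.
  move=> x; apply: (@continuous_comp _ _ _ (fun x => l * x) (f' (k * t))); last exact: c.
  by apply: (@hder_continuous _ _ (fun=> l)) => z; hder_tac; ring.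
move=> x; rewrite (le_trans (b _))// -mulrA ler_wpM2l ?(ge0_nice_const b)//.
by have := hC' x; rewrite addr0.
Qed.

(** The scaling symmetry of the equation, used with l = 1/N to bring the carrier frequency N to
    one. *)
Lemma mkdv_family_rescale (v : nat -> R -> R -> R) (l : R) : 0 < l -> mkdv_family v ->
  mkdv_family (fun n t x => l ^+ n.+1 * v n (l ^+ 3 * t) (l * x)).
Proof.
move=> l0 hv.
have hlx x : hder (fun x => l * x) x l by hder_tac; ring.
have hlt t : hder (fun t => l ^+ 3 * t) t (l ^+ 3) by hder_tac; ring.
split.
- move=> n t x; have := hder_scale (l ^+ n.+1) (hder_comp (hlx x) (fam_x hv n (l ^+ 3 * t) (l * x))).
  by move=> h; apply: hder_eq h _; rewrite [l ^+ n.+2]exprS; ring.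
- by move=> n t; apply: lniceZ; apply: lnice_rescale => //; exact: fam_nice.
- move=> t x; have := hder_scale (l ^+ 1) (hder_comp (hlt t) (fam_t0 hv (l ^+ 3 * t) (l * x))).
  by move=> h; apply: hder_eq h _; ring.
- move=> t x; have := hder_scale (l ^+ 2) (hder_comp (hlt t) (fam_t1 hv (l ^+ 3 * t) (l * x))).
  by move=> h; apply: hder_eq h _; ring.
- move=> t x; have := hder_scale (l ^+ 3) (hder_comp (hlt t) (fam_t2 hv (l ^+ 3 * t) (l * x))).
  by move=> h; apply: hder_eq h _; ring.
Qed.

End schwartz_curves.

(** * Gaussian wave packets *)

Section gaussian_packets.
Variable R : realType.
Implicit Types (x y z xi b c : R).
Local Notation gauss := (@gauss R).

Definition gauss_mass : R := integ gauss.
Local Notation cg := gauss_mass.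

Let ng : nice gauss := schwartz_nice (schwartz_gauss R).

Lemma nice_zgauss : nice (fun z => z * gauss z).
Proof.
have := niceN (schwartz_nice (schwartz_derive1 (schwartz_gauss R))); congr nice.
by apply/funext => z; rewrite (hder_derive1 (hder_gauss z)); ring.
Qed.

Lemma gauss_cos_nice xi b : nice (fun z => gauss z * cos (xi * z + b)).
Proof. exact: schwartz_nice (schwartz_cos xi b (schwartz_gauss R)). Qed.

Lemma hder_const_eq (f : R -> R) : (forall x, hder f x 0) -> forall x, f x = f 0.
Proof.
move=> h x; have hz (y : R) : `|0 : R| <= 0 by rewrite normr0.
have [x0|x0] := leP 0 x.
  have := @hder_bound _ f (fun=> 0) 0 x 0 (fun s _ => h s) x0 (fun y _ => hz y).
  by rewrite mul0r normr_le0 subr_eq0 => /eqP.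
have := @hder_bound _ f (fun=> 0) x 0 0 (fun s _ => h s) (ltW x0) (fun y _ => hz y).
by rewrite mul0r normr_le0 subr_eq0 => /eqP.
Qed.

(* The integral solves the linear equation [J' = - xi J]. *)
Lemma integ_gauss_cos xi b : integ (fun z => gauss z * cos (xi * z + b)) = cg * gauss xi * cos b.
Proof.
pose J xi := integ (fun z => gauss z * cos (xi * z + b)).
have nzs xi' : nice (fun z => z * gauss z * sin (xi' * z + b)).
  apply: (niceMb (C := 1)) nice_zgauss _ _; last by move=> z; exact: norm_sin_le1.
  by apply: (@hder_continuous _ _ (fun z => cos (xi' * z + b) * xi')) => z; hder_tac; ring.
have J1 xi' : integ (fun z => z * gauss z * sin (xi' * z + b)) = xi' * J xi'.
  have := @integ_der _ (fun z => gauss z * sin (xi' * z + b))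
    (fun z => xi' * (gauss z * cos (xi' * z + b)) - z * gauss z * sin (xi' * z + b)).
  have hd z : hder (fun z => gauss z * sin (xi' * z + b)) z
    (xi' * (gauss z * cos (xi' * z + b)) - z * gauss z * sin (xi' * z + b)).
    have hg := hder_gauss z; eapply hder_eq; [hder_step | cbv beta; ring].
  move=> /(_ hd) h.
  have n1 : nice (fun z => xi' * (gauss z * cos (xi' * z + b))) by apply/niceZ/gauss_cos_nice.
  have := h (schwartz_nice (schwartz_sin xi' b (schwartz_gauss R))) (niceB n1 (nzs xi')).
  rewrite integB// integZ; last exact: gauss_cos_nice.
  by move/subr0_eq.
have hJ xi' : hder J xi' (- (xi' * J xi')).
  have [C hC] := nice_zgauss.2.
  have := @hder_integ _ (fun xi z => gauss z * cos (xi * z + b))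
    (fun xi z => -1 * (z * gauss z * sin (xi * z + b))) xi' 1 C ltr01.
  move=> h; apply: (hder_eq (h _ _ _)).
  - by move=> t _; exact: gauss_cos_nice.
  - by move=> t z _; hder_tac; ring.
  - move=> t z _; rewrite normrM normrN1 mul1r normrM.
    by rewrite -[leRHS]mulr1 ler_pM// norm_sin_le1.
  - by rewrite integZ// J1 mulN1r.
have hE xi' : hder (fun xi => J xi * expR (xi ^+ 2 / 2)) xi' 0.
  by have hj := hJ xi'; eapply hder_eq; [hder_step | cbv beta; field].
have := hder_const_eq hE xi.
rewrite expr0n /= mul0r expR0 mulr1.
have -> : J 0 = cg * cos b.
  rewrite /J /gauss_mass mulrC -integZ//; apply: eq_integ => z.
  by rewrite mul0r add0r mulrC.
rewrite -/(J xi) => h.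
have -> : cg * gauss xi * cos b = (J xi * expR (xi ^+ 2 / 2)) * gauss xi by rewrite h; ring.
by rewrite -mulrA /gauss -expRD addrC addNr expR0 mulr1.
Qed.

(** By comparison with the smaller function exp(-x^2), whose integral is known. *)
Lemma gauss_mass_gt0 : 0 < cg.
Proof.
have nf : nice (@gauss_fun R).
  split; first exact: continuous_gauss_fun.
  have [C hC] := ng.2; exists C => x; apply: le_trans (hC x).
  rewrite ger0_norm ?gauss_fun_ge0// ger0_norm ?expR_ge0// ler_expR.
  by have := sqr_ge0 x; lra.
apply: (@lt_le_trans _ _ (integ (@gauss_fun R))).
  by rewrite /integ /Rintegral integralT_gauss /= sqrtr_gt0 pi_gt0.
apply: le_integ => // x; rewrite ler_expR; have := sqr_ge0 x; lra.
Qed.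

Lemma nice_sqr_gauss : nice (fun z => z ^+ 2 * gauss z).
Proof.
have := schwartz_nice (schwartz_derive1 (schwartz_derive1 (schwartz_gauss R))).
have -> : derive1 (derive1 gauss) = fun z => z ^+ 2 * gauss z - gauss z.
  have e : derive1 gauss = fun z => - z * gauss z.
    by apply/funext => z; rewrite (hder_derive1 (hder_gauss z)).
  rewrite e; apply/funext => z; apply: hder_derive1; have hg := hder_gauss z.
  by eapply hder_eq; [hder_step | cbv beta; ring].
move=> h; have := niceD h ng; congr nice; apply/funext => z; ring.
Qed.

Lemma integ_sqr_gauss : integ (fun z => z ^+ 2 * gauss z) = cg.
Proof.
have := @integ_der _ (fun z => z * gauss z) (fun z => gauss z - z ^+ 2 * gauss z).
have hd z : hder (fun z => z * gauss z) z (gauss z - z ^+ 2 * gauss z).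
  by have hg := hder_gauss z; eapply hder_eq; [hder_step | cbv beta; ring].
move=> /(_ hd nice_zgauss (niceB ng nice_sqr_gauss)); rewrite integB//; last exact: nice_sqr_gauss; move=> /subr0_eq <-.
by [].
Qed.

Variables (sigma N x0 al : R).
Hypothesis s0 : 0 < sigma.
Let s0' : sigma != 0. Proof. by rewrite gt_eqF. Qed.

(** The test functions live on the Fourier side: a Gaussian of width 1/sigma around N. The
    modulation by x0 places the corresponding packet in x around -x0. *)
Definition packet_env xi : R := gauss (sigma * (xi - N)).
Definition packet_cos xi : R := packet_env xi * cos (x0 * (xi - N) + al).
Definition packet_sin xi : R := packet_env xi * sin (x0 * (xi - N) + al).
Definition packet x : R := gauss ((x0 + x) / sigma) * cos (N * x + al).

Let envE xi : packet_env xi = gauss (sigma * xi + (- (sigma * N))).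
Proof. by rewrite /packet_env mulrBr. Qed.

Lemma schwartz_packet_env : schwartz packet_env.
Proof.
have := schwartz_affine (- (sigma * N)) s0' (schwartz_gauss R).
by congr schwartz; apply/funext => xi; rewrite envE.
Qed.

Lemma schwartz_packet_cos : schwartz packet_cos.
Proof.
have := schwartz_cos x0 (al - x0 * N) schwartz_packet_env.
by congr schwartz; apply/funext => xi; rewrite /packet_cos; congr (_ * cos _); ring.
Qed.

Lemma schwartz_packet_sin : schwartz packet_sin.
Proof.
have := schwartz_sin x0 (al - x0 * N) schwartz_packet_env.
by congr schwartz; apply/funext => xi; rewrite /packet_sin; congr (_ * sin _); ring.
Qed.

Lemma schwartz_packet : schwartz packet.
Proof.
have si : sigma^-1 != 0 by rewrite invr_eq0.
have := schwartz_cos N al (schwartz_affine (x0 / sigma) si (schwartz_gauss R)).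
by congr schwartz; apply/funext => x; rewrite /packet; congr (gauss _ * _); ring.
Qed.

Lemma nice_packet_osc b c : nice (fun xi => packet_env xi * cos (b * xi + c)).
Proof. exact: schwartz_nice (schwartz_cos b c schwartz_packet_env). Qed.

Lemma integ_packet x : integ (fun xi => packet_env xi * cos (x0 * (xi - N) + al + xi * x))
  = cg / sigma * packet x.
Proof.
rewrite (@eq_integ _ _ (fun xi => (fun z => gauss z * cos ((x0 + x) / sigma * z + (N * x + al)))
   (sigma * xi + (- (sigma * N))))); last first.
  by move=> xi; rewrite envE; congr (_ * cos _); field.
rewrite (@integ_affine _ (fun z => gauss z * cos ((x0 + x) / sigma * z + (N * x + al))))//.
  by rewrite integ_gauss_cos /packet; ring.
exact: gauss_cos_nice.
Qed.

(** The real part of a transform is even, so the packet appears with its mirror image. The imaginary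
    part, taken with the sine test function, gives the difference of the two, and the sum of both
    isolates the packet. *)
Lemma Re_fourier_packet x : complex.Re (fourier packet_cos x) =
  (cg / sigma * packet x + cg / sigma * packet (- x)) / 2.
Proof.
rewrite -!integ_packet /= -/(integ _).
have nn y : nice (fun xi => packet_env xi * cos (x0 * (xi - N) + al + xi * y)).
  have := nice_packet_osc (x0 + y) (al - x0 * N); congr nice; apply/funext => xi.
  by congr (_ * cos _); ring.
rewrite -integD// [RHS]mulrC -integZ; last exact: niceD.
apply: eq_integ => xi; by rewrite /packet_cos mulrN (cosB _ (xi * x)) (cosD _ (xi * x)); field.
Qed.

Lemma Im_fourier_packet x : complex.Im (fourier packet_sin x) =
  (cg / sigma * packet x - cg / sigma * packet (- x)) / 2.
Proof.
rewrite -!integ_packet /= -/(integ _).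
have nn y : nice (fun xi => packet_env xi * cos (x0 * (xi - N) + al + xi * y)).
  have := nice_packet_osc (x0 + y) (al - x0 * N); congr nice; apply/funext => xi.
  by congr (_ * cos _); ring.
rewrite -integB// [RHS]mulrC -integZ; last exact: niceB.
have ns : nice (fun xi => packet_sin xi * sin (xi * x)).
  have := schwartz_nice (schwartz_sin x 0 schwartz_packet_sin); congr nice.
  by apply/funext => xi; rewrite addr0 [x * xi]mulrC.
rewrite -[LHS]mulN1r -integZ//.
by apply: eq_integ => xi; rewrite /packet_sin mulrN (cosB _ (xi * x)) (cosD _ (xi * x)); field.
Qed.

Lemma schwartz_packet_refl : schwartz (fun x => packet (- x)).
Proof.
have n1 : -1 != 0 :> R by rewrite oppr_eq0 oner_eq0.
have := schwartz_affine 0 n1 schwartz_packet.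
by congr schwartz; apply/funext => x; rewrite mulN1r addr0.
Qed.

End gaussian_packets.

(** * The Sobolev weight near frequency N *)

Section sobolev_weight.
Variable R : realType.
Implicit Types (x y z xi s N L : R).

Lemma powR_le_max (t s : R) : 0 < t -> 0 <= s -> s <= 1 -> t `^ s <= 1 + t.
Proof.
move=> t0 s0 s1; have [t1|t1] := leP t 1.
  apply: (@le_trans _ _ 1); last by rewrite lerDl ltW.
  by rewrite -[leRHS](powRr0 t) ger_powR// t0.
apply: (@le_trans _ _ t); last by rewrite lerDr.
by rewrite -[leRHS]powRr1 ?(ltW t0)// ler_powR// ltW.
Qed.

(** Near N the weight is comparable to N^(2 s); elsewhere the loss is paid by the quadratic factor,
    that is by decay of the transform on the scale 1/L. The proof bounds t^s, where t is the ratio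
    of 1 + xi^2 to N^2. *)
Lemma sobolev_weight_le s N L xi : - (1 / 4) < s < 1 / 4 -> 1 <= N -> 0 < L -> 1 <= L ^+ 2 * N ->
  1 <= N * L ->
  (1 + xi ^+ 2) `^ s <= 16 * N `^ (2 * s) * (1 + (L * (xi - N)) ^+ 2).
Proof.
move=> /andP[s1 s2] N1 L0 LN NL.
have N0 : 0 < N := lt_le_trans ltr01 N1.
set z := L * (xi - N).
have xiE : xi = N + z / L by rewrite /z; field; rewrite gt_eqF.
have NN : N `^ (2 * s) = (N ^+ 2) `^ s.
  by rewrite powRrM -powR_mulrn// ltW.
have N2 : 0 < N ^+ 2 by rewrite exprn_gt0.
rewrite NN; set t := (1 + xi ^+ 2) / N ^+ 2.
have t0 : 0 < t by rewrite divr_gt0// oneD_gt0.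
have -> : 1 + xi ^+ 2 = N ^+ 2 * t by rewrite /t mulrC divfK// gt_eqF.
rewrite powRM ?(ltW N2) ?(ltW t0)// [16 * _]mulrC -mulrA ler_wpM2l ?powR_ge0//.
have z2 := sqr_ge0 z.
have tE : t = N ^- 2 + (1 + z / (N * L)) ^+ 2.
  by rewrite /t xiE; field; rewrite !gt_eqF.
have zb : (z / (N * L)) ^+ 2 <= z ^+ 2.
  rewrite expr_div_n ler_pdivrMr ?exprn_gt0 ?mulr_gt0// ler_peMr// exprn_ege1//.
have iN : N ^- 2 <= 1 by rewrite invf_le1// exprn_ege1.
have [ss|ss] := leP 0 s.
  apply: le_trans (powR_le_max t0 ss _) _; first by lra.
  rewrite tE; move: zb; set w := z / _ => zb; have := sqr_ge0 (1 - w); nra.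
(* For s < 0 and |xi - N| <= N/2 the ratio t is at least 1/4, so t^s <= 4. *)
have [zs|zs] := leP (z ^+ 2) ((N * L) ^+ 2 / 4).
  have w4 : (z / (N * L)) ^+ 2 <= 1 / 4.
    by rewrite expr_div_n ler_pdivrMr ?exprn_gt0 ?mulr_gt0//; lra.
  have t4 : 1 / 4 <= t.
    have : 0 <= N ^- 2 by rewrite invr_ge0 ltW.
    rewrite tE; move: w4; set w := z / _ => w4.
    have w12 : -(1/2) <= w.
      rewrite leNgt; apply/negP => hw; have : 1 / 4 < w ^+ 2 by nra.
      by rewrite ltNge w4.
    nra.
  have -> : t `^ s = (t `^ (- s))^-1 by rewrite -powRN opprK.
  apply: (@le_trans _ _ 4); last by lra.
  have h4 : (1 / 4) `^ (- s) <= t `^ (- s).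
    by rewrite ge0_ler_powR// ?nnegrE ?(ltW t0)//; lra.
  have h5 : 1 / 4 <= (1 / 4 : R) `^ (- s).
    by apply: ger1_powR; lra.
  have h6 : 1 / 4 <= t `^ (- s) := le_trans h5 h4.
  have p0 : 0 < t `^ (- s) by apply: lt_le_trans h6; lra.
  rewrite -[leLHS]div1r ler_pdivrMr//; lra.
(* At distance more than N/2 from N, only t >= N^-2 is available: t^s <= N^(-2 s) <= N, and L^2 N >=
   1 bounds this by (N L)^2 < 4 z^2. *)
have tN : N ^- 2 <= t by rewrite tE lerDl sqr_ge0.
have -> : t `^ s = (t `^ (- s))^-1 by rewrite -powRN opprK.
have iN0 : 0 < N ^- 2 by rewrite invr_gt0.
have h4 : (N ^- 2) `^ (- s) <= t `^ (- s).
  by rewrite ge0_ler_powR// ?nnegrE ?(ltW t0) ?(ltW iN0)//; lra.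
have h5 : N^-1 <= (N ^- 2) `^ (- s).
  have -> : (N ^- 2) `^ (- s) = N^-1 `^ (2 * - s).
    by rewrite -exprVn -powR_mulrn ?invr_ge0 ?(ltW N0)// -powRrM.
  by apply: ger1_powR; [rewrite invr_gt0 N0 /= invf_le1|lra].
have h6 := le_trans h5 h4.
have Ni : 0 < N^-1 by rewrite invr_gt0.
have : (t `^ (- s))^-1 <= N by rewrite -[leRHS]invrK lef_pV2 ?posrE// (lt_le_trans Ni).
move=> h; apply: le_trans h _.
have : N <= (N * L) ^+ 2.
  rewrite exprMn [N ^+ 2]expr2 -mulrA ler_peMr ?(ltW N0)// mulrC//.
lra.
Qed.

End sobolev_weight.

(** * Bounds of the Sobolev norm *)

Section weighted_norms.
Variable R : realType.
Implicit Types (x y z xi s N L : R).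
Local Notation mu := (@lebesgue_measure R).

Lemma Lnorm2_le (F : R -> R) (k : R) : 0 <= k ->
  (\int[mu]_x (F x ^+ 2)%:E <= (k ^+ 2)%:E)%E ->
  (Lnorm mu 2%:E (EFin \o F) <= k%:E)%E.
Proof.
move=> k0; rewrite unlock /Lnorm.
have -> : (\int[mu]_x (`|(EFin \o F) x| `^ 2) = \int[mu]_x (F x ^+ 2)%:E)%E.
  apply: eq_integral => x _; rewrite /=; congr EFin.
  by rewrite powR_mulrn// real_normK// num_real.
have : (0 <= \int[mu]_x (F x ^+ 2)%:E)%E.
  by apply: integral_ge0 => x _; rewrite lee_fin sqr_ge0.
case: (\int[mu]_x _)%E => [r| |]//.
rewrite !lee_fin => r0 rk.
rewrite powR12_sqrt//.
by rewrite -[leRHS]ger0_norm// -sqrtr_sqr ler_wsqrtr.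
Qed.

Lemma integral_le_integ (F h : R -> R) : measurable_fun setT F -> nice h ->
  (forall x, 0 <= F x <= h x) -> (\int[mu]_x (F x)%:E <= (integ h)%:E)%E.
Proof.
move=> mF nh Fh; rewrite /integ /Rintegral fineK; last first.
  by apply: integrable_fin_num => //; exact: nice_integrable.
apply: ge0_le_integral => //.
- by move=> x _; rewrite lee_fin; case/andP: (Fh x).
- exact/measurable_EFinP.
- by apply/measurable_EFinP; exact: continuous_measurable_funT nh.1.
- by move=> x _; rewrite lee_fin; case/andP: (Fh x).
Qed.

Lemma normr_fine_le (X : \bar R) (c : R) : (`|X| <= c%:E)%E -> `|fine X| <= c.
Proof. by case: X => [r| |] //=; rewrite lee_fin. Qed.

Definition hs_weight s xi : R := (1 + xi ^+ 2) `^ (s / 2).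

Lemma hs_weightN s xi : hs_weight s xi * hs_weight (- s) xi = 1.
Proof. by rewrite /hs_weight mulNr powRN mulfV// gt_eqF// powR_gt0// oneD_gt0. Qed.

Lemma hs_weight_sqr s xi : hs_weight s xi ^+ 2 = (1 + xi ^+ 2) `^ s.
Proof.
rewrite /hs_weight -powR_mulrn ?powR_ge0// -powRrM; congr (_ `^ _).
by field.
Qed.

Lemma measurable_hs_weight s : measurable_fun setT (hs_weight s).
Proof.
apply: (measurableT_comp (@measurable_powR R (s / 2))).
apply: continuous_measurable_funT => x; apply: cvgD; first exact: cvg_cst.
exact: exprn_continuous.
Qed.

(** The duality of H^s and H^-s: Hoelder's inequality with the weights of orders s and -s, whose
    product is one. *)
Lemma weighted_pairing (g : R -> R[i]) (h psi gam : R -> R) s (r k : R) :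
  measurable_fun setT (fun xi => complex.Re (g xi)) ->
  measurable_fun setT (fun xi => complex.Im (g xi)) ->
  measurable_fun setT h -> measurable_fun setT psi -> measurable_fun setT gam ->
  (forall xi, `|h xi| <= ComplexField.Normc.normc (g xi)) ->
  (forall xi, `|psi xi| <= gam xi) ->
  0 <= k -> (\int[mu]_x ((hs_weight (- s) x * gam x) ^+ 2)%:E <= (k ^+ 2)%:E)%E ->
  0 <= r -> (hs_weighted_norm s g <= r%:E)%E ->
  `|\int[mu]_xi (h xi * psi xi)| <= r * k.
Proof.
move=> mRe mIm mh mpsi mgam hh hpsi k0 hk r0 hr.
apply: normr_fine_le.
have mn : measurable_fun setT (fun xi => ComplexField.Normc.normc (g xi)).
  have -> : (fun xi => ComplexField.Normc.normc (g xi)) =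
    (fun xi => Num.sqrt (complex.Re (g xi) ^+ 2 + complex.Im (g xi) ^+ 2)).
    by apply/funext => xi; case: (g xi).
  apply: measurableT_comp; first by apply: continuous_measurable_funT; exact: sqrt_continuous.
  by apply: measurable_funD; apply: measurable_funX.
pose F1 xi := hs_weight s xi * ComplexField.Normc.normc (g xi).
pose F2 xi := hs_weight (- s) xi * gam xi.
have mF1 : measurable_fun setT F1 by apply: measurable_funM => //; exact: measurable_hs_weight.
have mF2 : measurable_fun setT F2 by apply: measurable_funM => //; exact: measurable_hs_weight.
have n0 xi : 0 <= ComplexField.Normc.normc (g xi) by apply: le_trans (hh xi).
have g0 xi : 0 <= gam xi by apply: le_trans (hpsi xi).
apply: (@le_trans _ _ (\int[mu]_xi `|(h xi * psi xi)%:E|)%E).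
  by apply: le_abse_integral => //; apply/measurable_EFinP; exact: measurable_funM.
apply: (@le_trans _ _ (Lnorm mu 1%:E (EFin \o (F1 \* F2)%R))).
  rewrite Lnorm1; apply: ge0_le_integral => //.
  - by apply/measurable_EFinP; apply: measurableT_comp => //; exact: measurable_funM.
  - by apply/measurable_EFinP; apply: measurableT_comp => //; exact: measurable_funM.
  - move=> xi _; rewrite /= lee_fin /F1 /F2.
    rewrite (_ : _ * _ * _ = (hs_weight s xi * hs_weight (- s) xi) *
       (ComplexField.Normc.normc (g xi) * gam xi)); last by ring.
    by rewrite hs_weightN mul1r [leRHS]ger0_norm ?mulr_ge0// normrM ler_pM.
have half : (2 : R)^-1 + 2^-1 = 1 by lra.
have H := @hoelder _ (measurableTypeR R) R mu F1 F2 2 2 mF1 mF2 (ltr0Sn _ _) (ltr0Sn _ _) half.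
apply: le_trans H _.
rewrite EFinM; apply: lee_pmul; [exact: Lnorm_ge0|exact: Lnorm_ge0| |].
- exact: hr.
- exact: Lnorm2_le.
Qed.

Variables (s sigma N x0 al K : R) (b : distr R) (f : R -> R).
Hypotheses (s0 : 0 < sigma) (nf : nice f) (K0 : 0 < K).
Hypothesis hb : forall phi, schwartz phi -> b phi = integ (fun x => f x * phi x).
Hypothesis hK : forall xi, (1 + xi ^+ 2) `^ (- s) * packet_env sigma N xi ^+ 2
  <= K * lor (sigma * (xi - N)).

(** Bounds the H^-s size of the envelope, since the integral of K [lor] (sigma (xi - N)) is K pi /
    sigma. *)
Let k := Num.sqrt (K * pi / sigma).
Let k0 : 0 < k. Proof. by rewrite sqrtr_gt0 divr_gt0// mulr_gt0// pi_gt0. Qed.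

(** Each Fourier density g of b is paired with the cosine and sine test functions, at a cost of k
    times its weighted norm each; hence the factor 2. As this holds for every g, it passes to the
    infimum that defines the norm. *)
Lemma hs_norm_packet_lower (eps : R) : (hs_norm s b <= eps%:E)%E ->
  `|gauss_mass R / sigma * integ (fun x => f x * packet sigma N x0 al x)| <= 2 * eps * k.
Proof.
set A := `| _ |; move=> hle; rewrite leNgt; apply/negP => hlt.
suff : ((A / (2 * k))%:E <= hs_norm s b)%E.
  move=> /le_trans /(_ hle); rewrite lee_fin ler_pdivrMr ?mulr_gt0//.
  by rewrite mulrCA mulrA leNgt hlt.
apply: le_ereal_inf_tmp.
move=> _ [g [mRe mIm hg] <-].
have := @le_refl _ _ (hs_weighted_norm s g).
have : (0 <= hs_weighted_norm s g)%E by exact: Lnorm_ge0.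
case E : (hs_weighted_norm s g) => [r| |] // r0 _; last by rewrite leey.
rewrite lee_fin in r0; rewrite lee_fin ler_pdivrMr ?mulr_gt0//.
have sc := schwartz_packet_cos N x0 al s0; have ss := schwartz_packet_sin N x0 al s0.
have se := schwartz_packet_env N s0.
have mS (h : R -> R) : schwartz h -> measurable_fun setT h.
  by move=> /schwartz_nice[? _]; exact: continuous_measurable_funT.
have [hRe _] := hg _ sc; have [_ hIm] := hg _ ss.
have sp := schwartz_packet N x0 al s0; have sr := schwartz_packet_refl N x0 al s0.
pose m := gauss_mass R / sigma.
have eRe : (fun x => complex.Re (fourier (packet_cos sigma N x0 al) x)) =
  (fun x => (m / 2) * packet sigma N x0 al x + (m / 2) * packet sigma N x0 al (- x)).
  by apply/funext => x; rewrite Re_fourier_packet// /m; field; rewrite gt_eqF.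
have eIm : (fun x => complex.Im (fourier (packet_sin sigma N x0 al) x)) =
  (fun x => (m / 2) * packet sigma N x0 al x + (- (m / 2)) * packet sigma N x0 al (- x)).
  by apply/funext => x; rewrite Im_fourier_packet// /m; field; rewrite gt_eqF.
rewrite eRe in hRe; rewrite eIm in hIm.
have s1 := schwartz_lin (m / 2) (m / 2) sp sr.
have s2 := schwartz_lin (m / 2) (- (m / 2)) sp sr.
rewrite hb// in hRe; rewrite hb// in hIm.
have AE : A = `|\int[mu]_xi (complex.Re (g xi) * packet_cos sigma N x0 al xi)
   + \int[mu]_xi (complex.Im (g xi) * packet_sin sigma N x0 al xi)|.
  rewrite hRe hIm -integD; [|exact: niceM nf (schwartz_nice s1)|exact: niceM nf (schwartz_nice s2)].
  rewrite /A -/m -integZ; last exact: niceM nf (schwartz_nice sp).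
  by congr `| _ |; apply: eq_integ => x; field.
have bound : (\int[mu]_x ((hs_weight (- s) x * packet_env sigma N x) ^+ 2)%:E <= (k ^+ 2)%:E)%E.
  rewrite sqr_sqrtr; last by rewrite ltW// divr_gt0// mulr_gt0// pi_gt0.
  have nl : nice (fun xi => K * lor (sigma * (xi - N))).
    have := niceZ K (nice_affine (- (sigma * N)) (lt0r_neq0 s0) (@nice_lor R)).
    by congr nice; apply/funext => xi; rewrite mulrBr.
  have -> : K * pi / sigma = integ (fun xi => K * lor (sigma * (xi - N))).
    rewrite integZ; last first.
      have := nice_affine (- (sigma * N)) (lt0r_neq0 s0) (@nice_lor R).
      by congr nice; apply/funext => xi; rewrite mulrBr.
    under eq_integ do rewrite mulrBr.
    by rewrite (integ_affine _ s0 (@nice_lor R)) integ_lor; field; rewrite gt_eqF.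
  apply: integral_le_integ => //.
    apply: measurable_funX; apply: measurable_funM; first exact: measurable_hs_weight.
    exact: mS.
  move=> xi; rewrite sqr_ge0 /= exprMn hs_weight_sqr; exact: hK.
have hE : (hs_weighted_norm s g <= r%:E)%E by rewrite E.
have env0 xi : 0 <= packet_env sigma N xi := expR_ge0 _.
have nb (z : R[i]) : `|complex.Re z| <= ComplexField.Normc.normc z /\
   `|complex.Im z| <= ComplexField.Normc.normc z.
  by case: z => x y /=; split; rewrite -sqrtr_sqr ler_wsqrtr// ?lerDl ?lerDr sqr_ge0.
have b1 : `|\int[mu]_xi (complex.Re (g xi) * packet_cos sigma N x0 al xi)| <= r * k.
  apply: (weighted_pairing mRe mIm mRe (mS _ sc) (mS _ se) _ _ (ltW k0) bound r0 hE).
    by move=> xi; have [] := nb (g xi).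
  move=> xi; rewrite /packet_cos normrM (ger0_norm (env0 xi)) ler_piMr//.
  by exact: norm_cos_le1.
have b2 : `|\int[mu]_xi (complex.Im (g xi) * packet_sin sigma N x0 al xi)| <= r * k.
  apply: (weighted_pairing mRe mIm mIm (mS _ ss) (mS _ se) _ _ (ltW k0) bound r0 hE).
    by move=> xi; have [] := nb (g xi).
  move=> xi; rewrite /packet_sin normrM (ger0_norm (env0 xi)) ler_piMr//.
  by exact: norm_sin_le1.
rewrite AE; apply: le_trans (ler_normD _ _) _.
by rewrite (_ : r * (2 * k) = r * k + r * k) ?lerD//; ring.
Qed.

End weighted_norms.

(** * The Sobolev norm of a Schwartz function *)

Section fourier_of_schwartz.
Variable R : realType.
Implicit Types (x y z xi s N L : R) (f phi : R -> R).
Local Notation mu := (@lebesgue_measure R).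

Lemma nice_mul_dilation f (g : R -> R) k : nice f -> continuous g -> (forall x, `|g x| <= 1) ->
  nice (fun x => f x * g (x * k)).
Proof.
move=> nf cg g1; apply: (niceMb nf) => // x.
apply: (@continuous_comp _ _ _ (fun x => x * k) g); last exact: cg.
by apply: (@hder_continuous _ _ (fun=> k)) => z; hder_tac; ring.
Qed.

(** With c = cos and c = sin this is the multiplication formula, by which the classical transform of
    f is also its distributional one. *)
Lemma kernel_fubini f phi (c : R -> R) : nice f -> nice phi -> continuous c ->
  (forall x, `|c x| <= 1) ->
  \int[mu]_xi ((\int[mu]_x (f x * c (x * xi))) * phi xi) =
  \int[mu]_x (f x * \int[mu]_xi (phi xi * c (xi * x))).
Proof.
move=> nf nphi cc c1.
have cx xi : nice (fun x => f x * c (x * xi)) by exact: nice_mul_dilation.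
have cxi x : nice (fun xi => phi xi * c (xi * x)) by exact: nice_mul_dilation.
pose T := measurableTypeR R.
pose F (p : T * T) : \bar R := (f p.1 * phi p.2 * c (p.1 * p.2))%:E.
have mf : measurable_fun setT f := continuous_measurable_funT nf.1.
have mphi : measurable_fun setT phi := continuous_measurable_funT nphi.1.
have mc : measurable_fun setT c := continuous_measurable_funT cc.
have mF : measurable_fun setT F.
  apply/measurable_EFinP; apply: measurable_funM; first apply: measurable_funM.
  - exact: (measurableT_comp mf (@measurable_fst _ _ T T)).
  - exact: (measurableT_comp mphi (@measurable_snd _ _ T T)).
  - apply: (measurableT_comp mc); apply: measurable_funM.
      exact: (@measurable_fst _ _ T T).
    exact: (@measurable_snd _ _ T T).
have intR (h : R -> R) : nice h -> (\int[mu]_x (h x)%:E = (integ h)%:E)%E.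
  by move=> nh; rewrite /integ /Rintegral fineK// integrable_fin_num//; exact: nice_integrable.
have iF : ((mu : {measure set T -> \bar R}) \x mu)%E.-integrable setT F.
  apply/integrable12ltyP => //.
  apply: (@le_lt_trans _ _ (\int[mu]_x ((integ (fun xi => `|phi xi|)) * `|f x|)%:E)%E); last first.
    by rewrite intR ?ltry//; exact/niceZ/nice_norm.
  apply: ge0_le_integral => //.
  - by move=> x _; exact: integral_ge0.
  - apply: (measurable_fun_fubini_tonelli_F (m2 := mu) (fun p => `|F p|%E)) => //.
    exact: measurableT_comp.
  - by apply/measurable_EFinP; apply: continuous_measurable_funT; exact: (niceZ _ (nice_norm nf)).1.
  - move=> x _; apply: (@le_trans _ _ (\int[mu]_xi (`|f x| * `|phi xi|)%:E)%E).
      apply: ge0_le_integral => //.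
      + apply/measurable_EFinP; apply: measurableT_comp => //.
        have := continuous_measurable_funT (niceZ (f x) (cxi x)).1.
        by congr (measurable_fun _ _); apply/funext => xi /=; rewrite [x * xi]mulrC mulrA.
      + by apply/measurable_EFinP; apply: continuous_measurable_funT; exact: (niceZ _ (nice_norm nphi)).1.
      + by move=> xi _; rewrite /= lee_fin !normrM ler_piMr ?mulr_ge0.
    rewrite intR; last exact/niceZ/nice_norm.
    by rewrite integZ; [rewrite lee_fin mulrC|exact: nice_norm].
have := Fubini iF.
have e1 : (\int[mu]_x \int[mu]_y F (x, y) = \int[mu]_x ((f x * integ (fun xi => phi xi * c (xi * x)))%:E))%E.
  apply: eq_integral => x _; rewrite -integZ// -intR; last exact: niceZ.
  by apply: eq_integral => xi _; rewrite /F /= [xi * x]mulrC mulrA.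
have e2 : (\int[mu]_y \int[mu]_x F (x, y) = \int[mu]_y ((integ (fun x => f x * c (x * y)) * phi y)%:E))%E.
  apply: eq_integral => xi _; rewrite mulrC -integZ// -intR; last exact: niceZ.
  by apply: eq_integral => x _; rewrite /F /=; congr EFin; ring.
rewrite e1 e2 => E.
by rewrite /Rintegral; congr fine.
Qed.

Lemma schwartz_nice_mulX f : schwartz f -> nice (fun x => x * f x).
Proof.
move=> sf; have [cf _] := schwartz_nice sf; split.
  by move=> x; apply: cvgM; [exact: cvg_id|exact: cf].
have [C1 h1] := schwartz_rapid 0 sf 1; have [C3 h3] := schwartz_rapid 0 sf 3.
exists (C1 + C3) => x; rewrite ler_pdivlMr ?oneD_gt0// mulrDr mulr1 lerD//.
  by have := h1 x; rewrite expr1.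
have -> : `|x * f x| * x ^+ 2 = `|x ^+ 3 * f x|.
  by rewrite -[x ^+ 2]ger0_norm ?sqr_ge0// -normrM; congr `| _ |; ring.
exact: h3.
Qed.

Lemma continuous_fourier_cos f : schwartz f -> continuous (fun xi => \int[mu]_x (f x * cos (x * xi))).
Proof.
move=> sf; have [C hC] := (schwartz_nice_mulX sf).2.
apply: (@hder_continuous _ _ (fun xi => integ (fun x => - (x * f x * sin (x * xi))))) => xi.
apply: (@hder_integ _ (fun xi x => f x * cos (x * xi)) (fun xi x => - (x * f x * sin (x * xi))) xi 1 C) => //.
- move=> t _; have := schwartz_nice (schwartz_cos t 0 sf); congr nice; apply/funext => x.
  by rewrite addr0 [t * x]mulrC.
- by move=> t x _; hder_tac; ring.
- move=> t x _; rewrite normrN normrM -[leRHS]mulr1 ler_pM//.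
  by exact: norm_sin_le1.
Qed.

Lemma continuous_fourier_sin f : schwartz f -> continuous (fun xi => \int[mu]_x (f x * sin (x * xi))).
Proof.
move=> sf; have [C hC] := (schwartz_nice_mulX sf).2.
apply: (@hder_continuous _ _ (fun xi => integ (fun x => x * f x * cos (x * xi)))) => xi.
apply: (@hder_integ _ (fun xi x => f x * sin (x * xi)) (fun xi x => x * f x * cos (x * xi)) xi 1 C) => //.
- move=> t _; have := schwartz_nice (schwartz_sin t 0 sf); congr nice; apply/funext => x.
  by rewrite addr0 [t * x]mulrC.
- by move=> t x _; hder_tac; ring.
- move=> t x _; rewrite normrM -[leRHS]mulr1 ler_pM//.
  by exact: norm_cos_le1.
Qed.

Lemma measurable_fourier_density s f : schwartz f -> measurable_fun setT (fun xi => (1 + xi ^+ 2) `^ s *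
   (complex.Re (fourier f xi) ^+ 2 + complex.Im (fourier f xi) ^+ 2)).
Proof.
move=> sf; apply: measurable_funM.
  have := measurable_funX 2 (@measurable_hs_weight R s).
  by congr (measurable_fun _ _); apply/funext => xi; rewrite -hs_weight_sqr.
apply: measurable_funD; apply: measurable_funX; apply: continuous_measurable_funT.
  exact: continuous_fourier_cos.
by move=> xi; apply: cvgN; exact: continuous_fourier_sin.
Qed.

(** The explicit transform is a competitor in the infimum. The factor c lets one computation serve
    both data and their difference, which are multiples of the same wave. *)
Lemma hs_norm_schwartz_le s (a : distr R) c f (K : R) : schwartz f -> 0 <= K ->
  (forall phi, nice (fun x => f x * phi x) -> a phi = c * integ (fun x => f x * phi x)) ->
  (\int[mu]_xi ((1 + xi ^+ 2) `^ s * (complex.Re (fourier f xi) ^+ 2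
      + complex.Im (fourier f xi) ^+ 2))%:E <= (K ^+ 2)%:E)%E ->
  (hs_norm s a <= (`|c| * K)%:E)%E.
Proof.
move=> sf K0 ha hK.
pose g xi : R[i] := Complex (c * complex.Re (fourier f xi)) (c * complex.Im (fourier f xi)).
have nf := schwartz_nice sf.
have cRe : continuous (fun xi => c * complex.Re (fourier f xi)).
  by move=> xi; apply: cvgM; [exact: cvg_cst|exact: continuous_fourier_cos].
have cIm : continuous (fun xi => c * complex.Im (fourier f xi)).
  by move=> xi; apply: cvgM; [exact: cvg_cst|apply: cvgN; exact: continuous_fourier_sin].
have bc (x : R) : `|cos x| <= 1 by exact: norm_cos_le1.
have bs (x : R) : `|sin x| <= 1 by exact: norm_sin_le1.
have cc : continuous (@cos R) by exact: continuous_cos.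
have cs : continuous (@sin R) by exact: continuous_sin.
have bound (f1 h : R -> R) : nice f1 -> continuous h -> (forall x, `|h x| <= 1) -> forall xi,
    `|\int[mu]_x (f1 x * h (x * xi))| <= integ (fun x => `|f1 x|).
  move=> nf1 ch h1 xi; apply: norm_integ_le.
  - exact: nice_mul_dilation.
  - exact: nice_norm.
  - by move=> x; rewrite normrM ler_piMr.
apply: (@le_trans _ _ (hs_weighted_norm s g)).
  apply: ereal_inf_lbound; exists g => //; split.
  - exact: continuous_measurable_funT.
  - exact: continuous_measurable_funT.
  move=> phi sphi; have nphi := schwartz_nice sphi.
  have nRe : nice (fun xi => phi xi * \int[mu]_x (f x * cos (x * xi))).
    by apply: niceMb (bound _ _ nf cc bc) => //; exact: continuous_fourier_cos.
  have nIm : nice (fun xi => phi xi * \int[mu]_x (f x * sin (x * xi))).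
    by apply: niceMb (bound _ _ nf cs bs) => //; exact: continuous_fourier_sin.
  have sF (h : R -> R) : \int[mu]_xi (h xi) = integ h by [].
  split.
    rewrite ha; last first.
      by apply: niceMb (bound _ _ nphi cc bc) => //; exact: continuous_fourier_cos.
    rewrite -[integ _]/(\int[mu]_x (f x * \int[mu]_xi (phi xi * cos (xi * x)))).
    rewrite -(kernel_fubini nf nphi cc bc) sF -integZ; last first.
      by move: nRe; congr nice; apply/funext => xi; rewrite mulrC.
    by apply: eq_integ => xi; rewrite /= mulrA.
  rewrite ha; last first.
    apply: (niceMb (C := integ (fun x => `|phi x|))) => //.
      by move=> xi; apply: cvgN; exact: continuous_fourier_sin.
    by move=> xi; rewrite normrN; exact: (bound _ _ nphi cs bs).
  rewrite (_ : integ _ = - \int[mu]_x (f x * \int[mu]_xi (phi xi * sin (xi * x)))); last first.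
    rewrite sF -mulN1r -integZ; first by apply: eq_integ => x /=; ring.
    by apply: niceMb (bound _ _ nphi cs bs) => //; exact: continuous_fourier_sin.
  rewrite -(kernel_fubini nf nphi cs bs) sF -mulN1r mulrA -integZ; last first.
    by move: nIm; congr nice; apply/funext => xi; rewrite mulrC.
  by apply: eq_integ => xi /=; ring.
apply: Lnorm2_le; first by rewrite mulr_ge0.
have -> : (\int[mu]_x (((1 + x ^+ 2) `^ (s / 2) * ComplexField.Normc.normc (g x)) ^+ 2)%:E =
  \int[mu]_x ((c ^+ 2)%:E * ((1 + x ^+ 2) `^ s *
   (complex.Re (fourier f x) ^+ 2 + complex.Im (fourier f x) ^+ 2))%:E))%E.
  apply: eq_integral => x _; rewrite -EFinM exprMn -[_ `^ (s / 2)]/(hs_weight s x) hs_weight_sqr.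
  by rewrite /g /= sqr_sqrtr ?addr_ge0 ?sqr_ge0//; congr EFin; ring.
rewrite ge0_integralZl_EFin ?sqr_ge0//.
- by rewrite exprMn real_normK ?num_real// (EFinM (c ^+ 2)); apply: lee_wpmul2l; rewrite ?lee_fin ?sqr_ge0.
- by move=> x _; rewrite lee_fin mulr_ge0 ?powR_ge0// addr_ge0 ?sqr_ge0.
- by apply/measurable_EFinP; exact: measurable_fourier_density.
Qed.

End fourier_of_schwartz.

Section distributions.
Variable R : realType.
Implicit Types (f phi : R -> R).
Local Notation mu := (@lebesgue_measure R).

Lemma tempered_distr_of f : nice f -> tempered (distr_of f).
Proof.
move=> nf; split.
  move=> c phi psi /schwartz_nice np /schwartz_nice nq.
  rewrite /distr_of -!/(integ _) -integZ; last exact: niceM.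
  rewrite -integD; [|exact/niceZ/niceM|exact: niceM].
  by apply: eq_integ => x; ring.
exists (integ (fun x => `|f x|)), 1%N => phi sphi.
rewrite !big_ord_recl !big_ord0 !adde0.
have := sphi.2 0%N 0%N; have := seminorm_ub 0 0 phi.
have : (0 <= schwartz_seminorm 0 0 phi)%E.
  by apply: le_trans (seminorm_ub 0 0 phi 0); rewrite lee_fin.
case: (schwartz_seminorm 0 0 phi) => [M| |]// _ hM _.
have {}hM x : `|phi x| <= M by have := hM x; rewrite expr0 mul1r lee_fin.
rewrite -EFinM lee_fin mulrC -integZ; last exact: nice_norm.
apply: norm_integ_le; first exact: niceM nf (schwartz_nice sphi).
  exact/niceZ/nice_norm.
by move=> x; rewrite normrM mulrC ler_wpM2r.
Qed.

End distributions.

(** * The Sobolev norm of the initial packets *)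

Section plateau_packet.
Variable R : realType.
Implicit Types (x y z xi s N L a b zeta : R).
Local Notation mu := (@lebesgue_measure R).
Variable D : R.
Hypothesis D1 : 1 <= D.

Let D0 : 0 < D. Proof. exact: lt_le_trans ltr01 D1. Qed.

Lemma expRN_le_lor (u : R) : expR (- `|u|) <= 3 * lor u.
Proof.
rewrite /lor ler_pdivlMr ?oneD_gt0// expRN mulrC ler_pdivrMr ?expR_gt0//.
have := @pow_le_expR R 2 `|u| (normr_ge0 u); have := expR_ge1Dx `|u|.
have := normr_ge0 u; rewrite real_normK ?num_real//.
by set e := expR _; rewrite !factS fact0 /= => ? ? ?; lra.
Qed.

Lemma logis_le_lor y : logis y * (1 - logis y) <= 3 * lor y.
Proof.
apply: le_trans (expRN_le_lor y).
have := logis_le_expR y; have := logis_ge y; have := logis_gt0 y; have := logis_lt1 y.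
have := expR_gt0 y; have := expR_gt0 (- y).
by case: (ger0P y) => y0; rewrite ?opprK => ? ? ? ? ? ?; nra.
Qed.

(** For |y| <= 2 D the quotient y^2/D^2 is at most 4; beyond, the exponential tail gives y^2 G(y) <=
    8, whence 9 = 1 + 8. *)
Lemma plat_le_lor y : plat D y <= 9 * lor (D^-1 * y).
Proof.
rewrite /lor ler_pdivlMr ?oneD_gt0// exprMn exprVn.
have p0 := plat_gt0 D y; have p1 := plat_le1 D y; have pe := plat_expR D y.
have D2 : 0 < D ^+ 2 by rewrite exprn_gt0.
have i1 : D ^- 2 <= 1 by rewrite invf_le1// expr_ge1// ltW.
have i0 : 0 < D ^- 2 by rewrite invr_gt0.
have [yD|yD] := lerP `|y| (2 * D).
  have : D ^- 2 * y ^+ 2 <= 4.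
    rewrite mulrC ler_pdivrMr// -real_normK ?num_real//.
    by have := normr_ge0 y; nra.
  have : 0 <= D ^- 2 * y ^+ 2 by rewrite mulr_ge0 ?sqr_ge0// ltW.
  by move=> ? ?; nra.
have e1 : expR (D - `|y|) <= expR (- (`|y| / 2)) by rewrite ler_expR; lra.
have h0 : 0 <= `|y| / 2 by rewrite divr_ge0.
have e2 := pow_le_expR 2 h0.
have e3 : expR (- (`|y| / 2)) * expR (`|y| / 2) = 1 by rewrite -expRD addNr expR0.
have e4 : plat D y * y ^+ 2 <= 8.
  have : y ^+ 2 <= 8 * expR (`|y| / 2).
    by move: e2; rewrite expr_div_n real_normK ?num_real// !factS fact0 /=; lra.
  have := sqr_ge0 y; have := expR_gt0 (- (`|y| / 2)).
  set E := expR (- _) in e1 e3 *; set F := expR (_ / 2) in e3 *; move=> ? ? ?; nra.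
by have := sqr_ge0 y => ?; nra.
Qed.

Lemma nice_mul_cos f zeta b : nice f -> nice (fun y => f y * cos (zeta * y + b)).
Proof.
move=> nf; apply: (niceMb (C := 1) nf) => [|y]; last by exact: norm_cos_le1.
by apply: (@hder_continuous _ _ (fun y => - (zeta * sin (zeta * y + b)))) => y; hder_tac; ring.
Qed.

Lemma nice_mul_sin f zeta b : nice f -> nice (fun y => f y * sin (zeta * y + b)).
Proof.
move=> nf; apply: (niceMb (C := 1) nf) => [|y]; last by exact: norm_sin_le1.
by apply: (@hder_continuous _ _ (fun y => zeta * cos (zeta * y + b))) => y; hder_tac; ring.
Qed.

Lemma integ_by_parts_cos f f' zeta b : (forall x, hder f x (f' x)) -> nice f -> nice f' ->
  zeta * integ (fun y => f y * cos (zeta * y + b)) = - integ (fun y => f' y * sin (zeta * y + b)).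
Proof.
move=> hf nf nf'; apply/eqP; rewrite -addr_eq0 -integZ; last exact: nice_mul_cos.
rewrite -integD; [|exact/niceZ/nice_mul_cos|exact: nice_mul_sin].
apply/eqP; apply: (@integ_der _ (fun y => f y * sin (zeta * y + b))) => [x| |].
- by eapply hder_eq; [hder_step; exact: hf|cbv beta; ring].
- exact: nice_mul_sin.
- by apply: niceD; [exact/niceZ/nice_mul_cos|exact: nice_mul_sin].
Qed.

Lemma integ_by_parts_sin f f' zeta b : (forall x, hder f x (f' x)) -> nice f -> nice f' ->
  zeta * integ (fun y => f y * sin (zeta * y + b)) = integ (fun y => f' y * cos (zeta * y + b)).
Proof.
move=> hf nf nf'; apply/eqP; rewrite -subr_eq0 -integZ; last exact: nice_mul_sin.
rewrite -integB; [|exact/niceZ/nice_mul_sin|exact: nice_mul_cos].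
rewrite -oppr_eq0 -mulN1r -integZ; last first.
  by apply: niceB; [exact/niceZ/nice_mul_sin|exact: nice_mul_cos].
apply/eqP; apply: (@integ_der _ (fun y => f y * cos (zeta * y + b))) => [x| |].
- by eapply hder_eq; [hder_step; exact: hf|cbv beta; ring].
- exact: nice_mul_cos.
- by apply/niceZ/niceB; [exact/niceZ/nice_mul_sin|exact: nice_mul_cos].
Qed.

(** Dominates the slope of the plateau, which is concentrated near -D and D; its mass does not
    depend on D. *)
Definition edge y : R := lor (1 * y + D) + lor (1 * y + - D).

Lemma nice_edge : nice edge.
Proof. by apply: niceD; apply: nice_affine (@nice_lor R) => //; exact: oner_neq0. Qed.

Lemma integ_edge : integ edge = 2 * pi.
Proof.
have n c := nice_affine c (oner_neq0 R) (@nice_lor R).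
rewrite /edge integD; [|exact: n|exact: n].
by rewrite !(integ_affine _ ltr01 (@nice_lor R)) integ_lor invr1; ring.
Qed.

Lemma plat_slope_le y :
  plat_p D y * (1 - plat_p D y) + plat_q D y * (1 - plat_q D y) <= 3 * edge y.
Proof.
have h1 := logis_le_lor (D + y); have h2 := logis_le_lor (D - y).
rewrite /plat_p /plat_q /edge (mulrDr 3) !mul1r; apply: lerD; first by rewrite [y + D]addrC.
by rewrite (_ : lor (y - D) = lor (D - y))// /lor; congr (_^-1); ring.
Qed.

Lemma plat_d1_le y : `|plat D y * plat_d D y| <= 3 * edge y.
Proof.
apply: le_trans (plat_slope_le y).
have := logis_gt0 (D + y); have := logis_lt1 (D + y).
have := logis_gt0 (D - y); have := logis_lt1 (D - y).
rewrite ler_norml /plat /plat_d /plat_p /plat_q.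
set p := logis (D + y); set q := logis _ => ? ? ? ?.
have : 0 <= p * (1 - p) by rewrite mulr_ge0//; lra.
have : 0 <= q * (1 - q) by rewrite mulr_ge0//; lra.
by move=> ? ?; apply/andP; split; nra.
Qed.

Lemma plat_d2_le y : `|plat D y * plat_d D y * plat_d D y + plat D y * plat_e1 D y| <= 6 * edge y.
Proof.
rewrite (_ : 6 * _ = 3 * edge y + 3 * edge y); last by ring.
apply: le_trans (ler_normD _ _) _; apply: lerD.
  rewrite normrM; apply: le_trans (plat_d1_le y).
  by rewrite ler_piMr// plat_d_le1.
rewrite normrM (ger0_norm (ltW (plat_gt0 D y))); apply: le_trans (plat_slope_le y).
have := plat_gt0 D y; have := plat_le1 D y.
have := logis_gt0 (D + y); have := logis_lt1 (D + y).
have := logis_gt0 (D - y); have := logis_lt1 (D - y).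
rewrite /plat_e1 -[X in `|X - _|]/(- plat_q D y * (1 - plat_q D y)) mulNr -opprD normrN.
rewrite -/(plat_p D y) -/(plat_q D y).
move: (plat D y) (plat_p D y) (plat_q D y) => G p q ? ? ? ? ? ?.
have h1 : 0 <= p * (1 - p) by rewrite mulr_ge0//; lra.
have h2 : 0 <= q * (1 - q) by rewrite mulr_ge0//; lra.
rewrite ger0_norm ?addr_ge0// [leRHS]addrC ler_piMl ?addr_ge0//; lra.
Qed.

(** The phase b allows the real part (b = 0) and the imaginary part (b = -pi/2, up to sign) of the
    transform to be treated at once. *)
Definition plat_hat zeta b := integ (fun y => plat D y * cos (zeta * y + b)).

Let nP : nice (plat D). Proof. exact: schwartz_nice (schwartz_plat D). Qed.

Let nP1 : nice (fun y => plat D y * plat_d D y).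
Proof.
apply: (niceMb nP _ (@plat_d_le1 R D)).
exact: hder_continuous (hder_plat_d D).
Qed.

Let nP2 : nice (fun y => plat D y * plat_d D y * plat_d D y + plat D y * plat_e1 D y).
Proof.
apply: niceD; first by apply: (niceMb nP1 _ (@plat_d_le1 R D)); exact: hder_continuous (hder_plat_d D).
by apply: (niceMb nP _ (@plat_e1_le R D)); exact: hder_continuous (hder_plat_e1 D).
Qed.

Lemma norm_mul_le1 (u v w : R) : `|u| <= w -> `|v| <= 1 -> `|u * v| <= w.
Proof. by move=> uw v1; rewrite normrM; apply: le_trans uw; rewrite ler_piMr. Qed.

Lemma plat_hat_le zeta b : `|plat_hat zeta b| <= 9 * pi * D.
Proof.
have Dn0 : D^-1 != 0 by rewrite invr_eq0 gt_eqF.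
have n9 : nice (fun y => 9 * lor (D^-1 * y + 0)) by exact/niceZ/nice_affine/nice_lor.
rewrite (_ : 9 * pi * D = integ (fun y => 9 * lor (D^-1 * y + 0))); last first.
  rewrite integZ; last exact/nice_affine/nice_lor.
  by rewrite integ_affine ?invr_gt0// ?integ_lor ?invrK; [ring|exact: nice_lor].
apply: norm_integ_le => //; first exact: nice_mul_cos.
move=> y; apply: norm_mul_le1; last by exact: norm_cos_le1.
by rewrite addr0 ger0_norm ?plat_le_lor// ltW// plat_gt0.
Qed.

(** Integration by parts moves the derivative onto the two edges, so the bound is uniform in D, in
    contrast to the trivial one. *)
Lemma plat_hat1_le zeta b : `|zeta * plat_hat zeta b| <= 6 * pi.
Proof.
rewrite /plat_hat (integ_by_parts_cos _ _ (hder_plat D) nP nP1) normrN.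
rewrite (_ : 6 * pi = integ (fun y => 3 * edge y)); last by rewrite integZ ?integ_edge; [ring|exact: nice_edge].
apply: norm_integ_le; [exact: nice_mul_sin|exact/niceZ/nice_edge|move=> y].
by apply: norm_mul_le1; [exact: plat_d1_le|exact: norm_sin_le1].
Qed.

Lemma plat_hat2_le zeta b : `|zeta * (zeta * plat_hat zeta b)| <= 12 * pi.
Proof.
rewrite /plat_hat (integ_by_parts_cos _ _ (hder_plat D) nP nP1) mulrN normrN.
have h y : hder (fun y => plat D y * plat_d D y) y
    (plat D y * plat_d D y * plat_d D y + plat D y * plat_e1 D y).
  eapply hder_eq; first by (hder_step; [exact: hder_plat|exact: hder_plat_d]).
  by cbv beta; ring.
rewrite (integ_by_parts_sin _ _ h nP1 nP2).
rewrite (_ : 12 * pi = integ (fun y => 6 * edge y)); last by rewrite integZ ?integ_edge; [ring|exact: nice_edge].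
apply: norm_integ_le; [exact: nice_mul_cos|exact/niceZ/nice_edge|move=> y].
by apply: norm_mul_le1; [exact: plat_d2_le|exact: norm_cos_le1].
Qed.

(** The first summand covers the central peak of height D^2 and width 1/D, the second the
    contribution of the edges; the integral is therefore of order D and not D^2. The constant 180 =
    6^2 + 12^2 comes from one and two integrations by parts. *)
Definition plat_majorant zeta : R := 180 * pi ^+ 2 * (D ^+ 2 * lor (D * zeta + 0) + lor zeta).

Lemma nice_plat_majorant : nice plat_majorant.
Proof.
apply/niceZ/niceD; last exact: nice_lor.
by apply/niceZ/nice_affine; [rewrite gt_eqF|exact: nice_lor].
Qed.

Lemma integ_plat_majorant : integ plat_majorant = 180 * pi ^+ 3 * (D + 1).
Proof.
have n1 : nice (fun zeta => lor (D * zeta + 0)) by apply: nice_affine (@nice_lor R); rewrite gt_eqF.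
rewrite /plat_majorant integZ; last by apply: niceD; [exact: niceZ|exact: nice_lor].
rewrite integD; [|exact: niceZ|exact: nice_lor].
rewrite integZ// (integ_affine _ D0 (@nice_lor R)) integ_lor.
by field; rewrite gt_eqF.
Qed.

Lemma plat_hat_sqr_le zeta b : (1 + zeta ^+ 2) * plat_hat zeta b ^+ 2 <= plat_majorant zeta.
Proof.
have h0 := plat_hat_le zeta b; have h1 := plat_hat1_le zeta b; have h2 := plat_hat2_le zeta b.
have sq (u w : R) : `|u| <= w -> u ^+ 2 <= w ^+ 2.
  by move=> uw; rewrite -real_normK ?num_real// lerXn2r// nnegrE (le_trans _ uw).
move: (sq _ _ h0) (sq _ _ h1) (sq _ _ h2); set H := plat_hat zeta b => {h0 h1 h2} h0 h1 h2.
rewrite /plat_majorant mulrDr mulrDl mul1r; apply: lerD.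
  rewrite addr0 /lor mulrA ler_pdivlMr ?oneD_gt0//.
  have := sqr_ge0 (zeta * H); have := sqr_ge0 (pi : R); have := sqr_ge0 D => ? ? ?.
  have : D ^+ 2 * (zeta * H) ^+ 2 <= D ^+ 2 * (6 * pi) ^+ 2 by rewrite ler_wpM2l.
  by move: h0; rewrite !exprMn => ? ?; nra.
rewrite /lor ler_pdivlMr ?oneD_gt0//.
by move: h1 h2; rewrite !exprMn => ? ?; have := sqr_ge0 (pi : R) => ?; nra.
Qed.

Definition wave a L N x : R := a * plat D (x / L) * cos (N * x).

Lemma schwartz_wave a L N : 0 < L -> schwartz (wave a L N).
Proof.
move=> L0; have Ln0 : L^-1 != 0 by rewrite invr_eq0 gt_eqF.
have := schwartz_cos N 0 (schwartzZ a (schwartz_affine 0 Ln0 (schwartz_plat D))).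
by congr schwartz; apply/funext => x; rewrite /wave !addr0 [L^-1 * x]mulrC.
Qed.

Lemma integ_wave_cos a L N xi b : 0 < L ->
  integ (fun x => wave a L N x * cos (xi * x + b)) =
  (a * L / 2) * (plat_hat (L * (xi - N)) b + plat_hat (L * (xi + N)) b).
Proof.
move=> L0; have Li0 : 0 < L^-1 by rewrite invr_gt0.
pose F z y := plat D y * cos (L * z * y + b).
have nF z : nice (F z) by exact: nice_mul_cos.
have E z : plat_hat (L * z) b = L^-1 * integ (fun x => F z (L^-1 * x + 0)).
  by rewrite (integ_affine _ Li0 (nF z)) invrK mulKf// gt_eqF.
have nA z := nice_affine 0 (lt0r_neq0 Li0) (nF z).
rewrite !E -mulrDr mulrA (_ : a * L / 2 * L^-1 = a / 2); last by field; rewrite gt_eqF.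
rewrite -integD// -integZ; last exact: niceD.
apply: eq_integ => x; rewrite /F /wave addr0 [L^-1 * x]mulrC.
have e z : L * z * (x / L) + b = z * x + b by field; rewrite gt_eqF.
rewrite !e.
have := cosD (xi * x + b) (N * x); have := cosD (xi * x + b) (- (N * x)).
rewrite cosN sinN (_ : xi * x + b + - (N * x) = (xi - N) * x + b); last by ring.
rewrite (_ : xi * x + b + N * x = (xi + N) * x + b); last by ring.
by move=> -> ->; field.
Qed.

(** The quadratic factor lost in [sobolev_weight_le] is the one provided by [plat_hat_sqr_le], at
    each of the two peaks N and -N. *)
Lemma integ_wave_cos_sqr_le a L N xi b s : 0 < L -> - (1 / 4) < s < 1 / 4 -> 1 <= N ->
  1 <= L ^+ 2 * N -> 1 <= N * L ->
  (1 + xi ^+ 2) `^ s * integ (fun x => wave a L N x * cos (xi * x + b)) ^+ 2 <=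
  8 * (N `^ (2 * s) * (a * L) ^+ 2) *
    (plat_majorant (L * xi + - (L * N)) + plat_majorant (L * xi + L * N)).
Proof.
move=> L0 hs N1 LN1 NL1; rewrite integ_wave_cos//.
have w1 := sobolev_weight_le xi hs N1 L0 LN1 NL1.
have := sobolev_weight_le (- xi) hs N1 L0 LN1 NL1.
rewrite sqrrN (_ : L * (- xi - N) = - (L * (xi + N))) ?sqrrN; last by ring.
move=> w2; rewrite -mulrN -(mulrDr L xi (- N)) -(mulrDr L xi N).
have h1 := plat_hat_sqr_le (L * (xi - N)) b; have h2 := plat_hat_sqr_le (L * (xi + N)) b.
move: w1 w2 h1 h2; set w := (1 + xi ^+ 2) `^ s.
have w0 : 0 <= w by exact: powR_ge0.
move: (powR_ge0 N (2 * s)); move: (N `^ _) => M M0.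
move: (L * (xi - N)) (L * (xi + N)) => z1 z2 w1 w2 h1 h2.
set H1 := plat_hat z1 b in h1 *; set H2 := plat_hat z2 b in h2 *.
have k1 : w * H1 ^+ 2 <= 16 * M * plat_majorant z1.
  apply: (le_trans (ler_wpM2r (sqr_ge0 H1) w1)); rewrite -[leLHS]mulrA ler_wpM2l ?mulr_ge0//.
have k2 : w * H2 ^+ 2 <= 16 * M * plat_majorant z2.
  apply: (le_trans (ler_wpM2r (sqr_ge0 H2) w2)); rewrite -[leLHS]mulrA ler_wpM2l ?mulr_ge0//.
have : w * (H1 + H2) ^+ 2 <= 2 * (16 * M * plat_majorant z1 + 16 * M * plat_majorant z2).
  apply: (@le_trans _ _ (2 * (w * H1 ^+ 2 + w * H2 ^+ 2))); last by rewrite ler_pM2l// lerD.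
  by have := mulr_ge0 w0 (sqr_ge0 (H1 - H2)) => ?; nra.
move=> /(ler_wpM2l (sqr_ge0 (a * L))) k3.
rewrite (_ : w * _ = 4^-1 * ((a * L) ^+ 2 * (w * (H1 + H2) ^+ 2))); last by field.
rewrite (_ : 8 * _ * _ = 4^-1 * ((a * L) ^+ 2 *
  (2 * (16 * M * plat_majorant z1 + 16 * M * plat_majorant z2)))); last by field.
by rewrite ler_pM2l ?invr_gt0.
Qed.

(** Shows that the squared H^s norm is of order N^(2 s) a^2 L D, which explains why this product is
    later normalised to 1. *)
Lemma integral_wave_le a L N s : 0 < L -> - (1 / 4) < s < 1 / 4 -> 1 <= N ->
  1 <= L ^+ 2 * N -> 1 <= N * L ->
  (\int[mu]_xi ((1 + xi ^+ 2) `^ s * (complex.Re (fourier (wave a L N) xi) ^+ 2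
      + complex.Im (fourier (wave a L N) xi) ^+ 2))%:E
    <= ((96 * 120) * pi ^+ 3 * (N `^ (2 * s) * a ^+ 2 * L * D))%:E)%E.
Proof.
move=> L0 hs N1 LN1 NL1.
have nM c : nice (fun xi => plat_majorant (L * xi + c)).
  by apply: nice_affine nice_plat_majorant; rewrite gt_eqF.
have nh : nice (fun xi => 16 * (N `^ (2 * s) * (a * L) ^+ 2) *
    (plat_majorant (L * xi + - (L * N)) + plat_majorant (L * xi + L * N))).
  by apply/niceZ/niceD.
apply: (le_trans (integral_le_integ _ nh _)).
- exact: measurable_fourier_density (schwartz_wave _ _ L0).
- move=> xi; apply/andP; split; first by rewrite mulr_ge0 ?powR_ge0// addr_ge0 ?sqr_ge0.
  have e1 : complex.Re (fourier (wave a L N) xi) = integ (fun x => wave a L N x * cos (xi * x + 0)).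
    by apply: eq_integ => x; rewrite addr0 mulrC [xi * x]mulrC mulrC.
  have e2 : complex.Im (fourier (wave a L N) xi) = - integ (fun x => wave a L N x * cos (xi * x + - (pi / 2))).
    congr (- _); apply: eq_integ => x; congr (_ * _).
    by rewrite cosD cosN sinN cos_pihalf sin_pihalf [xi * x]mulrC; ring.
  rewrite e1 e2 sqrrN mulrDr.
  have i1 := integ_wave_cos_sqr_le a xi 0 L0 hs N1 LN1 NL1.
  have i2 := integ_wave_cos_sqr_le a xi (- (pi / 2)) L0 hs N1 LN1 NL1.
  by apply: le_trans (lerD i1 i2) _; rewrite le_eqVlt; apply/orP; left; apply/eqP; ring.
rewrite lee_fin integZ; last exact: niceD.
rewrite integD// !(integ_affine _ L0 nice_plat_majorant) integ_plat_majorant.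
(* 5760 = 16 * 2 * 180 for the two peaks; then D + 1 <= 2 D doubles it to 96 * 120. *)
rewrite (_ : _ * _ = 5760 * pi ^+ 3 * (N `^ (2 * s) * a ^+ 2 * L) * (D + 1)); last first.
  by field; rewrite gt_eqF.
have p0 : 0 <= pi ^+ 3 :> R by rewrite exprn_ge0// pi_ge0.
have : 0 <= pi ^+ 3 * (N `^ (2 * s) * a ^+ 2 * L).
  by rewrite mulr_ge0// mulr_ge0 ?(ltW L0)// mulr_ge0 ?powR_ge0// sqr_ge0.
rewrite (_ : 5760 * pi ^+ 3 * _ = 5760 * (pi ^+ 3 * (N `^ (2 * s) * a ^+ 2 * L))); last by ring.
rewrite (_ : (96 * 120) * pi ^+ 3 * _ = (96 * 120) * (pi ^+ 3 * (N `^ (2 * s) * a ^+ 2 * L)) * D); last by ring.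
move=> X0; have D1' : 0 <= D - 1 by rewrite subr_ge0.
by have := mulr_ge0 X0 D1' => ?; nra.
Qed.

End plateau_packet.

(** * Decoherence of two packets *)

Section decoherence.
Variable R : realType.
Implicit Types (a L t x y del Phi D : R).

Lemma cos_lipschitz x y : `|cos x - cos y| <= `|x - y|.
Proof.
wlog xy : x y / y <= x.
  by move=> h; case: (leP y x) => [/h//|/ltW /h]; rewrite distrC [X in _ <= X]distrC.
rewrite [leRHS]ger0_norm ?subr_ge0// -[leRHS]mul1r.
apply: (@hder_bound _ (@cos R) (fun x => - sin x)) => // z _.
  by have := hder_cos (hder_id z); rewrite mulr1.
by rewrite normrN norm_sin_le1.
Qed.

Lemma pi_le4 : pi <= 4 :> R.
Proof. by have := @pihalf_lt2 R; lra. Qed.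

(** Since Phi (1 + del)^2 = Phi + pi, at G = 1 the two cosines are c and -c and S equals (2 + del)
    c^2. The first bound controls the deviation by the Lipschitz property of the cosine, at the
    price of Phi (1 - G); the second is crude and holds for every G. *)
Lemma opposite_phases Phi del b (G : R) : 0 <= del <= 1 / 100 -> 0 <= Phi ->
  Phi * (2 * del + del ^+ 2) = pi -> 0 <= G <= 1 ->
  let c := cos (b + Phi) in
  let S := (G * cos (b + Phi * G ^+ 2) - (1 + del) * G * cos (b + Phi * (1 + del) ^+ 2 * G ^+ 2)) * c in
  2 * c ^+ 2 - (5 * Phi + 12) * (1 - G) <= S /\ 2 * c ^+ 2 - 17 / 4 <= S.
Proof.
move=> hdel Phi0 hPhi hG c S.
have pi4 := pi_le4; have pi0 := pi_ge0 R.
have c1 : `|c| <= 1 by exact: norm_cos_le1.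
rewrite /S; set cu := cos (b + Phi * G ^+ 2); set cv := cos (b + _ * _ * _).
have cu1 : `|cu| <= 1 by exact: norm_cos_le1.
have cv1 : `|cv| <= 1 by exact: norm_cos_le1.
have G2 : 0 <= 1 - G ^+ 2 <= 2 * (1 - G) by nra.
have hu : `|cu - c| <= 2 * Phi * (1 - G).
  apply: le_trans (cos_lipschitz _ _) _; rewrite ler_norml; nra.
have hv : `|cv + c| <= 2 * (Phi + pi) * (1 - G).
  rewrite -[c]opprK -cosDpi; apply: le_trans (cos_lipschitz _ _) _.
  have -> : Phi * (1 + del) ^+ 2 = Phi + pi by rewrite -hPhi; ring.
  by rewrite ler_norml; nra.
move: c1 cu1 cv1 hu hv; rewrite !ler_norml.
move: c cu cv {S} => c cu cv c1 cu1 cv1 hu hv.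
split.
  have e : (G * cu - (1 + del) * G * cv) * c =
     G * (2 + del) * c ^+ 2 + G * ((cu - c) * c) - (1 + del) * G * ((cv + c) * c) by ring.
  rewrite e.
  have c2 : 0 <= c ^+ 2 <= 1 by nra.
  have k1 : - (2 * Phi * (1 - G)) <= (cu - c) * c by nra.
  have k2 : (cv + c) * c <= 2 * (Phi + pi) * (1 - G) by nra.
  have m1 : 0 <= 2 * Phi * (1 - G) by rewrite !mulr_ge0//; lra.
  have m2 : 0 <= 2 * (Phi + pi) * (1 - G) by rewrite !mulr_ge0//; lra.
  have k1' : - (2 * Phi * (1 - G)) <= G * ((cu - c) * c) by nra.
  have g1 : 0 <= (1 + del) * G <= 101 / 100 by nra.
  have k2' : (1 + del) * G * ((cv + c) * c) <= 101 / 100 * (2 * (Phi + pi) * (1 - G)) by nra.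
  have k3 : 2 * c ^+ 2 - 2 * (1 - G) <= G * (2 + del) * c ^+ 2.
    have : 0 <= G * del * c ^+ 2 by apply: mulr_ge0; [apply: mulr_ge0; lra|lra].
    by nra.
  have k4 : pi * (1 - G) <= 4 * (1 - G) by rewrite ler_wpM2r//; lra.
  have : 0 <= Phi * (1 - G) by rewrite mulr_ge0//; lra.
  by nra.
have h1 : -1 <= G * cu * c <= 1.
  rewrite -ler_norml !normrM -[leRHS]mulr1 ler_pM//; last by rewrite ler_norml; lra.
  rewrite -[leRHS]mulr1 ler_pM// ler_norml; lra.
have h2 : -1 <= G * cv * c <= 1.
  rewrite -ler_norml !normrM -[leRHS]mulr1 ler_pM//; last by rewrite ler_norml; lra.
  rewrite -[leRHS]mulr1 ler_pM// ler_norml; lra.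
have c2 : 0 <= c ^+ 2 <= 1 by nra.
have -> : (G * cu - (1 + del) * G * cv) * c = G * cu * c - (1 + del) * (G * cv * c) by ring.
by nra.
Qed.

Let U D a L t x := wkbU (plat D) (plat_d D) (plat_e1 D) (plat_e2 D) a L 0 t x.

(** The first bound of [opposite_phases] is used for |y| <= D/2, the second elsewhere, where 17
    (y/D)^2 >= 17/4. The quadratic penalty replaces a cut-off, so that the result can be integrated
    against a Gaussian in closed form. Of the constant 11/100, the part 1/10 comes from the plateau
    and 1/100 covers the third harmonics. *)
Lemma wkb_gap D del Phi a L t x : 0 < D -> 0 <= del <= 1 / 100 -> 0 <= Phi ->
  Phi * (2 * del + del ^+ 2) = pi -> (5 * Phi + 12) * (2 * expR (- (D / 2))) <= 1 / 10 ->
  0 < a -> 10 * a <= 1 -> 3 / 2 * (a ^+ 2 * t) = Phi ->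
  a * (2 * cos (x + t + Phi) ^+ 2 - 11 / 100 - 17 * (L^-1 * (x + 3 * t) / D) ^+ 2) <=
  (U D a L t x - U D ((1 + del) * a) L t x) * cos (x + t + Phi).
Proof.
move=> D0 hdel Phi0 hPhi hD a0 a1 ht.
rewrite /U /= /wkbU /osc0 /wkb_S0 /wkb_3th /wkb_P0 /wkb_th -/(wkb_y L t x).
set y := wkb_y L t x; set G := plat D y.
have G0 : 0 < G := plat_gt0 D y; have G1 : G <= 1 := plat_le1 D y.
have hG : 0 <= G <= 1 by rewrite ltW.
have ev : 3 / 2 * (((1 + del) * a) ^+ 2 * t) = Phi * (1 + del) ^+ 2 by rewrite -ht; ring.
rewrite ev ht.
have [h1 h2] := opposite_phases (x + t) hdel Phi0 hPhi hG.
have c1 := norm_cos_le1 (x + t + Phi).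
set c := cos (x + t + Phi) in h1 h2 c1 *.
set cu := cos (x + t + Phi * G ^+ 2) in h1 h2 *.
set cv := cos (x + t + _ * _ * _) in h1 h2 *.
have u3 := norm_cos_le1 (3 * (x + t + Phi * G ^+ 2)).
have v3 := norm_cos_le1 (3 * (x + t + Phi * (1 + del) ^+ 2 * G ^+ 2)).
set cu3 := cos (3 * (x + t + Phi * G ^+ 2)) in u3 *.
set cv3 := cos _ in v3 *.
set S := (_ - _) * c in h1 h2.
have S1 : 2 * c ^+ 2 - 1 / 10 - 17 * (y / D) ^+ 2 <= S.
  have y0 : 0 <= (y / D) ^+ 2 by exact: sqr_ge0.
  have [yD|yD] := lerP `|y| (D / 2).
    apply: le_trans h1.
    have : 1 - G <= 2 * expR (- (D / 2)).
      apply: le_trans (plat_ge D y) _; rewrite ler_pM2l// ler_expR; lra.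
    have : 0 <= 5 * Phi + 12 by lra.
    by move=> p q; have := ler_wpM2l p q => ?; lra.
  apply: le_trans h2; have : 1 / 4 <= (y / D) ^+ 2; last by lra.
  have : 1 / 2 <= `|y / D|.
    rewrite normrM normfV (gtr0_norm D0) ler_pdivlMr//; lra.
  by rewrite -[(y / D) ^+ 2]real_normK ?num_real// => ?; nra.
have G3 : 0 <= G ^+ 3 <= 1 by rewrite exprn_ge0 ?(ltW G0)//= exprn_ile1// ltW.
have a3 : 0 <= a ^+ 3 <= a / 100.
  rewrite exprn_ge0 ?(ltW a0)//= exprSr expr2; nra.
have d3 : 0 <= (1 + del) ^+ 3 <= 2.
  have : 1 <= 1 + del <= 101 / 100 by lra.
  move: (1 + del) => e he; have e2 : 0 <= e ^+ 2 <= 3 / 2 by nra.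
  by rewrite exprS; nra.
have tri (p q r : R) : 0 <= p <= 1 -> `|q| <= 1 -> `|r| <= 1 -> `|p * q * r| <= 1.
  move=> p1 q1 r1; rewrite !normrM -[leRHS]mulr1 ler_pM// -[leRHS]mulr1 ler_pM//.
  by rewrite ger0_norm; lra.
have := tri _ _ _ G3 u3 c1; have := tri _ _ _ G3 v3 c1; rewrite !ler_norml => w2 w1.
have -> : (a * G * cu - 16^-1 * ((a * G) ^+ 3 * cu3)
   - ((1 + del) * a * G * cv - 16^-1 * (((1 + del) * a * G) ^+ 3 * cv3))) * c =
   a * S - 16^-1 * a ^+ 3 * (G ^+ 3 * cu3 * c) + 16^-1 * a ^+ 3 * ((1 + del) ^+ 3 * (G ^+ 3 * cv3 * c)).
  by rewrite /S; ring.
move: w1 w2; move: (G ^+ 3 * cu3 * c) (G ^+ 3 * cv3 * c) => p q w1 w2.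
have aS := ler_wpM2l (ltW a0) S1.
have k1 : a ^+ 3 * p <= a / 100 by nra.
have k2 : -2 <= (1 + del) ^+ 3 * q by nra.
have k3 : - (a / 50) <= a ^+ 3 * ((1 + del) ^+ 3 * q) by nra.
by nra.
Qed.

Let cg : R := gauss_mass R.

(** The test packet at frequency one, centred at -3 t by the group velocity; the coefficient 1 and
    the affine argument fit the lemmas on Gaussians. *)
Definition packet_at t m b x : R := gauss (m^-1 * x + 3 * t / m) * cos (1 * x + b).

Lemma nice_gauss_at t m : 0 < m -> nice (fun x => @gauss R (m^-1 * x + 3 * t / m)).
Proof.
move=> m0; apply: nice_affine; first by rewrite invr_eq0 gt_eqF.
exact: schwartz_nice (@schwartz_gauss R).
Qed.

Lemma nice_packet_at t m b : 0 < m -> nice (packet_at t m b).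
Proof. by move=> m0; exact/nice_mul_cos/nice_gauss_at. Qed.

Lemma gauss_le1 x : gauss x <= 1.
Proof. by rewrite /gauss -expR0 ler_expR oppr_le0 divr_ge0 ?sqr_ge0. Qed.

Lemma integ_packet_sqr_le t m b : 0 < m -> integ (fun x => packet_at t m b x ^+ 2) <= m * cg.
Proof.
move=> m0; have -> : m * cg = integ (fun x => gauss (m^-1 * x + 3 * t / m)).
  by rewrite integ_affine ?invr_gt0 ?invrK//; exact: schwartz_nice (@schwartz_gauss R).
apply: le_integ; [exact: (niceX 1 (nice_packet_at _ _ m0))|exact: nice_gauss_at|move=> x].
have g0 := gauss_gt0 (m^-1 * x + 3 * t / m); have g1 := gauss_le1 (m^-1 * x + 3 * t / m).
have := norm_cos_le1 (1 * x + b); rewrite /packet_at ler_norml.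
move: (gauss _) (cos _) g0 g1 => g c g0 g1 c1.
have : 0 <= c ^+ 2 <= 1 by nra.
rewrite exprMn; have : 0 <= g ^+ 2 <= g by nra.
by nra.
Qed.

Lemma norm_integ_packet_le (w : R -> R) t m b (K : R) : nice w -> 0 < m -> 0 <= K ->
  integ (fun x => w x ^+ 2) * (m * cg) <= K ^+ 2 -> `|integ (fun x => w x * packet_at t m b x)| <= K.
Proof.
move=> nw m0 K0 hK; rewrite -(@ler_pXn2r _ 2) ?nnegrE// real_normK ?num_real//.
apply: le_trans (integ_CS nw (nice_packet_at t b m0)) _; apply: le_trans hK.
rewrite ler_wpM2l ?integ_packet_sqr_le// integ_ge0// => x; exact: sqr_ge0.
Qed.

(** In the variable z of the Gaussian the width D/8 turns the penalty into (17/64) z^2, and the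
    second moment equals the mass. The oscillating half of 2 cos^2 contributes at most gauss(2 m) <=
    1/10, so a fraction 1 - 11/100 - 17/64 - 1/10 > 1/2 of the mass remains. *)
Lemma integ_gap_profile L t b D m : 8 <= D -> 3 <= L -> m = D / 8 * L ->
  let F x := (2 * cos (x + b) ^+ 2 - 11 / 100
    - 17 * (L^-1 * (x + 3 * t) / D) ^+ 2) * gauss (m^-1 * x + 3 * t / m) in
  nice F /\ cg * m / 2 <= integ F.
Proof.
move=> D8 L3 mE F; have m3 : 3 <= m by rewrite mE; nra.
have m0 : 0 < m by lra.
have L0 : 0 < L by lra.
have D0 : 0 < D by lra.
have ng : nice (@gauss R) := schwartz_nice (@schwartz_gauss R).
have nzg := @nice_sqr_gauss R.
pose h z := 89 / 100 * gauss z + gauss z * cos ((2 * m) * z + (2 * b - 6 * t))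
   - 17 / 64 * (z ^+ 2 * gauss z).
have nh : nice h by apply: niceB; [apply: niceD; [exact: niceZ|exact: nice_mul_cos]|exact: niceZ].
have -> : F = fun x => h (m^-1 * x + 3 * t / m).
  apply/funext => x; rewrite /F /h; set z := _ + _ / m.
  have ez : L^-1 * (x + 3 * t) / D = z / 8 by rewrite /z mE; field; rewrite !gt_eqF.
  have ec : (2 * m) * z + (2 * b - 6 * t) = (x + b) *+ 2 by rewrite /z mulr2n; field; rewrite gt_eqF.
  by rewrite ez ec cos_mulr2n; field.
split; first by apply: nice_affine nh; rewrite gt_eqF// invr_gt0.
rewrite integ_affine ?invr_gt0// invrK /h.
rewrite integB; [|by apply: niceD; [exact: niceZ|exact: nice_mul_cos]|exact: niceZ].
rewrite integD; [|exact: niceZ|exact: nice_mul_cos].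
rewrite !integZ// integ_gauss_cos integ_sqr_gauss -/(gauss_mass R) -/cg.
have := norm_cos_le1 (2 * b - 6 * t); rewrite ler_norml.
have : 0 < gauss (2 * m) <= 1 / 10.
  rewrite gauss_gt0 /= /gauss expRN mul1r lef_pV2 ?posrE ?expR_gt0//.
  by apply: le_trans (expR_ge1Dx _); nra.
move: (gauss _) (cos _) => g c hg hc.
have : - (1 / 10) <= g * c by nra.
have c0 : 0 < cg := gauss_mass_gt0 R.
have : 0 < m * cg by rewrite mulr_gt0.
by nra.
Qed.

(** Here mu stands for a L and ell for D/8. By Cauchy-Schwarz the approximation error changes the
    pairing by at most a tenth of a m [cg], as soon as mu is large in terms of C. *)
Lemma wkb_error_le (A C L mu ell : R) : 0 < L -> 1 <= ell -> 0 < C ->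
  1 + C + 100 * C / cg <= mu -> L * A <= C / mu ^+ 2 ->
  A * (ell * L * cg) <= (mu * ell * cg / 10) ^+ 2.
Proof.
move=> L0 ell1 C0 hmu hA; have c0 : 0 < cg := gauss_mass_gt0 R.
have q0 : 0 < 100 * C / cg by rewrite divr_gt0// mulr_gt0.
have mu1 : 1 <= mu by lra.
have mu0 : 0 < mu by lra.
have hc : 100 * C <= mu * cg by rewrite -ler_pdivrMr//; lra.
rewrite (_ : A * _ = L * A * (ell * cg)); last by ring.
have ec0 : 0 < ell * cg by rewrite mulr_gt0//; lra.
apply: (le_trans (ler_wpM2r (ltW ec0) hA)).
rewrite mulrAC ler_pdivrMr ?exprn_gt0//.
rewrite (_ : _ ^+ 2 * _ = 100^-1 * (ell * cg) * (mu ^+ 4 * cg * ell)); last by field.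
rewrite (_ : C * _ = 100^-1 * (ell * cg) * (100 * C)); last by field.
rewrite ler_pM2l; last by rewrite mulr_gt0// invr_gt0.
apply: (le_trans hc); rewrite -[leLHS]mulr1 ler_pM//; [by rewrite mulr_ge0// ltW|].
by rewrite ler_pM2r// exprS ler_peMr ?exprn_ege1// ltW.
Qed.

(** The ansatz contributes a m [cg] / 2 to the pairing, and each of the two approximation errors
    removes at most a tenth of a m [cg], leaving 3/10. *)
Theorem decoherence D del Phi : 8 <= D -> 0 <= del <= 1 / 100 -> 0 <= Phi ->
  Phi * (2 * del + del ^+ 2) = pi -> (5 * Phi + 12) * (2 * expR (- (D / 2))) <= 1 / 10 ->
  exists mu0 : R, forall a L t m, 0 < a -> 10 * a <= 1 -> 3 <= L -> ((1 + del) * a) ^+ 2 * L <= 1 ->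
    mu0 <= a * L -> 3 / 2 * (a ^+ 2 * t) = Phi -> m = D / 8 * L ->
  forall u v, mkdv_family u -> mkdv_family v ->
    (forall x, u 0%N 0 x = a * plat D (x / L) * cos x) ->
    (forall x, v 0%N 0 x = (1 + del) * a * plat D (x / L) * cos x) ->
  3 / 10 * (a * m * cg) <= integ (fun x => (u 0%N t x - v 0%N t x) * packet_at t m (t + Phi) x).
Proof.
move=> D8 hdel Phi0 hPhi hD; have c0 : 0 < cg := gauss_mass_gt0 R.
have D0 : 0 < D by lra.
have [C C0 hC] := wkb_approximation (@hder_plat R D) (@hder_plat_d R D) (@hder_plat_e1 R D)
  (fun y => ltW (plat_gt0 D y)) (@plat_le1 R D) (@plat_d_le1 R D) (@plat_e1_le R D)
  (@plat_e2_le R D) (schwartz_nice (schwartz_plat D)) (@continuous_plat_e2 R D) Phi0.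
exists (1 + C + 100 * C / cg) => a L t m a0 a1 L3 haL hmu ht mE u v hu hv u0 v0.
have L0 : 0 < L by lra.
have ell1 : 1 <= D / 8 by lra.
have m0 : 0 < m by rewrite mE mulr_gt0//; lra.
have t0 : 0 <= t.
  have a20 : 0 < a ^+ 2 by rewrite exprn_gt0.
  by rewrite -(pmulr_rge0 _ a20); lra.
have tt : 0 <= t <= t by rewrite t0 lexx.
set b := (1 + del) * a in haL v0 *.
have ab : a <= b by rewrite /b; nra.
have b0 : 0 < b := lt_le_trans a0 ab.
have b1 : b <= 1 by rewrite /b; nra.
have mu1 : 1 <= a * L.
  have q0 : 0 < 100 * C / cg by rewrite divr_gt0// mulr_gt0.
  by lra.
have muC : C <= (a * L) ^+ 2.
  have q0 : 0 < 100 * C / cg by rewrite divr_gt0// mulr_gt0.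
  have : C <= a * L by lra.
  by rewrite expr2; nra.
have abL : a * L <= b * L by rewrite ler_pM2r.
have mubC : C <= (b * L) ^+ 2.
  by apply: le_trans muC _; rewrite lerXn2r// nnegrE; lra.
have aLsq : a ^+ 2 * L <= 1.
  by apply: le_trans haL; rewrite ler_pM2r// lerXn2r// nnegrE ltW.
have aPhi : a ^+ 2 * t <= Phi by lra.
have bPhi : b ^+ 2 * t <= Phi.
  rewrite /b exprMn -mulrA; have : (1 + del) ^+ 2 <= 3 / 2 by nra.
  have : 0 <= a ^+ 2 * t by rewrite mulr_ge0// sqr_ge0.
  by move=> ? ?; nra.
have Eu := hC a L t a0 _ _ aLsq t0 aPhi muC u hu u0 t tt.
have Ev := hC b L t b0 b1 _ haL t0 bPhi mubC v hv v0 t tt.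
have {}Eu : L * integ (fun x => (u 0%N t x - U D a L t x) ^+ 2) <= C / (a * L) ^+ 2.
  by apply: Eu; lra.
have {}Ev : L * integ (fun x => (v 0%N t x - U D b L t x) ^+ 2) <= C / (a * L) ^+ 2.
  apply: le_trans (Ev _) _; first by lra.
  rewrite ler_pM2l// lef_pV2 ?posrE ?exprn_gt0 ?(mulr_gt0 a0 L0) ?(mulr_gt0 b0 L0)//.
  by rewrite lerXn2r// nnegrE; lra.
pose p := packet_at t m (t + Phi).
have np : nice p := nice_packet_at _ _ m0.
have nu : nice (u 0%N t) := lnice_nice (fam_nice hu 0%N t).
have nv : nice (v 0%N t) := lnice_nice (fam_nice hv 0%N t).
have nU c : nice (U D c L t).
  apply: (@lnice_nice _ t (wkbU (plat D) (plat_d D) (plat_e1 D) (plat_e2 D) c L 0)).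
  by apply: wkbU_nice => //; [exact: hder_plat|exact: hder_plat_d|exact: hder_plat_e1|
    exact: plat_d_le1|exact: plat_e1_le|exact: plat_e2_le|exact: schwartz_nice (schwartz_plat D)|
    exact: continuous_plat_e2].
have nUa := nU a; have nUb := nU b.
have nwu := niceB nu nUa; have nwv := niceB nv nUb.
have K0 : 0 <= a * m * cg / 10 by rewrite !mulr_ge0// ltW.
have err A : L * A <= C / (a * L) ^+ 2 -> A * (m * cg) <= (a * m * cg / 10) ^+ 2.
  move=> /(wkb_error_le L0 ell1 C0 hmu); rewrite mE; congr (_ <= _).
  by congr (_ ^+ 2); ring.
have hwu := norm_integ_packet_le t (t + Phi) nwu m0 K0 (err _ Eu).
have hwv := norm_integ_packet_le t (t + Phi) nwv m0 K0 (err _ Ev).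
have gap : a * (cg * m / 2) <= integ (fun x => (U D a L t x - U D b L t x) * p x).
  have [nF hF] := integ_gap_profile t (t + Phi) D8 L3 mE.
  apply: le_trans (ler_wpM2l (ltW a0) hF) _.
  rewrite -integZ//; apply: le_integ; [exact: niceZ|exact/niceM/np/niceB|move=> x].
  rewrite /p /packet_at mul1r addrA mulrCA mulrA [leRHS]mulrCA [gauss _ * _]mulrC.
  rewrite ler_wpM2r ?(ltW (gauss_gt0 _))// mulrC.
  by have := wkb_gap L x D0 hdel Phi0 hPhi hD a0 a1 ht.
have -> : integ (fun x => (u 0%N t x - v 0%N t x) * packet_at t m (t + Phi) x) =
  integ (fun x => (U D a L t x - U D b L t x) * p x)
  + (integ (fun x => (u 0%N t x - U D a L t x) * p x) - integ (fun x => (v 0%N t x - U D b L t x) * p x)).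
  rewrite -integB; [|exact: niceM|exact: niceM].
  rewrite -integD; [|exact/niceM/np/niceB|by apply: niceB; exact: niceM].
  by apply: eq_integ => x; rewrite /p; ring.
move: hwu hwv; rewrite !ler_norml => /andP[hwu _] /andP[_ hwv].
by move: gap; rewrite (_ : a * (cg * m / 2) = 5 * (a * m * cg / 10)); last (by field); lra.
Qed.

End decoherence.

(** * Separation in the Sobolev norm and the choice of parameters *)

Section separation.
Variable R : realType.
Implicit Types (a L t x y s N D del Phi : R).
Local Notation cg := (gauss_mass R).

Lemma packet_weight_le s N sigma xi : - (1 / 4) < s < 1 / 4 -> 1 <= N -> 0 < sigma ->
  1 <= sigma ^+ 2 * N -> 1 <= N * sigma ->
  (1 + xi ^+ 2) `^ (- s) * packet_env sigma N xi ^+ 2 <=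
    64 * N `^ (2 * (- s)) * lor (sigma * (xi - N)).
Proof.
move=> hs N1 s0 h1 h2; have hs' : - (1 / 4) < - s < 1 / 4 by lra.
have w := sobolev_weight_le xi hs' N1 s0 h1 h2.
rewrite /packet_env; move: (sigma * (xi - N)) w => z w.
rewrite /lor ler_pdivlMr ?oneD_gt0//.
have g0 := gauss_gt0 z.
(* The envelope enters squared, so this bound supplies two factors 1 + z^2: one for the weight, one
   for the Lorentzian. Hence 64 = 16 * 2^2. *)
have hg : (1 + z ^+ 2) * gauss z <= 2.
  rewrite /gauss expRN ler_pdivrMr ?expR_gt0//.
  by have := expR_ge1Dx (z ^+ 2 / 2); lra.
have z0 := oneD_gt0 z; have M0 := powR_ge0 N (2 * - s).
have hg2 : ((1 + z ^+ 2) * gauss z) ^+ 2 <= 4.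
  rewrite (_ : 4 = 2 ^+ 2); last by ring.
  by rewrite lerXn2r ?nnegrE// mulr_ge0// ltW.
apply: (@le_trans _ _ (16 * N `^ (2 * - s) * (1 + z ^+ 2) * gauss z ^+ 2 * (1 + z ^+ 2))).
  by rewrite ler_wpM2r ?(ltW z0)// ler_wpM2r ?sqr_ge0.
rewrite (_ : _ * (1 + z ^+ 2) = 16 * N `^ (2 * - s) * ((1 + z ^+ 2) * gauss z) ^+ 2); last by ring.
by apply: le_trans (ler_wpM2l _ hg2) _; [rewrite mulr_ge0|lra].
Qed.

Lemma mkdv_solution_rescaled (u0 : R -> R) u N : 0 < N -> mkdv_solution u0 u ->
  exists2 v, mkdv_family v & forall t x, v 0%N t x = N^-1 * u (N^-1 ^+ 3 * t) (N^-1 * x).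
Proof.
move=> N0 /mkdv_solution_family hu; have Ni : 0 < N^-1 by rewrite invr_gt0.
by eexists; [exact: mkdv_family_rescale Ni hu|].
Qed.

(** Transfers [decoherence] to frequency N: the rescaled amplitude, length and time are a/N, N L and
    N^3 t. The pairing with the packet then contradicts a small H^s norm through
    [hs_norm_packet_lower]. *)
Theorem solutions_separate D del Phi : 8 <= D -> 0 <= del <= 1 / 100 -> 0 <= Phi ->
  Phi * (2 * del + del ^+ 2) = pi -> (5 * Phi + 12) * (2 * expR (- (D / 2))) <= 1 / 10 ->
  exists mu0 : R, forall s N L a t u v (b : distr R) eps, - (1 / 4) < s < 1 / 4 ->
    0 < a -> 0 < L -> 1 <= N -> 10 * a <= N -> 3 <= N * L -> 1 <= L ^+ 2 * N ->
    ((1 + del) * a) ^+ 2 * L <= N -> mu0 <= a * L -> 3 / 2 * (a ^+ 2 * N * t) = Phi ->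
    N `^ (2 * s) * a ^+ 2 * L * D = 1 ->
    mkdv_solution (wave D a L N) u -> mkdv_solution (wave D ((1 + del) * a) L N) v ->
    (forall phi, schwartz phi -> b phi = integ (fun x => (u t x - v t x) * phi x)) ->
    0 < eps -> 20 * 20 * eps <= cg ^+ 2 -> ~ (hs_norm s b <= eps%:E)%E.
Proof.
move=> D8 hdel Phi0 hPhi hD.
have [mu0 hmu0] := decoherence D8 hdel Phi0 hPhi hD.
exists mu0 => s N L a t u v b eps hs a0 L0 N1 aN NL3 LN1 aLN hmu ht hone hu hv hb eps0 heps hle.
have N0 : 0 < N := lt_le_trans ltr01 N1.
have Nn0 : N != 0 by rewrite gt_eqF.
have Ni0 : 0 < N^-1 by rewrite invr_gt0.
have D0 : 0 < D by lra.
have c0 : 0 < cg := gauss_mass_gt0 R.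
pose sigma := D / 8 * L.
have Ls : L <= sigma by rewrite /sigma ler_peMl ?(ltW L0)//; lra.
have s0 : 0 < sigma by apply: lt_le_trans Ls.
have sN1 : 1 <= sigma ^+ 2 * N.
  apply: le_trans LN1 _; rewrite ler_pM2r// lerXn2r// nnegrE ltW//.
have Ns1 : 1 <= N * sigma.
  have : N * L <= N * sigma by rewrite ler_pM2l.
  by lra.
pose K := 64 * N `^ (2 * (- s)).
have NP0 : 0 < N `^ (2 * (- s)) by rewrite powR_gt0.
have K0 : 0 < K by rewrite mulr_gt0.
have [su _ u0E] := hu; have [sv _ v0E] := hv.
have sut : schwartz (u t) by case: su => W [<- + _]; exact.
have svt : schwartz (v t) by case: sv => W [<- + _]; exact.
have nf : nice (fun x => u t x - v t x) by apply: niceB; exact: schwartz_nice.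
pose t' := N ^+ 3 * t.
have hK xi := packet_weight_le xi hs N1 s0 sN1 Ns1.
(* The packet sits at -3 t'/N = -3 N^2 t, where the wave has been carried by the group velocity, and
   has the phase N^3 t + Phi of the first solution on its plateau. *)
have := hs_norm_packet_lower (3 * t' / N) (t' + Phi) s0 nf K0 hb hK hle.
have [u' hu' u'E] := mkdv_solution_rescaled N0 hu.
have [v' hv' v'E] := mkdv_solution_rescaled N0 hv.
have tE : N^-1 ^+ 3 * t' = t by rewrite /t'; field.
have hI : 3 / 10 * (a * sigma * cg) <=
    integ (fun x => (u t x - v t x) * packet sigma N (3 * t' / N) (t' + Phi) x).
  have := hmu0 (a / N) (N * L) t' (N * sigma) _ _ NL3 _ _ _ _ u' v' hu' hv' _ _.
  rewrite (_ : a / N * (N * sigma) * cg = a * sigma * cg); last by field.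
  have np : nice (fun x => (u t x - v t x) * packet sigma N (3 * t' / N) (t' + Phi) x).
    exact: niceM nf (schwartz_nice (schwartz_packet _ _ _ s0)).
  rewrite (_ : integ (fun x => (u' 0%N t' x - v' 0%N t' x) * _) =
     N^-1 * integ (fun x => (fun x => (u t x - v t x) * packet sigma N (3 * t' / N) (t' + Phi) x)
       (N^-1 * x + 0))); last first.
    rewrite -integZ; last by apply: nice_affine np; rewrite gt_eqF.
    apply: eq_integ => x; rewrite u'E v'E tE addr0 /packet_at /packet.
    rewrite (_ : (N * sigma)^-1 * x + 3 * t' / (N * sigma) = (3 * t' / N + N^-1 * x) / sigma); last first.
      by field; rewrite Nn0 gt_eqF.
    by rewrite (_ : N * (N^-1 * x) = 1 * x); [ring|field].
  rewrite (integ_affine _ Ni0 np) invrK mulKf//; apply.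
  - by rewrite divr_gt0.
  - by rewrite mulrA ler_pdivrMr// mul1r.
  - rewrite (_ : _ ^+ 2 * _ = ((1 + del) * a) ^+ 2 * L / N); last by field.
    by rewrite ler_pdivrMr// mul1r.
  - by rewrite (_ : a / N * _ = a * L)//; field.
  - by rewrite -ht /t'; field.
  - by rewrite /sigma; ring.
  - by move=> x; rewrite u'E mulr0 u0E /wave mulVKf// (_ : N^-1 * x / L = x / (N * L)); [ring|field; rewrite Nn0 gt_eqF].
  - by move=> x; rewrite v'E mulr0 v0E /wave mulVKf// (_ : N^-1 * x / L = x / (N * L)); [ring|field; rewrite Nn0 gt_eqF].
set I := integ _ in hI *.
have hI2 : 3 / 10 * (a * cg ^+ 2) <= cg / sigma * I.
  rewrite (_ : 3 / 10 * (a * cg ^+ 2) = cg / sigma * (3 / 10 * (a * sigma * cg))); last by field; rewrite gt_eqF.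
  by rewrite ler_pM2l// divr_gt0.
move=> /(le_trans (ler_norm _)) /(le_trans hI2).
apply/negP; rewrite -ltNge.
have l0 : 0 < 3 / 10 * (a * cg ^+ 2) by rewrite !mulr_gt0// ?exprn_gt0//; lra.
have q0 : 0 < cg ^+ 2 by rewrite exprn_gt0.
have kp0 : 0 < K * pi / sigma by rewrite divr_gt0// mulr_gt0// pi_gt0.
have r0 : 0 <= 2 * eps * Num.sqrt (K * pi / sigma) by rewrite !mulr_ge0 ?sqrtr_ge0// ltW.
rewrite -(@ltr_pXn2r _ 2) ?nnegrE ?(ltW l0)//.
rewrite exprMn sqr_sqrtr ?(ltW kp0)// (mulrA _ (K * pi)) ltr_pdivrMr//.
(* The normalisation makes a^2 sigma N^(2 s) equal to 1/8. The dual weight carries N^(-2 s) as well,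
   so N cancels from the comparison. *)
have hone' : a ^+ 2 * sigma = N `^ (2 * - s) / 8.
  have e1 : N `^ (2 * - s) * N `^ (2 * s) = 1.
    by rewrite mulrN powRN mulVf// gt_eqF// powR_gt0.
  move: e1 hone; rewrite /sigma; move: (N `^ (2 * - s)) (N `^ (2 * s)) => p q e1 hone'.
  transitivity (p * (q * a ^+ 2 * L * D) / 8); last by rewrite hone' mulr1.
  rewrite (_ : p * _ = p * q * (a ^+ 2 * L * D)); last by ring.
  by rewrite e1; field.
rewrite [ltRHS](_ : _ = 9 / 100 * cg ^+ 4 * (a ^+ 2 * sigma)); last by field.
rewrite hone' /K [ltLHS](_ : _ = 256 * pi * eps ^+ 2 * N `^ (2 * - s)); last by ring.
rewrite [ltRHS](_ : _ = 9 / 800 * cg ^+ 4 * N `^ (2 * - s)); last by field.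
rewrite ltr_pM2r//.
(* With pi <= 4 and eps <= [cg]^2 / 400, the left side is at most 1024/160000 of [cg]^4, below
   9/800. *)
have e2 : 20 * 20 * (20 * 20) * eps ^+ 2 <= cg ^+ 4.
  rewrite (_ : cg ^+ 4 = cg ^+ 2 * cg ^+ 2); last by ring.
  rewrite (_ : _ * eps ^+ 2 = 20 * 20 * eps * (20 * 20 * eps)); last by ring.
  have h0 : 0 <= 20 * 20 * eps by rewrite mulr_ge0// ltW.
  by apply: ler_pM.
have c4 : 0 < cg ^+ 4 by rewrite exprn_gt0.
have := pi_le4 R; have p0 := pi_gt0 R; have := exprn_gt0 2 eps0.
move=> q2 pi4; have e3 : pi * eps ^+ 2 <= 4 * eps ^+ 2 by rewrite ler_pM2r.
by rewrite -mulrA; lra.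
Qed.

Lemma distr_of_wave_le s D c a L N (b : distr R) : 1 <= D -> - (1 / 4) < s < 1 / 4 -> 0 < L ->
  1 <= N -> 1 <= L ^+ 2 * N -> 1 <= N * L -> N `^ (2 * s) * a ^+ 2 * L * D = 1 ->
  (forall phi, nice (fun x => wave D a L N x * phi x) ->
    b phi = c * integ (fun x => wave D a L N x * phi x)) ->
  (hs_norm s b <= (`|c| * Num.sqrt ((96 * 120) * pi ^+ 3))%:E)%E.
Proof.
move=> D1 hs L0 N1 LN1 NL1 hone hb; apply: (hs_norm_schwartz_le (schwartz_wave D a N L0) _ hb) => //.
apply: le_trans (integral_wave_le D1 a L0 hs N1 LN1 NL1) _; rewrite hone mulr1 sqr_sqrtr//.
by rewrite mulr_ge0// exprn_ge0// pi_ge0.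
Qed.

Lemma admissible_plateau Phi : 0 <= Phi ->
  exists2 D, 8 <= D & (5 * Phi + 12) * (2 * expR (- (D / 2))) <= 1 / 10.
Proof.
move=> Phi0; exists (8 + 2 * (20 * (5 * Phi + 12))); first by lra.
rewrite expRN mulrA ler_pdivrMr ?expR_gt0//.
apply: le_trans (ler_wpM2l _ (expR_ge1Dx _)); [lra|lra].
Qed.

(* [N = M^(1 / (1/4 - s))], [L = N^(1/2)], [a = D^(-1/2) N^(-(s + 1/4))] and [M] large *)
Lemma admissible_parameters s D del Phi mu0 T : - (1 / 4) < s < 1 / 4 -> 8 <= D ->
  0 <= del <= 1 / 100 -> 0 <= Phi -> 0 < T ->
  exists N L a t, [/\ 0 < a /\ 0 < L, [/\ 1 <= N, 10 * a <= N, 3 <= N * L & 1 <= L ^+ 2 * N],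
    ((1 + del) * a) ^+ 2 * L <= N /\ mu0 <= a * L,
    3 / 2 * (a ^+ 2 * N * t) = Phi /\ 0 <= t < T & N `^ (2 * s) * a ^+ 2 * L * D = 1].
Proof.
move=> hs D8 hdel Phi0 T0.
have D0 : 0 < D by lra.
pose q := Num.sqrt D; have q0 : 0 < q by rewrite sqrtr_gt0.
have qD : q ^+ 2 = D by rewrite sqr_sqrtr// ltW.
have qn : q != 0 by rewrite gt_eqF.
pose k := 1 / 4 - s; have k0 : 0 < k by rewrite /k; lra.
(* The second summand gives mu0 <= a L = M/q, the third makes the time less than T; 10 serves the
   remaining lower bounds. Here M = N^(1/4 - s), which can be made large because s < 1/4. *)
pose M := 10 + q * `|mu0| + 2 * Phi * D / (3 * T).
have m1 : 0 <= q * `|mu0| by rewrite mulr_ge0// ltW.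
have m2 : 0 <= 2 * Phi * D / (3 * T) by rewrite divr_ge0// !mulr_ge0// ltW.
have M10 : 10 <= M by rewrite /M; lra.
have M0 : 0 < M by lra.
pose N := M `^ k^-1.
have N0 : 0 < N by rewrite powR_gt0.
have Nk : N `^ k = M by rewrite /N -powRrM mulVf ?gt_eqF// powRr1// ltW.
have MN : M <= N.
  rewrite -[leLHS]powRr1 ?(ltW M0)// /N ler_powR//; first by lra.
  by rewrite invf_ge1//; rewrite /k; lra.
have N1 : 1 <= N by lra.
have pD x y : N `^ (x + y) = N `^ x * N `^ y.
  by rewrite powRD//; apply/implyP => _; rewrite gt_eqF.
pose L := N `^ (1 / 2); pose e := N `^ (- (s + 1 / 4)); pose a := q^-1 * e.
have L0 : 0 < L by rewrite powR_gt0.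
have e0 : 0 < e by rewrite powR_gt0.
have a0 : 0 < a by rewrite mulr_gt0// invr_gt0.
have L2 : L ^+ 2 = N.
  by rewrite expr2 -pD (_ : 1 / 2 + 1 / 2 = 1) ?powRr1//; [exact: ltW|lra].
have eL : e * L = M by rewrite /e /L -pD -Nk /k; congr (N `^ _); field.
have e1 : e <= 1.
  rewrite /e powRN invf_le1 ?powR_gt0//; have h : 0 <= s + 1 / 4 by lra.
  by have := ler_powR N1 h; rewrite powRr0.
have eN : N `^ (2 * s) * e ^+ 2 * L = 1.
  by rewrite expr2 /e /L -!pD (_ : _ + _ + _ = 0) ?powRr0//; field.
have L1 : 1 <= L.
  have h : 0 <= 1 / 2 :> R by lra.
  by have := ler_powR N1 h; rewrite powRr0.
have LN : L <= N by rewrite -L2 expr2 ler_peMl// ltW.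
have a1 : a <= 1.
  rewrite /a -[leRHS]mulr1 ler_pM//; [by rewrite invr_ge0 ltW|exact: ltW|].
  by rewrite invf_le1// -(@ler_pXn2r _ 2) ?nnegrE ?(ltW q0)// qD expr1n; lra.
have a2 : a ^+ 2 <= 1 / 8.
  rewrite /a exprMn exprVn qD -[leRHS]mulr1; apply: ler_pM.
  - by rewrite invr_ge0 ltW.
  - exact: sqr_ge0.
  - by rewrite div1r lef_pV2 ?posrE.
  - by rewrite expr_le1// ltW.
(* The time solves (3/2) a^2 N t = Phi, because a^2 N = M^2 / D. *)
exists N, L, a, (2 * Phi * D / (3 * M ^+ 2)); split=> //.
- split=> //.
  + by lra.
  + by have : N * 1 <= N * L; [rewrite ler_pM2l|lra].
  + by rewrite L2; nra.
- split.
    have : (1 + del) ^+ 2 <= 2 by nra.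
    rewrite exprMn => h; apply: le_trans LN; rewrite ler_piMl ?(ltW L0)//.
    by have := sqr_ge0 a; nra.
  rewrite /a -mulrA eL mulrC ler_pdivlMr//.
  by have := ler_norm mu0; rewrite /M; nra.
- split.
    rewrite /a exprMn exprVn qD -L2 (_ : _ * L ^+ 2 = D^-1 * M ^+ 2); last by rewrite -eL; ring.
    by field; rewrite !gt_eqF.
  rewrite divr_ge0 ?mulr_ge0 ?(ltW M0) ?(ltW D0)//=.
  have hM : 2 * Phi * D / (3 * T) < M by rewrite /M; lra.
  rewrite ltr_pdivrMr ?mulr_gt0 ?exprn_gt0//.
  rewrite ltr_pdivrMr ?mulr_gt0// in hM; apply: (lt_le_trans hM).
  have h : 0 <= M * (3 * T) by apply: mulr_ge0; [exact: ltW|apply: mulr_ge0; [|exact: ltW]].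
  rewrite (_ : T * (3 * M ^+ 2) = M * (M * (3 * T))); last by ring.
  by rewrite ler_peMl//; lra.
- rewrite /a exprMn exprVn qD (_ : _ * D = N `^ (2 * s) * e ^+ 2 * L)//.
  by field; rewrite gt_eqF.
Qed.

Variable S : (R -> R) -> R -> R -> R.
Hypothesis hS : mkdv_solution_operator S.

(** The bounds rho and eps are fixed before T and delta. The distance is bounded below for every b
    with the same action on Schwartz functions, because an extension of the solution map agrees with
    the solutions only in that sense. *)
Theorem norm_separation s : - (1 / 4) < s < 1 / 4 -> exists rho eps : R, [/\ 0 < rho, 0 < eps &
  forall T delta, 0 < T -> 0 < delta -> exists u0 v0 t,
  [/\ schwartz u0 /\ schwartz v0, t \in `]-T, T[,
      (hs_norm s (distr_of u0) < rho%:E)%E /\ (hs_norm s (distr_of v0) < rho%:E)%E,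
      (hs_norm s (distr_sub (distr_of u0) (distr_of v0)) < delta%:E)%E &
      forall b, eq_distr b (distr_sub (solution_distr S u0 t) (solution_distr S v0 t)) ->
        ~ (hs_norm s b <= eps%:E)%E]].
Proof.
move=> hs; pose B := Num.sqrt ((96 * 120) * pi ^+ 3) : R; have B0 : 0 <= B := sqrtr_ge0 _.
exists (2 * B + 1), ((cg / 20) ^+ 2); split; first by lra.
  by rewrite exprn_gt0// divr_gt0// gauss_mass_gt0.
move=> T delta T0 delta0.
(* The data differ by the factor del, hence by at most del B < delta in H^s. *)
pose del := Num.min (1 / 100) (delta / (B + 1)).
have del0 : 0 < del by rewrite /del lt_min !divr_gt0//; lra.
have hdel : 0 <= del <= 1 / 100 by rewrite (ltW del0) ge_min lexx.
have hdelta : del * B < delta.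
  have : del <= delta / (B + 1) by rewrite /del ge_min lexx orbT.
  rewrite ler_pdivlMr; last by lra.
  by apply: lt_le_trans; nra.
pose Phi := pi / (2 * del + del ^+ 2) : R.
have dd0 : 0 < 2 * del + del ^+ 2 by rewrite addr_gt0 ?mulr_gt0 ?exprn_gt0.
have Phi0 : 0 <= Phi by rewrite divr_ge0 ?pi_ge0 ?(ltW dd0).
have hPhi : Phi * (2 * del + del ^+ 2) = pi by rewrite mulfVK// gt_eqF.
have [D D8 hD] := admissible_plateau Phi0.
have [mu0 hsep] := solutions_separate D8 hdel Phi0 hPhi hD.
have [N [L [a [t [[a0 L0] [N1 aN NL3 LN1] [aLN hmu] [ht /andP[t0 tT]] hone]]]]] :=
  admissible_parameters mu0 hs D8 hdel Phi0 T0.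
have D1 : 1 <= D by lra.
have NL1 : 1 <= N * L by lra.
have su := schwartz_wave D a N L0; have sv := schwartz_wave D ((1 + del) * a) N L0.
have hle := distr_of_wave_le D1 hs L0 N1 LN1 NL1 hone.
have vE x : wave D ((1 + del) * a) L N x = (1 + del) * wave D a L N x by rewrite /wave; ring.
exists (wave D a L N), (wave D ((1 + del) * a) L N), t; split=> //.
- by rewrite in_itv/= tT andbT; lra.
- split.
    apply: le_lt_trans (hle 1 _ _) _; first by move=> phi _; rewrite mul1r.
    by rewrite lte_fin normr1 -/B; lra.
  apply: le_lt_trans (hle (1 + del) _ _) _.
    by move=> phi nphi; rewrite -integZ//; apply: eq_integ => x; rewrite vE mulrA.
  by rewrite lte_fin ger0_norm -/B; nra.
- apply: le_lt_trans (hle (- del) _ _) _.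
    move=> phi nphi; rewrite /distr_sub /distr_of -!/(integ _).
    rewrite (_ : integ (fun x => wave D ((1 + del) * a) L N x * phi x) =
      (1 + del) * integ (fun x => wave D a L N x * phi x)); first by ring.
    by rewrite -integZ//; apply: eq_integ => x; rewrite vE mulrA.
  by rewrite lte_fin normrN gtr0_norm.
- move=> b hb; have [hu _] := hS su; have [hv _] := hS sv.
  apply: (hsep s N L a t _ _ b _ hs a0 L0 N1 aN NL3 LN1 aLN hmu ht hone hu hv) => [phi sphi||]; last 2 first.
    by rewrite exprn_gt0// divr_gt0// gauss_mass_gt0.
    by rewrite (_ : 20 * 20 * _ = cg ^+ 2)//; field.
  have st u0 u : mkdv_solution u0 u -> nice (fun x : R => u t x * phi x).
    move=> [[W [<- sW _]] _ _]; exact: niceM (schwartz_nice (sW 0%N t)) (schwartz_nice sphi).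
  rewrite hb// /distr_sub /solution_distr /distr_of -!/(integ _) -integB; [|exact: st hu|exact: st hv].
  by apply: eq_integ => x; ring.
Qed.

End separation.

Theorem theorem4 (R : realType) (S : (R -> R) -> R -> R -> R)
    (hS : mkdv_solution_operator S)
    (s : R) (hs : - (1 / 4) < s < 1 / 4) :
  ~ locally_well_posed S s /\ ~ solution_operator_unif_continuous S s.
Proof.
have [rho [eps [rho0 eps0 hsep]]] := norm_separation hS hs.
split.
  move=> /(_ rho rho0)[T T0 [Phi [_ hcont hext] _]].
  have [delta delta0 hdelta] := hcont eps eps0.
  have [u0 [v0 [t [[su sv] tT [hu hv] huv hb]]]] := hsep T delta T0 delta0.
  have ball w : schwartz w -> (hs_norm s (distr_of w) < rho%:E)%E -> Hs_ball s rho (distr_of w).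
    move=> sw hw; split=> //; split; first exact/tempered_distr_of/schwartz_nice.
    exact: lt_trans hw (ltry _).
  have bu := ball _ su hu; have bv := ball _ sv hv.
  (* On Schwartz data the extension has the action of the solutions, so its modulus of continuity
     applies to a distribution that [norm_separation] keeps away from zero. *)
  apply: (hb (distr_sub (Phi (distr_of u0) t) (Phi (distr_of v0) t))).
    by move=> phi sphi; rewrite /distr_sub (hext u0)// (hext v0).
  apply: le_trans (hdelta _ _ bu bv huv).
  by apply: ereal_sup_ubound; exists t.
move=> /(_ rho rho0)[T T0 /(_ eps eps0)[delta delta0 hdelta]].
have [u0 [v0 [t [[su sv] tT [hu hv] huv hb]]]] := hsep T delta T0 delta0.
apply: (hb (distr_sub (solution_distr S u0 t) (solution_distr S v0 t))); first by [].
apply: le_trans (hdelta u0 v0 su sv hu hv huv).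
by apply: ereal_sup_ubound; exists t.
Qed.
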